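(* For each $n\ge1$ let $\theta\in\mathbb{R}^n$, $\hat\theta_0\in\mathbb{R}^n$ with $\|\hat\theta_0\|=\sqrt n$, and binary vectors $\delta_t\in\{0,1\}^n$ ($t\in\mathbb{N}_0$) with $\delta_0=\mathsf{1}$ be deterministic, and let $M=\frac{\lambda}{n}\theta\theta^\top+Z$ with fixed $\lambda\ge0$ and $Z\sim\mathsf{GOE}(n)$. Assume that for each $t\in\mathbb{N}_0$ the joint empirical measure of $\{(\theta_i,\hat\theta_{0i},\delta_{0i},\dots,\delta_{ti}):i\in[n]\}$ converges in quadratic Wasserstein distance, as $n\to\infty$, to a product measure $\mu\otimes\nu_t$, where $\mu$ is a probability measure on $\mathbb{R}^2$ (fixed, independent of $t$) whose two marginals have unit second moments, and $\nu_t$ is the law of the corresponding initial entries of a random binary string drawn from a probability measure $\nu$ on $\{0,1\}^{\mathbb{N}_0}$. Let $\tau(t,i)=\max\{s\in\{0,\dots,t-1\}:\delta_{si}=1\}$, $w_{ts}=\sum_{i=1}^n\mathbf{1}\{\tau(t,i)=s\}$, and for $0\le s<t$ let $p_t(s)=\nu(\{\omega:\omega_s=1,\omega_{s+1}=\dots=\omega_{t-1}=0\})$. Generate, starting from $\hat\theta_0$, $$x_t=\delta_t\circ\Big(M\hat\theta_t-\frac{1}{\sqrt n\,\|x_{t-1}\|}\sum_{s<t}w_{ts}\hat\theta_s\Big)+(\mathsf{1}-\delta_t)\circ x_{t-1},\qquad\hat\theta_{t+1}=\frac{\sqrt n}{\|x_t\|}x_t,$$ for $t=0,1,2,\dots$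 (for $t=0$ this reads $x_0=M\hat\theta_0$). Define $\rho_0=\int u\hat u\,d\mu(u,\hat u)$ and, for $t\ge1$, $$\rho_t=\frac{\lambda\sum_{s<t}\rho_sp_t(s)}{\sqrt{\sum_{s<t}(\lambda^2\rho_s^2+1)p_t(s)}}.$$ Then for each $t\in\mathbb{N}$, $\big|\frac1n\langle\theta,\hat\theta_t\rangle-\rho_t\big|\xrightarrow[n\to\infty]{\mathrm{p}}0$.
   Context: $\mathsf{GOE}(n)$: symmetric $n\times n$ random matrix with independent $\mathsf{N}(0,1/n)$ entries above the diagonal and independent $\mathsf{N}(0,2/n)$ diagonal entries. $\circ$ is the entrywise (Hadamard) product and $\mathsf{1}$ the all-ones vector. *)

(* Defs.v *)
From HB Require Import structures.
From mathcomp Require Import all_boot all_order all_algebra.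
From mathcomp Require Import all_classical all_reals all_analysis.

Set Implicit Arguments.
Unset Strict Implicit.
Unset Printing Implicit Defensive.

Import Order.TTheory GRing.Theory Num.Theory.
Local Open Scope classical_set_scope.
Local Open Scope ring_scope.

Section defs.
Context {R : realType}.

Definition vdot n (a b : 'cV[R]_n) : R := \sum_(i < n) a i 0 * b i 0.
Definition vnorm n (a : 'cV[R]_n) : R := Num.sqrt (vdot a a).
Definition bits_vec n (d : 'I_n -> bool) : 'cV[R]_n := \col_i (d i)%:R.
Definition hadamard n (a b : 'cV[R]_n) : 'cV[R]_n := \col_i (a i 0 * b i 0).
Definition ones n : 'cV[R]_n := \col_i 1.

Definition mutually_independent d (Om : measurableType d) (P : probability Om R)
    (I : finType) (X : I -> Om -> R) : Prop :=
  forall (S : {set I}) (A : I -> set R), (forall i, measurable (A i)) ->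
    P (\bigcap_(i in [set i | i \in S]) (X i @^-1` A i)) =
    (\prod_(i in S) P (X i @^-1` A i))%E.

(* Z ~ GOE(n): symmetric, entries above the diagonal N(0,1/n), diagonal
   entries N(0,2/n), the entries on and above the diagonal independent.
   (normal_prob m s has mean m and standard deviation s.) *)
Definition is_GOE d (Om : measurableType d) (P : probability Om R) (n : nat)
    (Z : Om -> 'M[R]_n) : Prop :=
  [/\ forall w, (Z w)^T = Z w,
      forall i j, measurable_fun setT (fun w => Z w i j),
      forall (i j : 'I_n), (i < j)%N -> forall A : set R, measurable A ->
        pushforward P (fun w => Z w i j) A =
        normal_prob 0 (Num.sqrt (n%:R^-1)) A,
      forall (i : 'I_n) (A : set R), measurable A ->
        pushforward P (fun w => Z w i i) A =
        normal_prob 0 (Num.sqrt (2 / n%:R)) A &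
      mutually_independent P
        (fun p : {p : 'I_n * 'I_n | (p.1 <= p.2)%N} =>
           fun w => Z w (val p).1 (val p).2)].

Definition cylinder_gen : set (set (nat -> bool)) :=
  [set A | exists (s : nat) (b : bool), A = [set w | w s = b]].
Definition bitstrings := g_sigma_algebraType cylinder_gen.

Definition init_bits (t : nat) (w : bitstrings) : (t.+1).-tuple bool :=
  [tuple w (nat_of_ord s) | s < t.+1].

Definition p_last (nu : set bitstrings -> \bar R) (t s : nat) : R :=
  fine (nu [set w : bitstrings | w s = true /\
                                 forall r, (s < r)%N -> (r < t)%N -> w r = false]).

Fixpoint rho_seq (lambda rho0 : R) (p : nat -> nat -> R) (t : nat) : seq R :=
  match t with
  | 0 => [:: rho0]
  | t'.+1 =>
      let rs := rho_seq lambda rho0 p t' in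
      let r s := nth 0 rs s in
      rcons rs
        (lambda * (\sum_(s < t) r s * p t s) /
         Num.sqrt (\sum_(s < t) (lambda ^+ 2 * (r s) ^+ 2 + 1) * p t s))
  end.
Definition rho (lambda rho0 : R) (p : nat -> nat -> R) (t : nat) : R :=
  nth 0 (rho_seq lambda rho0 p t) t.

Definition tau n (delta : nat -> 'I_n -> bool) (t : nat) (i : 'I_n) : nat :=
  (\max_(s < t | delta s i) s)%N.
Definition wts n (delta : nat -> 'I_n -> bool) (t s : nat) : R :=
  #|[set i : 'I_n | tau delta t i == s]|%:R.

(* amp_iter t = ([:: th_0; ...; th_{t}], x_{t-1})  (x_{-1} := 0, irrelevant
   because delta_0 = 1) *)
Fixpoint amp_iter n (M : 'M[R]_n) (th0 : 'cV[R]_n) (delta : nat -> 'I_n -> bool)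
    (t : nat) : seq 'cV[R]_n * 'cV[R]_n :=
  match t with
  | 0 => ([:: th0], 0)
  | t'.+1 =>
      let: (ths, xprev) := amp_iter M th0 delta t' in
      let th s := nth 0 ths s in
      let xt := hadamard (bits_vec (delta t'))
                  (M *m th t' -
                   (Num.sqrt n%:R * vnorm xprev)^-1 *:
                     \sum_(s < t') wts delta t' s *: th s)
                + hadamard (ones n - bits_vec (delta t')) xprev in
      (rcons ths ((Num.sqrt n%:R / vnorm xt) *: xt), xt)
  end.
Definition theta_hat n (M : 'M[R]_n) (th0 : 'cV[R]_n)
    (delta : nat -> 'I_n -> bool) (t : nat) : 'cV[R]_n :=
  nth 0 (amp_iter M th0 delta t).1 t.

Definition empirical d (T : measurableType d) n (z : 'I_n -> T) : set T -> \bar R :=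
  fun A => ((n%:R^-1 : R)%:E * \sum_(i < n) \d_(z i) A)%E.

Definition sqdist (k : nat) (a b : (R * R) * k.-tuple bool) : R :=
  (a.1.1 - b.1.1) ^+ 2 + (a.1.2 - b.1.2) ^+ 2 +
  \sum_(j < k) ((tnth a.2 j)%:R - (tnth b.2 j)%:R) ^+ 2.

Definition couplings d (T : measurableType d) (m1 m2 : set T -> \bar R) :
    set (probability (T * T)%type R) :=
  [set g | (forall A, measurable A -> g (A `*` setT) = m1 A) /\
           (forall B, measurable B -> g (setT `*` B) = m2 B)].

Definition W2sq (k : nat) (m1 m2 : set ((R * R) * k.-tuple bool) -> \bar R) : \bar R :=
  ereal_inf [set (\int[g]_z (sqdist z.1 z.2)%:E)%E | g in couplings m1 m2].

End defs.

(* Main.v *)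
(* Between two refreshes a coordinate keeps its value, so x_{t-1} = sum_s D_{ts} y_s, where
   D_{ts} is the diagonal 0/1 mask of the coordinates with tau(t,i) = s and
   y_s = lambda rho_s^n theta + g_s is the full update at time s, rho_s^n being the overlap
   of theta with theta_hat_s and g_s its pure-noise part.  Unfolding the recursion writes
   (theta_hat_t, g_t) as a combination of pairs (P(l)h, Q(l)h) with deterministic vectors h
   and scalar coefficients that converge in probability, where for a list l of masks
     Q([]) = Z, P([]) = 1, Q(D::l) = Z D Q(l) - <D> P(l), P(D::l) = D Q(l),
   and <D> is the normalized trace: the memory term of the algorithm is exactly the Wick
   subtraction.  The state evolution then reduces to two facts on the GOE,
     <v, Q(l)h>/n -> 0   and   <Q(l)h, D Q(l')h'>/n - <D> <P(l)h, P(l')h'>/n -> 0.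
   Both follow from Chebyshev's inequality: Gaussian integration by parts expresses the
   expectation of a product of bilinear forms in words in Z through words of lower degree
   (the loop equations), and induction on the degree bounds these expectations, shows that
   covariances are O(1/n), and evaluates the leading order. *)

Require Import Defs.
From HB Require Import structures.
From mathcomp Require Import all_boot all_order all_algebra.
From mathcomp Require Import all_classical all_reals all_analysis.
From mathcomp Require Import measurable_realfun.
From mathcomp Require Import -(notations) mpoly.
From mathcomp Require Import ring lra zify.

Set Implicit Arguments.
Unset Strict Implicit.
Unset Printing Implicit Defensive.

Import Order.TTheory GRing.Theory Num.Theory.
Import numFieldNormedType.Exports.
Local Open Scope classical_set_scope.
Local Open Scope ring_scope.

(** * Loop equations for words in a Gaussian symmetric matrix *)

(** The iterates are not polynomials in Z: each step divides by the norm of x, which is random and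
    depends on Z. Expectations are therefore taken only of words applied to deterministic vectors;
    the norms stay outside as scalar coefficients, of which only convergence in probability is used.
    The subtraction in Q works because of a closure property. Removing one letter Z from P(l) or
    Q(l) leaves a left and a right factor that are again of this kind, up to a mask, and the loop
    equation turns the left factor into its normalized trace. For P(D::l) the left factor is either
    D, whose trace <D> is what Q(D::l) subtracts, or D Q(m) D' with m shorter than D::l, whose
    normalized trace has mean O(1/n) by induction. The remaining terms, due to the symmetry of Z or
    to derivatives of other factors, contain no trace and keep the factor 1/n. All constants depend
    on degrees and lengths only: masks are contractions, vectors are scaled into the unit ball, and
    a normalized trace is an average of n bilinear forms. *)

Lemma norm_sum_le (R : numDomainType) (I : eqType) (s : seq I) (F : I -> R) (c : R) :
  (forall i, i \in s -> `|F i| <= c) -> `|\sum_(i <- s) F i| <= (size s)%:R * c.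
Proof.
elim: s => [|i s IH] h; first by rewrite big_nil normr0 mul0r.
rewrite big_cons /= -natr1 mulrDl mul1r addrC; apply: le_trans (ler_normD _ _) _.
apply: lerD; last by apply: h; rewrite mem_head.
by apply: IH => j js; apply: h; rewrite inE js orbT.
Qed.

(** Bounds, uniformly in n, the expectation of a product of total degree [N] in Z. Removing a first
    letter Z costs at most 2k + 2l terms of degree at most N - 1, where k + l = N - 1. *)
Fixpoint mom_bound (R : realFieldType) (N : nat) : R :=
  if N is m.+1 then (2 * N%:R + 1) * mom_bound R m else 1.

(** Bounds n times a covariance of total degree [N]: up to N covariances of lower degree, then the
    terms with an explicit 1/n, estimated by moments. The last summand makes monotonicity
    immediate. *)
Fixpoint cov_bound (R : realFieldType) (N : nat) : R :=
  if N is m.+1 then N%:R * cov_bound R m +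
    3 * N%:R * (mom_bound R m + mom_bound R m ^+ 2) + cov_bound R m else 0.

Lemma mom_bound_ge1 (R : realFieldType) N : 1 <= mom_bound R N.
Proof.
by elim: N => //= m IH; have : (0 : R) <= m.+1%:R by []; nra.
Qed.

Lemma cov_bound_ge0 (R : realFieldType) N : 0 <= cov_bound R N.
Proof.
elim: N => //= m IH; have := mom_bound_ge1 R m => h.
by rewrite !addr_ge0 ?mulr_ge0 ?addr_ge0 ?exprn_ge0 //; lra.
Qed.

Lemma mom_bound_le (R : realFieldType) N M : (N <= M)%N -> mom_bound R N <= mom_bound R M.
Proof.
move=> /subnK <-; elim: (M - N)%N => // m /le_trans; apply; rewrite addSn /=.
move: (m + N)%N => {}m; have := mom_bound_ge1 R m => h.
rewrite mulrDl mul1r lerDr mulr_ge0 ?mulr_ge0 //; lra.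
Qed.

Lemma cov_bound_le (R : realFieldType) N M : (N <= M)%N -> cov_bound R N <= cov_bound R M.
Proof.
move=> /subnK <-; elim: (M - N)%N => // m /le_trans; apply; rewrite addSn /=.
move: (m + N)%N => {}m; have := mom_bound_ge1 R m => h; have := cov_bound_ge0 R m => h'.
by rewrite lerDr !addr_ge0 ?mulr_ge0 ?addr_ge0 ?exprn_ge0 //; lra.
Qed.

(** n times the error in evaluating E(Y^T Q(l)): [N] and [B] are degree and coefficient sum of Y and
    of the factors of its derivative, [q] is the number of these pairs, [s] the length of l, and c/n
    bounds the means of shorter Q words. The [s] terms come from differentiating P(l), the [q] terms
    from Y. *)
Definition wick_error (R : realFieldType) (c : R) (N : nat) (B : R) (q s : nat) : R :=
  s%:R * (c * (mom_bound R (N + s) * (B * 2 ^+ s)) +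
          cov_bound R (s + (N + s)) * 2 ^+ s * (B * 2 ^+ s) +
          mom_bound R (N + s + s) * (B * 2 ^+ s * 2 ^+ s)) +
  q%:R * (mom_bound R (N + N + s) * (B * B * 2 ^+ s)).

(** The case Y = 1 of [wick_error], iterated over the length. *)
Fixpoint wick_bound (R : realFieldType) (s : nat) : R :=
  if s is s'.+1 then wick_bound R s' + wick_error (wick_bound R s') 0 1 0 s else 0.

Lemma wick_error_ge0 (R : realFieldType) (c : R) N B q s :
  0 <= c -> 0 <= B -> 0 <= wick_error c N B q s.
Proof.
move=> c0 B0; have m0 k : 0 <= mom_bound R k by exact: le_trans (mom_bound_ge1 _ _).
by rewrite /wick_error !(addr_ge0, mulr_ge0) ?exprn_ge0 ?cov_bound_ge0.
Qed.

Lemma wick_bound_ge0 (R : realFieldType) s : 0 <= wick_bound R s.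
Proof. by elim: s => //= s IH; rewrite addr_ge0 // wick_error_ge0. Qed.

(** Here Y = D Q(l), of degree a + 1, coefficient sum 2^a and with a + 1 pairs in its derivative.
    The summand with factor [a] bounds the traces from the pairs other than the leading one. *)
Definition wick_pair_error (R : realFieldType) (a b : nat) : R :=
  wick_error (wick_bound R b) a.+1 (2 ^+ a) a.+1 b +
  a%:R * (wick_bound R a * (mom_bound R (a + b) * (2 ^+ a * 2 ^+ b)) +
    cov_bound R (a + (a + b)) * 2 ^+ a * (2 ^+ a * 2 ^+ b)).

Definition wick_var (R : realFieldType) (s : nat) : R :=
  cov_bound R (s.+1 + s.+1) * 2 ^+ s * 2 ^+ s + wick_bound R s * wick_bound R s.

Definition wick_pair_var (R : realFieldType) (a b : nat) : R :=
  let B := 2 ^+ a * 2 ^+ b + 2 ^+ a * 2 ^+ b in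
  cov_bound R (a.+1 + b.+1 + (a.+1 + b.+1)) * B * B +
  wick_pair_error R a b * wick_pair_error R a b.

(* A stands for the polynomials in the entries of Z and E for the expectation; der a b
   differentiates in the symmetric direction e_a e_b^T + e_b e_a^T. *)
Section gaussian_calculus.
Variables (R : realFieldType) (A : comAlgType R) (n : nat).
Hypothesis n_gt0 : (0 < n)%N.
Variables (E : {scalar A}) (Z : 'M[A]_n) (der : 'I_n -> 'I_n -> {linear A -> A}).
Hypothesis Zsym : Z^T = Z.
Hypothesis derM : forall a b x y, der a b (x * y) = der a b x * y + x * der a b y.
Hypothesis derZ : forall a b c d,
  der a b (Z c d) = ((a == c) && (b == d))%:R + ((a == d) && (b == c))%:R.
Hypothesis E1 : E 1 = 1.
Hypothesis ibp : forall a b F, E (Z a b * F) = n%:R^-1 * E (der a b F).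

Let nz : (n%:R : R) != 0. Proof. by rewrite pnatr_eq0 -lt0n. Qed.

Lemma EZ c X : E (c *: X) = c * E X.
Proof. exact: linearZ. Qed.

Lemma der1 a b : der a b 1 = 0.
Proof.
by have /eqP := derM a b 1 1; rewrite !mulr1 mul1r -subr_eq subrr eq_sym => /eqP.
Qed.

Lemma der_alg a b (c : R) : der a b (c%:A) = 0.
Proof. by rewrite linearZ /= der1 scaler0. Qed.

(** * Matrix calculus for the derivations, and the loop equation *)

Definition cmx m p (u : 'M[R]_(m, p)) : 'M[A]_(m, p) := map_mx (in_alg A) u.
Definition dmx a b m p (W : 'M[A]_(m, p)) : 'M[A]_(m, p) := map_mx (der a b) W.
(* spl a b X Y is X (e_a e_b^T + e_b e_a^T) Y, the shape of the derivatives of words in Z. *)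
Definition spl a b (X Y : 'M[A]_n) : 'M[A]_n :=
  \matrix_(i, j) (X i a * Y b j + X i b * Y a j).
Definition bil (u v : 'cV[R]_n) (W : 'M[A]_n) : A :=
  ((cmx u)^T *m W *m cmx v) 0 0.
Definition Dg (d : 'rV[R]_n) : 'M[A]_n := diag_mx (cmx d).

Lemma dmxM a b m p q (W : 'M[A]_(m, p)) (V : 'M[A]_(p, q)) :
  dmx a b (W *m V) = dmx a b W *m V + W *m dmx a b V.
Proof.
apply/matrixP => i j; rewrite !mxE linear_sum -big_split /=.
by apply: eq_bigr => k _; rewrite derM !mxE.
Qed.

Lemma dmx_cst a b m p (u : 'M[R]_(m, p)) : dmx a b (cmx u) = 0.
Proof. by apply/matrixP => i j; rewrite !mxE /= der_alg. Qed.

Lemma dmxD a b m p (W V : 'M[A]_(m, p)) : dmx a b (W + V) = dmx a b W + dmx a b V.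
Proof. by apply/matrixP => i j; rewrite !mxE linearD. Qed.

Lemma dmxZ a b m p c (W : 'M[A]_(m, p)) : dmx a b (c%:A *: W) = c%:A *: dmx a b W.
Proof. by apply/matrixP => i j; rewrite !mxE -!scalerAl !mul1r linearZ. Qed.

Lemma dmx_Dg a b d : dmx a b (Dg d) = 0.
Proof.
apply/matrixP => i j; rewrite !mxE; case: eqP => _; last by rewrite mulr0n linear0.
by rewrite mulr1n /= der_alg.
Qed.

Lemma dmx_1 a b : dmx a b 1%:M = 0 :> 'M[A]_n.
Proof.
by apply/matrixP => i j; rewrite !mxE; case: eqP => _; rewrite ?mulr1n ?der1 ?mulr0n ?linear0.
Qed.

Lemma splMr a b X Y V : spl a b X Y *m V = spl a b X (Y *m V).
Proof.
apply/matrixP => i j; rewrite !mxE 2!mulr_sumr -big_split /=.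
by apply: eq_bigr => k _; rewrite !mxE mulrDl !mulrA.
Qed.

Lemma splMl a b X Y V : V *m spl a b X Y = spl a b (V *m X) Y.
Proof.
apply/matrixP => i j; rewrite !mxE 2!mulr_suml -big_split /=.
by apply: eq_bigr => k _; rewrite !mxE mulrDr !mulrA.
Qed.

Lemma splDl a b X X' Y : spl a b (X + X') Y = spl a b X Y + spl a b X' Y.
Proof. by apply/matrixP => i j; rewrite !mxE; ring. Qed.

Lemma splZl a b c X Y : spl a b (c *: X) Y = c *: spl a b X Y.
Proof. by apply/matrixP => i j; rewrite !mxE; ring. Qed.

Lemma dmx_Z a b : dmx a b Z = spl a b 1%:M 1%:M.
Proof.
apply/matrixP => i j; rewrite !mxE derZ -!natrM !mulnb (eq_sym i a) (eq_sym i b).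
by congr (_ + _%:R); rewrite andbC.
Qed.

(** The list does not depend on the direction: each pair consists of the left and the right factor
    that remain where a Z is removed. *)
Definition has_der (W : 'M[A]_n) (S : seq ('M[A]_n * 'M[A]_n)) :=
  forall a b, dmx a b W = \sum_(p <- S) spl a b p.1 p.2.

Lemma has_der_cst0 W : (forall a b, dmx a b W = 0) -> has_der W [::].
Proof. by move=> h a b; rewrite big_nil. Qed.

(** One of the two terms of [spl] closes the left factor into a trace, the other keeps both factors
    inside one bilinear form. Only the trace can compensate the 1/n of the integration by parts. *)
Lemma contr_row (p z : 'cV[A]_n) (X Y : 'M[A]_n) :
  \sum_a \sum_b (spl a b X Y *m p) a 0 * z b 0 =
  \tr X * ((Y *m p)^T *m z) 0 0 + ((Y *m p)^T *m (X *m z)) 0 0.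
Proof.
have spE a b : (spl a b X Y *m p) a 0 = X a a * (Y *m p) b 0 + X a b * (Y *m p) a 0.
  rewrite !mxE !mulr_sumr -big_split /=; apply: eq_bigr => k _.
  by rewrite !mxE mulrDl !mulrA.
rewrite /mxtrace mulr_suml [in X in _ + X]mxE -big_split /=; apply: eq_bigr => a _.
rewrite [in X in X + _]mxE [(_ *m z) a 0]mxE !mulr_sumr -big_split /=; apply: eq_bigr => b _.
by rewrite spE [(_ *m p)^T 0 a]mxE [(_ *m p)^T 0 b]mxE; ring.
Qed.

Lemma contr_col (y q : 'cV[A]_n) (X Y : 'M[A]_n) :
  \sum_a \sum_b y a 0 * (spl a b X Y *m q) b 0 =
  \tr X * (y^T *m (Y *m q)) 0 0 + ((X *m y)^T *m (Y *m q)) 0 0.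
Proof.
have spE a b : (spl a b X Y *m q) b 0 = X b a * (Y *m q) b 0 + X b b * (Y *m q) a 0.
  rewrite !mxE !mulr_sumr -big_split /=; apply: eq_bigr => k _.
  by rewrite !mxE mulrDl !mulrA.
rewrite exchange_big /= /mxtrace mulr_suml [in X in _ + X]mxE -big_split /=; apply: eq_bigr => b _.
rewrite [in X in X + _]mxE [(_ *m y)^T 0 b]mxE [(X *m y) b 0]mxE mulr_sumr mulr_suml -big_split /=; apply: eq_bigr => a _.
by rewrite spE [y^T 0 a]mxE; ring.
Qed.

(** The contribution of a further factor [G]: its derivative is contracted with both loose ends, so
    that bilinear forms are cut and reconnected without a trace. *)
Definition loop_merge (y z : 'cV[A]_n) (G : A) : A :=
  \sum_a \sum_b y a 0 * z b 0 * der a b G.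

Lemma mergeM y z G H : loop_merge y z (G * H) = loop_merge y z G * H + G * loop_merge y z H.
Proof.
rewrite /loop_merge mulr_suml mulr_sumr -big_split; apply: eq_bigr => a _ /=.
rewrite mulr_suml mulr_sumr -big_split; apply: eq_bigr => b _ /=.
by rewrite derM mulrDr mulrA; congr (_ + _); rewrite mulrCA.
Qed.

Lemma merge_cst y z (c : R) : loop_merge y z c%:A = 0.
Proof. by apply: big1 => a _; apply: big1 => b _; rewrite der_alg mulr0. Qed.

Lemma merge1 y z : loop_merge y z 1 = 0.
Proof. by apply: big1 => a _; apply: big1 => b _; rewrite der1 mulr0. Qed.

(** Expand in the entries of Z, integrate by parts entry by entry, and apply the Leibniz rule to the
    left vector, the right vector and [G]; summing over both indices contracts each derivative. *)
Lemma loop_equation (h v : 'cV[R]_n) (Y V : 'M[A]_n) SY SV G :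
  has_der Y SY -> has_der V SV ->
  E (bil h v (Y^T *m Z *m V) * G) = n%:R^-1 * (
    \sum_(p <- SV) (E (\tr p.1 * bil h v (Y^T *m p.2) * G) +
                    E (bil h v (Y^T *m p.1^T *m p.2) * G)) +
    \sum_(p <- SY) (E (\tr p.1 * bil h v (p.2^T *m V) * G) +
                    E (bil h v (p.2^T *m p.1 *m V) * G)) +
    E (loop_merge (Y *m cmx h) (V *m cmx v) G)).
Proof.
move=> dY dV.
set y := Y *m cmx h; set z := V *m cmx v.
have bilE : bil h v (Y^T *m Z *m V) * G =
    \sum_a \sum_b Z a b * (y a 0 * z b 0 * G).
  have -> : bil h v (Y^T *m Z *m V) = (y^T *m (Z *m z)) 0 0.
    by rewrite /bil trmx_mul !mulmxA.
  rewrite mxE mulr_suml; apply: eq_bigr => a _.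
  rewrite [(Z *m z) a 0]mxE [y^T 0 a]mxE mulr_sumr mulr_suml.
  by apply: eq_bigr => b _; ring.
have -> : E (bil h v (Y^T *m Z *m V) * G) =
    n%:R^-1 * E (\sum_a \sum_b der a b (y a 0 * z b 0 * G)).
  rewrite bilE !linear_sum mulr_sumr; apply: eq_bigr => a _.
  by rewrite !linear_sum mulr_sumr; apply: eq_bigr => b _; rewrite ibp.
congr (_ * _).
have dy a b i : der a b (y i 0) = \sum_(p <- SY) (spl a b p.1 p.2 *m cmx h) i 0.
  have -> : der a b (y i 0) = dmx a b y i 0 by rewrite [RHS]mxE.
  by rewrite /y dmxM dmx_cst mulmx0 addr0 dY mulmx_suml summxE.
have dz a b i : der a b (z i 0) = \sum_(p <- SV) (spl a b p.1 p.2 *m cmx v) i 0.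
  have -> : der a b (z i 0) = dmx a b z i 0 by rewrite [RHS]mxE.
  by rewrite /z dmxM dmx_cst mulmx0 addr0 dV mulmx_suml summxE.
have -> : \sum_a \sum_b der a b (y a 0 * z b 0 * G) =
    \sum_(p <- SV) (\sum_a \sum_b y a 0 * (spl a b p.1 p.2 *m cmx v) b 0) * G +
    \sum_(p <- SY) (\sum_a \sum_b (spl a b p.1 p.2 *m cmx h) a 0 * z b 0) * G +
    loop_merge y z G.
  rewrite /loop_merge -!mulr_suml [X in X * _ + _ + _]exchange_big /= [X in _ + X * _ + _]exchange_big /=.
  rewrite !mulr_suml -!big_split; apply: eq_bigr => a _ /=.
  rewrite [X in X * _ + _ + _]exchange_big /= [X in _ + X * _ + _]exchange_big /=.
  rewrite !mulr_suml -!big_split; apply: eq_bigr => b _ /=.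
  by rewrite !derM dy dz -mulr_sumr -mulr_suml; ring.
rewrite !linearD !linear_sum /=; congr (_ + _ + _); apply: eq_bigr => p _.
  rewrite contr_col -linearD -mulrDl; congr (E ((_ * _ + _) * _)).
    by rewrite /bil /y trmx_mul !mulmxA.
  by rewrite /bil /y !trmx_mul !mulmxA.
rewrite contr_row -linearD -mulrDl; congr (E ((_ * _ + _) * _)).
  by rewrite /bil /z trmx_mul !mulmxA.
by rewrite /bil /z !trmx_mul !mulmxA.
Qed.

Lemma bilD u v W V : bil u v (W + V) = bil u v W + bil u v V.
Proof. by rewrite /bil mulmxDr mulmxDl mxE. Qed.

Lemma bilZ u v (c : R) W : bil u v (c%:A *: W) = c *: bil u v W.
Proof. by rewrite /bil -scalemxAr -scalemxAl mxE -scalerAl mul1r. Qed.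

Lemma bil0 u v : bil u v 0 = 0.
Proof. by rewrite /bil mulmx0 mul0mx mxE. Qed.

Lemma bil_tr u v W : bil u v W^T = bil v u W.
Proof.
have -> : bil v u W = ((cmx v)^T *m W *m cmx u)^T 0 0 by rewrite [RHS]mxE.
by rewrite /bil !trmx_mul trmxK mulmxA.
Qed.

Lemma bil1 u v : bil u v 1%:M = (\sum_i u i 0 * v i 0)%:A.
Proof.
rewrite /bil mulmx1 mxE scaler_suml; apply: eq_bigr => i _.
by rewrite !mxE /= -scalerAl mul1r scalerA.
Qed.

Definition dscale (d : 'rV[R]_n) (u : 'cV[R]_n) : 'cV[R]_n := \col_i (d 0 i * u i 0).

Lemma Dg_cst d u : Dg d *m cmx u = cmx (dscale d u).
Proof.
apply/matrixP => i j; rewrite /Dg mul_diag_mx !mxE /= (ord1 j).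
by rewrite -scalerAl mul1r scalerA.
Qed.

Lemma Dg_tr d : (Dg d)^T = Dg d.
Proof. by rewrite /Dg tr_diag_mx. Qed.

Lemma bil_Dgl u v d W : bil u v (Dg d *m W) = bil (dscale d u) v W.
Proof. by rewrite /bil -Dg_cst trmx_mul Dg_tr !mulmxA. Qed.

Lemma bil_Dgr u v d W : bil u v (W *m Dg d) = bil u (dscale d v) W.
Proof. by rewrite /bil -Dg_cst !mulmxA. Qed.

Definition evec (i : 'I_n) : 'cV[R]_n := delta_mx i 0.

Lemma bil_evec i j W : bil (evec i) (evec j) W = W i j.
Proof.
have cE k : cmx (evec k) = delta_mx k 0.
  by apply/matrixP => a b; rewrite !mxE; case: (_ && _); rewrite /= ?scale1r ?scale0r.
by rewrite /bil !cE trmx_delta -rowE -colE !mxE.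
Qed.

(** Normalized traces thereby become averages of bilinear forms on unit vectors and need no class of
    their own. *)
Lemma trE W : \tr W = \sum_i bil (evec i) (evec i) W.
Proof. by apply: eq_bigr => i _; rewrite bil_evec. Qed.

(** * Words in Z and the masks, and products of bilinear forms *)

Definition unit_ball (u : 'cV[R]_n) := \sum_i u i 0 ^+ 2 <= 1.
Definition contraction (d : 'rV[R]_n) := forall i, `|d 0 i| <= 1.

Lemma ub_dscale d u : contraction d -> unit_ball u -> unit_ball (dscale d u).
Proof.
move=> hd; apply: le_trans; apply: ler_sum => i _; rewrite mxE exprMn.
rewrite -[leRHS]mul1r ler_wpM2r ?sqr_ge0 // -real_normK ?num_real //.
by rewrite expr_le1 // normr_ge0.
Qed.

Lemma ub_evec i : unit_ball (evec i).
Proof.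
rewrite /unit_ball (bigD1 i) //= big1 ?addr0; first by rewrite mxE !eqxx expr1n.
by move=> j ji; rewrite mxE (negbTE ji) expr0n.
Qed.

Lemma ub_dot u v : unit_ball u -> unit_ball v -> `|\sum_i u i 0 * v i 0| <= 1.
Proof.
move=> hu hv; apply: le_trans (ler_norm_sum _ _ _) _.
have h : \sum_i `|u i 0 * v i 0| <= \sum_i (u i 0 ^+ 2 + v i 0 ^+ 2) / 2.
  apply: ler_sum => i _; rewrite normrM -(real_normK (num_real (u i 0))).
  rewrite -(real_normK (num_real (v i 0))).
  have := sqr_ge0 (`|u i 0| - `|v i 0|); nra.
apply: le_trans h _; rewrite -mulr_suml big_split /=; move: hu hv; rewrite /unit_ball; lra.
Qed.

(** The index is the degree in Z. Masks are not counted, since they map the unit ball into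
    itself. *)
Inductive mword : nat -> 'M[A]_n -> Prop :=
| mw1 : mword 0 1%:M
| mwZ k W : mword k W -> mword k.+1 (Z *m W)
| mwD k W d : contraction d -> mword k W -> mword k (Dg d *m W).

Lemma mwordM k l W V : mword k W -> mword l V -> mword (k + l) (W *m V).
Proof.
move=> hW hV; elim: hW => [|{}k {}W _ IH|{}k {}W d hd _ IH].
- by rewrite mul1mx.
- by rewrite -mulmxA addSn; apply: mwZ.
- by rewrite -mulmxA; apply: mwD.
Qed.

Lemma mword_tr k W : mword k W -> mword k W^T.
Proof.
elim=> [|{}k {}W _ IH|{}k {}W d hd _ IH].
- by rewrite trmx1; exact: mw1.
- rewrite trmx_mul Zsym -addn1 -[Z]mulmx1; apply: mwordM => //.
  exact: mwZ mw1.
- rewrite trmx_mul Dg_tr -[k]addn0 -[Dg d]mulmx1; apply: mwordM => //.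
  exact: mwD hd mw1.
Qed.

Lemma mword_der k W : mword k W -> exists S, [/\ size S = k, has_der W S &
  forall p, p \in S -> exists i j, [/\ mword i p.1, mword j p.2 & (i + j).+1 = k]].
Proof.
elim=> [|{}k {}W hW [S [sS dS hS]]|{}k {}W d hd hW [S [sS dS hS]]].
- by exists [::]; split=> //; apply: has_der_cst0 => a b; exact: dmx_1.
- exists ((1%:M, W) :: [seq (Z *m p.1, p.2) | p <- S]); split.
  + by rewrite /= size_map sS.
  + move=> a b; rewrite dmxM dmx_Z big_cons big_map /= splMr mul1mx dS mulmx_sumr.
    by congr (_ + _); apply: eq_bigr => p _; rewrite splMl.
  + move=> p; rewrite inE => /predU1P[-> /=|/mapP[q /hS [i [j [hi hj ij]]] -> /=]].
      by exists 0%N, k; split => //; exact: mw1.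
    by exists i.+1, j; split => //; [exact: mwZ|rewrite addSn ij].
- exists [seq (Dg d *m p.1, p.2) | p <- S]; split.
  + by rewrite size_map.
  + move=> a b; rewrite dmxM dmx_Dg mul0mx add0r big_map dS mulmx_sumr.
    by apply: eq_bigr => p _; rewrite splMl.
  + move=> p /mapP[q /hS [i [j [hi hj ij]]] -> /=].
    by exists i, j; split => //; exact: mwD.
Qed.

Inductive tprod : nat -> A -> Prop :=
| tp_cst (c : R) : `|c| <= 1 -> tprod 0 c%:A
| tp_bil k u v W l X : unit_ball u -> unit_ball v -> mword k W -> tprod l X ->
    tprod (k + l) (bil u v W * X).

Lemma tprodZ k X (c : R) : `|c| <= 1 -> tprod k X -> tprod k (c *: X).
Proof.
move=> hc; elim=> [c' hc'|{}k u v W l {}X hu hv hW _ IH].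
  by rewrite scalerA; apply: tp_cst; rewrite normrM -[leRHS]mulr1 ler_pM.
by rewrite scalerAr; apply: tp_bil.
Qed.

Lemma tprodM k X l Y : tprod k X -> tprod l Y -> tprod (k + l) (X * Y).
Proof.
move=> hX hY; elim: hX => [c hc|{}k u v W l' {}X hu hv hW _ IH].
  by rewrite -scalerAl mul1r add0n; exact: tprodZ.
by rewrite -mulrA -addnA; apply: tp_bil.
Qed.

(* cls N B X: X is a linear combination of products of degree at most N whose coefficients
   have absolute values summing to at most B; mcls is the analogue for matrix words. *)
Inductive cls : nat -> R -> A -> Prop :=
| cls0 N : cls N 0 0
| clsT k N X : (k <= N)%N -> tprod k X -> cls N 1 X
| clsD N B X B' X' : cls N B X -> cls N B' X' -> cls N (B + B') (X + X')
| clsZ N B X (c : R) : cls N B X -> cls N (`|c| * B) (c *: X)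
| clsW N B B' X : B <= B' -> cls N B X -> cls N B' X.

Lemma cls_ge0 N B X : cls N B X -> 0 <= B.
Proof.
elim=> // [{}N {}B {}X B' X' _ h _ h'|{}N {}B {}X c _ h|{}N {}B B' {}X h _ h'].
- exact: addr_ge0.
- by rewrite mulr_ge0.
- exact: le_trans h' h.
Qed.

Lemma cls_leN N N' B X : (N <= N')%N -> cls N B X -> cls N' B X.
Proof.
move=> le h; elim: h le => [{}N|k {}N {}X kN h|{}N {}B {}X B' X' _ h _ h'|{}N {}B {}X c _ h|{}N {}B B' {}X BB' _ h] le.
- exact: cls0.
- exact: clsT (leq_trans kN le) h.
- by apply: clsD; [exact: h|exact: h'].
- by apply: clsZ; exact: h.
- by apply: clsW BB' _; exact: h.
Qed.

Lemma cls_tprodM k Y N B X : tprod k Y -> cls N B X -> cls (k + N) B (Y * X).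
Proof.
move=> hY; elim=> [{}N|k' {}N {}X kN h|{}N {}B {}X B' X' _ h _ h'|{}N {}B {}X c _ h|{}N {}B B' {}X BB' _ h].
- by rewrite mulr0; exact: cls0.
- by apply: (clsT _ (tprodM hY h)); rewrite leq_add2l.
- by rewrite mulrDr; exact: clsD.
- by rewrite -scalerAr; exact: clsZ.
- exact: clsW BB' h.
Qed.

Lemma clsM N B X N' B' X' : cls N B X -> cls N' B' X' -> cls (N + N') (B * B') (X * X').
Proof.
move=> h h'; elim: h => [{}N|k {}N {}X kN h|{}N {}B {}X C Y _ h _ k|{}N {}B {}X c _ h|{}N {}B C {}X BC _ h].
- by rewrite mul0r mul0r; exact: cls0.
- rewrite mul1r; apply: cls_leN (cls_tprodM h h').
  by rewrite leq_add2r.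
- by rewrite !mulrDl; exact: clsD.
- by rewrite -(mulrA `|c|) -(scalerAl c X); exact: clsZ.
- by apply: clsW h; rewrite ler_wpM2r ?(cls_ge0 h').
Qed.

Lemma cls_sum N B (I : eqType) (s : seq I) (F : I -> A) :
  (forall i, i \in s -> cls N B (F i)) -> cls N ((size s)%:R * B) (\sum_(i <- s) F i).
Proof.
elim: s => [|i s IH] h; first by rewrite big_nil mul0r; exact: cls0.
rewrite big_cons /= -natr1 mulrDl mul1r addrC; apply: clsD.
  by apply: h; rewrite mem_head.
by apply: IH => j js; apply: h; rewrite inE js orbT.
Qed.

(** The n terms cancel against 1/n. Applied to traces, this makes the bounds uniform in n. *)
Lemma cls_avg N B (F : 'I_n -> A) :
  (forall i, cls N B (F i)) -> cls N B (n%:R^-1 *: \sum_i F i).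
Proof.
move=> h; have := @cls_sum N B _ (index_enum 'I_n) F (fun i _ => h i).
rewrite -sum1_size big_const_ord iter_addn_0 mul1n => /(clsZ n%:R^-1).
by rewrite mulrA ger0_norm ?invr_ge0 ?ler0n // mulVf // mul1r.
Qed.

(** Leading masks are absorbed into the left vector until a Z is exposed or the word is exhausted;
    the latter leaves an inner product in the unit ball. *)
Lemma bil_first k u v W : unit_ball u -> unit_ball v -> mword k W ->
  (k = 0%N /\ exists2 c : R, `|c| <= 1 & bil u v W = c%:A) \/
  exists k' u' W', [/\ k = k'.+1, unit_ball u', mword k' W' & bil u v W = bil u' v (Z *m W')].
Proof.
move=> hu hv hW; elim: hW u hu => [|{}k {}W hW _|{}k {}W d hd hW IH] u hu.
- left; split => //; exists (\sum_i u i 0 * v i 0); last exact: bil1.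
  exact: ub_dot.
- by right; exists k, u, W.
- by rewrite bil_Dgl; apply: IH; exact: ub_dscale.
Qed.

(** Factors of degree 0 are scalars and pass into the rest, so a factor with an exposed Z comes
    first, ready for the loop equation. *)
Lemma tprod_case N X : tprod N X ->
  (N = 0%N /\ exists2 c : R, `|c| <= 1 & X = c%:A) \/
  exists k l u v W Y, [/\ N = (k + l).+1, unit_ball u, unit_ball v, mword k W &
    tprod l Y /\ X = bil u v (Z *m W) * Y].
Proof.
elim=> [c hc|k u v W l Y hu hv hW hY IH]; first by left; split => //; exists c.
have [[-> [c hc ->]]|[k' [u' [W' [-> hu' hW' ->]]]]] := bil_first hu hv hW; last first.
  by right; exists k', l, u', v, W', Y.
case: IH => [[-> [c' hc' ->]]|[k1 [l1 [u1 [v1 [W1 [Y1 [-> h1 h2 h3 [h4 ->]]]]]]]]].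
  left; split => //; exists (c * c').
    by rewrite normrM -[leRHS]mulr1 ler_pM.
  by rewrite -scalerAl mul1r scalerA.
right; exists k1, l1, u1, v1, W1, (c *: Y1); split => //; split; first exact: tprodZ.
by rewrite -scalerAl mul1r scalerAr.
Qed.

Lemma tp_bil1 k u v W : unit_ball u -> unit_ball v -> mword k W -> tprod k (bil u v W).
Proof.
move=> hu hv hW; rewrite -[k]addn0 -[bil _ _ _]mulr1 -[X in _ * X]scale1r.
by apply: tp_bil => //; apply: tp_cst; rewrite normr1.
Qed.

(** Each derivative cuts the form at a removed Z; its two ends are then joined to [y] and [z] in
    both orders. *)
Lemma merge_bil y z u v W S : has_der W S ->
  loop_merge y z (bil u v W) = \sum_(p <- S)
    ((y^T *m p.1^T *m cmx u) 0 0 * (z^T *m p.2 *m cmx v) 0 0 +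
     (y^T *m p.2 *m cmx v) 0 0 * ((cmx u)^T *m p.1 *m z) 0 0).
Proof.
move=> dW.
have dbil a b : der a b (bil u v W) = \sum_(p <- S)
    (((cmx u)^T *m p.1) 0 a * (p.2 *m cmx v) b 0 +
     ((cmx u)^T *m p.1) 0 b * (p.2 *m cmx v) a 0).
  have -> : der a b (bil u v W) = (dmx a b ((cmx u)^T *m W *m cmx v)) 0 0.
    by rewrite [RHS]mxE.
  rewrite !dmxM !dmx_cst mulmx0 addr0 /cmx map_trmx dmx_cst mul0mx add0r dW.
  rewrite mulmx_sumr mulmx_suml summxE; apply: eq_bigr => p _.
  set r := map_mx _ u^T; set c := map_mx _ v.
  rewrite -mulmxA [in LHS]mxE.
  have colE i : (spl a b p.1 p.2 *m c) i 0 =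
      p.1 i a * (p.2 *m c) b 0 + p.1 i b * (p.2 *m c) a 0.
    rewrite mxE [(p.2 *m c) b 0]mxE [(p.2 *m c) a 0]mxE !mulr_sumr -big_split /=.
    by apply: eq_bigr => k _; rewrite mxE mulrDl !mulrA.
  rewrite [(r *m p.1) 0 a]mxE [(r *m p.1) 0 b]mxE !mulr_suml -big_split /=.
  by apply: eq_bigr => i _; rewrite colE mulrDr !mulrA.
rewrite /loop_merge.
under eq_bigr do under eq_bigr do rewrite dbil mulr_sumr.
under eq_bigr do rewrite exchange_big /=.
rewrite exchange_big /=; apply: eq_bigr => p _.
have e1 : (y^T *m p.1^T *m cmx u) 0 0 = \sum_a y a 0 * ((cmx u)^T *m p.1) 0 a.
  have -> : y^T *m p.1^T *m cmx u = y^T *m ((cmx u)^T *m p.1)^T.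
    by rewrite trmx_mul trmxK mulmxA.
  by rewrite mxE; apply: eq_bigr => a _; rewrite [y^T 0 a]mxE [X in _ * X]mxE.
have e2 : (z^T *m p.2 *m cmx v) 0 0 = \sum_b z b 0 * (p.2 *m cmx v) b 0.
  by rewrite -mulmxA mxE; apply: eq_bigr => b _; rewrite [z^T 0 b]mxE.
have e3 : (y^T *m p.2 *m cmx v) 0 0 = \sum_b y b 0 * (p.2 *m cmx v) b 0.
  by rewrite -mulmxA mxE; apply: eq_bigr => b _; rewrite [y^T 0 b]mxE.
have e4 : ((cmx u)^T *m p.1 *m z) 0 0 = \sum_b ((cmx u)^T *m p.1) 0 b * z b 0.
  by rewrite mxE.
rewrite e1 e2 e3 e4 !mulr_suml -big_split /=; apply: eq_bigr => a _.
rewrite !mulr_sumr -big_split /=; apply: eq_bigr => b _.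
by ring.
Qed.

(** Each of the [l] letters Z in [X] allows two reconnections, and each of them is again a product
    of bilinear forms on the unit ball. *)
Lemma merge_tprod k W u v l X : unit_ball u -> unit_ball v -> mword k W -> tprod l X ->
  cls (k + l) (2 * l%:R) (loop_merge (cmx u) (W *m cmx v) X).
Proof.
move=> hu hv hW; elim=> [c hc|k1 u1 v1 W1 l1 X1 hu1 hv1 hW1 hX1 IH].
  by rewrite merge_cst mulr0; exact: cls0.
have [S [sS dS hS]] := mword_der hW1.
rewrite mergeM natrD mulrDr; apply: clsD; last first.
  by rewrite addnCA; apply: cls_tprodM IH; exact: tp_bil1.
rewrite addnA -[X in cls _ X _]mulr1; apply: clsM; last exact: clsT (leqnn _) hX1.
rewrite (merge_bil _ _ _ _ dS) mulrC -sS; apply: cls_sum => p pS.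
have [i [j [hi hj ij]]] := hS _ pS.
rewrite -[2]/(1 + 1); apply: clsD.
- have -> : ((cmx u)^T *m p.1^T *m cmx u1) 0 0 = bil u1 u p.1 by rewrite -bil_tr.
  have -> : ((W *m cmx v)^T *m p.2 *m cmx v1) 0 0 = bil v v1 (W^T *m p.2).
    by rewrite /bil trmx_mul !mulmxA.
  apply: (@clsT (i + (k + j))); first by lia.
  apply: tprodM; apply: tp_bil1 => //.
  by apply: mwordM => //; exact: mword_tr.
- have -> : ((cmx u)^T *m p.2 *m cmx v1) 0 0 = bil u v1 p.2 by [].
  have -> : ((cmx u1)^T *m p.1 *m (W *m cmx v)) 0 0 = bil u1 v (p.1 *m W).
    by rewrite /bil !mulmxA.
  apply: (@clsT (j + (i + k))); first by lia.
  by apply: tprodM; apply: tp_bil1 => //; exact: mwordM.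
Qed.

(** [T] collects the trace terms, where the trace uses up the factor 1/n; [T'] and the merge term
    keep it. Neither [T] nor [T'] depends on [G], so one expansion serves both expectations in a
    covariance. *)
Lemma E_first k W u v : unit_ball u -> unit_ball v -> mword k W ->
  exists T T', [/\ cls k k%:R T, cls k k%:R T' & forall G,
    E (bil u v (Z *m W) * G) =
    E (T * G) + n%:R^-1 * (E (T' * G) + E (loop_merge (cmx u) (W *m cmx v) G))].
Proof.
move=> hu hv hW; have [S [sS dS hS]] := mword_der hW.
exists (\sum_(p <- S) (n%:R^-1 *: (\tr p.1 * bil u v p.2))).
exists (\sum_(p <- S) bil u v (p.1^T *m p.2)); split.
- rewrite -sS -[X in cls _ X _]mulr1; apply: cls_sum => p pS.
  have [i [j [hi hj ij]]] := hS _ pS.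
  rewrite trE mulr_suml; apply: cls_avg => a.
  apply: (@clsT (i + j)); first by rewrite sS; lia.
  by apply: tprodM; apply: tp_bil1 => //; exact: ub_evec.
- rewrite -sS -[X in cls _ X _]mulr1; apply: cls_sum => p pS.
  have [i [j [hi hj ij]]] := hS _ pS.
  apply: (@clsT (i + j)); first by rewrite sS; lia.
  by apply: tp_bil1 => //; apply: mwordM => //; exact: mword_tr.
- move=> G; have := @loop_equation u v 1%:M W [::] S G (has_der_cst0 dmx_1) dS.
  rewrite trmx1 !mul1mx big_nil addr0 => ->.
  rewrite big_split /= !mulrDr addrA !mulr_suml !linear_sum mulr_sumr.
  congr (_ + _ + _).
    apply: eq_bigr => p _.
    by rewrite -scalerAl linearZ /= mul1mx.
  by congr (_ * _); apply: eq_bigr => p _; rewrite mul1mx.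
Qed.

(** Abstracts the induction over linear combinations; the instances are the modulus of [E] and that
    of a covariance in one argument. *)
Lemma cls_seminorm (f : A -> R) N B X c :
  f 0 = 0 -> (forall x y, f (x + y) <= f x + f y) ->
  (forall a x, f (a *: x) = `|a| * f x) ->
  (forall k Y, (k <= N)%N -> tprod k Y -> f Y <= c) ->
  cls N B X -> f X <= c * B.
Proof.
move=> f0 fD fZ hf hX; have {hX} : cls N B X /\ 0 <= c.
  (* The scalar 0 is itself a product, which gives [0 <= c]. *)
  split=> //; rewrite -f0 -(scale0r (1 : A)); apply: (hf 0%N) => //.
  by apply: tp_cst; rewrite normr0.
case=> hX c0; elim: hX hf => [M|k M Y kM hY|M C Y C' Y' _ h _ h'|M C Y a _ h|M C C' Y CC' hY h] hf.
- by rewrite f0 mulr0.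
- by rewrite mulr1; apply: hf kM hY.
- by rewrite mulrDr; apply: le_trans (fD _ _) (lerD (h hf) (h' hf)).
- by rewrite fZ mulrCA ler_wpM2l // h.
- by apply: le_trans (h hf) _; rewrite ler_wpM2l.
Qed.

Lemma E_cls_le N B X c : (forall k Y, (k <= N)%N -> tprod k Y -> `|E Y| <= c) ->
  cls N B X -> `|E X| <= c * B.
Proof.
apply: cls_seminorm => [|x y|a x]; first by rewrite linear0 normr0.
  by rewrite linearD; exact: ler_normD.
by rewrite linearZ normrM.
Qed.

(** * Moment and covariance bounds uniform in n *)

Lemma invn_le1 : (n%:R^-1 : R) <= 1.
Proof. by rewrite invf_le1 ?ltr0n // ler1n. Qed.

Lemma invn_ge0 : 0 <= (n%:R^-1 : R).
Proof. by rewrite invr_ge0. Qed.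

(** Strong induction on the degree: the three terms of [E_first] have lower degree and coefficient
    sums independent of n. *)
Lemma E_tprod N X : tprod N X -> `|E X| <= mom_bound R N.
Proof.
elim/ltn_ind: N X => N IH X /tprod_case[[-> [c hc ->]]|].
  by rewrite linearZ /= E1 mulr1.
case=> k [l [u [v [W [Y [NE hu hv hW [hY ->]]]]]]].
have [T [T' [hT hT' ->]]] := E_first hu hv hW.
have IHc M B V : (M <= k + l)%N -> cls M B V -> `|E V| <= mom_bound R (k + l) * B.
  move=> Mkl; apply: E_cls_le => m V' mM /IH h.
  by apply: le_trans (h _) (mom_bound_le _ _); lia.
have b1 := IHc _ _ _ (leqnn _) (clsM hT (clsT (leqnn _) hY)).
have b2 := IHc _ _ _ (leqnn _) (clsM hT' (clsT (leqnn _) hY)).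
have b3 := IHc _ _ _ (leqnn _) (merge_tprod hu hv hW hY).
rewrite NE /=; set M := mom_bound R _ in b1 b2 b3 *.
have M1 : 1 <= M by exact: mom_bound_ge1.
apply: le_trans (ler_normD _ _) _; rewrite normrM (ger0_norm invn_ge0).
have b4 : n%:R^-1 * `|E (T' * Y) + E (loop_merge (cmx u) (W *m cmx v) Y)| <=
    M * (k%:R * 1) + M * (2 * l%:R).
  rewrite -[leRHS]mul1r; apply: ler_pM => //; first exact: invn_le1.
  by apply: le_trans (ler_normD _ _) (lerD _ _).
apply: le_trans (lerD b1 b4) _; rewrite -[(k + l).+1%:R]natr1 natrD.
have : 0 <= (k%:R : R) by []. have : 0 <= (l%:R : R) by [].
by nra.
Qed.

Lemma E_cls N B X : cls N B X -> `|E X| <= mom_bound R N * B.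
Proof.
apply: E_cls_le => k Y kN /E_tprod h; exact: le_trans h (mom_bound_le _ kN).
Qed.

Definition cov X Y := E (X * Y) - E X * E Y.

Lemma cov_le_r N B X Y c :
  (forall k Y', (k <= N)%N -> tprod k Y' -> `|cov Y Y'| <= c) ->
  cls N B X -> `|cov Y X| <= c * B.
Proof.
apply: cls_seminorm => [|x y|a x]; rewrite /cov.
- by rewrite mulr0 linear0 mulr0 subrr normr0.
- rewrite mulrDr !linearD mulrDr opprD addrACA; exact: ler_normD.
- by rewrite -(scalerAr a Y) !EZ -normrM; congr (`| _ |); ring.
Qed.

Lemma cov_le_l N B X Y c :
  (forall k X', (k <= N)%N -> tprod k X' -> `|cov X' Y| <= c) ->
  cls N B X -> `|cov X Y| <= c * B.
Proof.
have covC V : cov V Y = cov Y V by rewrite /cov mulrC [E Y * _]mulrC.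
move=> h hX; rewrite covC; apply: cov_le_r hX => k X' kN hX'.
by rewrite -covC; exact: h kN hX'.
Qed.

(** Expand the first factor by [E_first] in both expectations. The [T] terms combine into a
    covariance of lower degree; everything else carries 1/n and is controlled by moments. *)
Lemma cov_tprod k l X Y : tprod k X -> tprod l Y ->
  `|cov X Y| <= cov_bound R (k + l) * n%:R^-1.
Proof.
have [N] := ubnP (k + l); elim: N k l X Y => // N IH k l X Y; rewrite ltnS => klN.
move=> /tprod_case[[-> [c hc ->]]|] hY.
  rewrite /cov -(scalerAl c 1) mul1r !EZ E1 mulr1 subrr normr0.
  by rewrite mulr_ge0 ?cov_bound_ge0 // invn_ge0.
case: hY => k' [m [u [v [W [X' [kE hu hv hW [hX' ->]]]]]]] hY.
have [T [T' [hT hT' TE]]] := E_first hu hv hW.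
set M := loop_merge (cmx u) (W *m cmx v).
have covE : cov (bil u v (Z *m W) * X') Y = cov (T * X') Y + n%:R^-1 *
    (E (T' * (X' * Y)) + E (M (X' * Y)) - (E (T' * X') + E (M X')) * E Y).
  by rewrite /cov -!mulrA !TE -/M; ring.
pose m0 := (k' + m + l)%N.
have m0E : (k + l = m0.+1)%N by rewrite kE.
have hTX := clsM hT (clsT (leqnn _) hX').
have b1 : `|cov (T * X') Y| <= cov_bound R m0 * n%:R^-1 * (k'%:R * 1).
  apply: cov_le_l hTX => j V hj hV.
  apply: le_trans (IH _ _ _ _ _ hV hY) _; first by rewrite /m0 in m0E; lia.
  by rewrite ler_wpM2r ?invn_ge0 // cov_bound_le // /m0 leq_add2r.
have hXY := tprodM hX' hY.
have le_mom j V B : (j <= m0)%N -> cls j B V -> `|E V| <= mom_bound R m0 * B.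
  move=> hj hV; apply: le_trans (E_cls hV) _.
  by rewrite ler_wpM2r ?(cls_ge0 hV) // mom_bound_le.
have b2 := le_mom _ _ _ _ (clsM hT' (clsT (leqnn _) hXY)).
have {b2} b2 := b2 (eq_leq (addnA _ _ _)).
have b3 := le_mom _ _ _ _ (merge_tprod hu hv hW hXY).
have {b3} b3 := b3 (eq_leq (addnA _ _ _)).
have b4 := le_mom _ _ _ (leq_addr _ _) (clsM hT' (clsT (leqnn _) hX')).
have b5 := le_mom _ _ _ (leq_addr _ _) (merge_tprod hu hv hW hX').
have b6 := le_mom _ _ _ (leq_addl _ _) (clsT (leqnn _) hY).
rewrite covE m0E /=; set C := mom_bound R m0 in b2 b3 b4 b5 b6 *.
have C1 : 1 <= C by exact: mom_bound_ge1.
set K := cov_bound R m0 in b1 *; have K0 : 0 <= K by exact: cov_bound_ge0.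
apply: le_trans (ler_normD _ _) _; rewrite normrM (ger0_norm invn_ge0).
have b7 : `|E (T' * (X' * Y)) + E (M (X' * Y)) - (E (T' * X') + E (M X')) * E Y| <=
    C * (k'%:R * 1) + C * (2 * (m + l)%:R) + (C * (k'%:R * 1) + C * (2 * m%:R)) * (C * 1).
  apply: le_trans (ler_normD _ _) _; rewrite normrN normrM; apply: lerD.
    by apply: le_trans (ler_normD _ _) (lerD _ _).
  by apply: ler_pM => //; apply: le_trans (ler_normD _ _) (lerD _ _).
apply: le_trans (lerD b1 (ler_wpM2l invn_ge0 b7)) _.
rewrite [X in X <= _](_ : _ = n%:R^-1 * (K * k'%:R + (C * (k'%:R * 1) +
   C * (2 * (m + l)%:R) + (C * (k'%:R * 1) + C * (2 * m%:R)) * (C * 1)))); last by ring.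
rewrite mulrC ler_wpM2r ?invn_ge0 // -[m0.+1%:R]natr1 /m0 !natrD.
have hk : 0 <= (k'%:R : R) by []. have hm : 0 <= (m%:R : R) by [].
have hl : 0 <= (l%:R : R) by [].
have C0 : 0 <= C by lra.
have CC : 0 <= C ^+ 2 by rewrite exprn_ge0.
have := mulr_ge0 K0 hk; have := mulr_ge0 K0 hm; have := mulr_ge0 K0 hl.
have := mulr_ge0 C0 hk; have := mulr_ge0 C0 hm; have := mulr_ge0 C0 hl.
have := mulr_ge0 CC hk; have := mulr_ge0 CC hm; have := mulr_ge0 CC hl.
set CC2 := C ^+ 2 in CC *; rewrite (_ : (_ + C * (2 * m%:R)) * (C * 1) =
  CC2 * (k'%:R + 2 * m%:R)); last by rewrite /CC2; ring.
by rewrite !(mulr1, mulrDl, mulrDr); lra.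
Qed.

Lemma cov_cls N B X N' B' Y : cls N B X -> cls N' B' Y ->
  `|cov X Y| <= cov_bound R (N + N') * B * B' * n%:R^-1.
Proof.
move=> hX hY.
rewrite [leRHS](_ : _ = cov_bound R (N + N') * n%:R^-1 * B' * B); last by ring.
apply: cov_le_l hX => k X' kN hX'; apply: cov_le_r hY => l Y' lN hY'.
apply: le_trans (cov_tprod hX' hY') _.
by rewrite ler_wpM2r ?invn_ge0 // cov_bound_le // leq_add.
Qed.

(** The second moment is a covariance plus a squared mean, and the resulting 1/n^2 is at most
    1/n. *)
Lemma second_moment_cls N B X e : cls N B X -> `|E X| <= e * n%:R^-1 ->
  E (X * X) <= (cov_bound R (N + N) * B * B + e * e) * n%:R^-1.
Proof.
move=> hX he; have := cov_cls hX hX; rewrite /cov => h.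
have -> : E (X * X) = (E (X * X) - E X * E X) + E X * E X by rewrite subrK.
rewrite mulrDl; apply: lerD; first exact: le_trans (ler_norm _) h.
apply: le_trans (ler_norm _) _; rewrite normrM.
apply: le_trans (ler_pM _ _ he he) _ => //.
have e0 : 0 <= e * e by rewrite -expr2 sqr_ge0.
rewrite mulrACA ler_wpM2l // -[leRHS]mulr1 ler_wpM2l ?invn_ge0 //.
exact: invn_le1.
Qed.

Inductive mcls : nat -> R -> 'M[A]_n -> Prop :=
| mcls0 N : mcls N 0 0
| mclsT k N W : (k <= N)%N -> mword k W -> mcls N 1 W
| mclsD N B W B' W' : mcls N B W -> mcls N B' W' -> mcls N (B + B') (W + W')
| mclsZ N B W (c : R) : mcls N B W -> mcls N (`|c| * B) (c%:A *: W)
| mclsW N B B' W : B <= B' -> mcls N B W -> mcls N B' W.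

Lemma mcls_ge0 N B W : mcls N B W -> 0 <= B.
Proof.
elim=> // [M C X C' X' _ h _ h'|M C X c _ h|M C C' X h _ h'].
- exact: addr_ge0.
- by rewrite mulr_ge0.
- exact: le_trans h' h.
Qed.

Lemma mcls_leN N N' B W : (N <= N')%N -> mcls N B W -> mcls N' B W.
Proof.
move=> le h; elim: h le => [M|k M X kN h|M C X C' X' _ h _ h'|M C X c _ h|M C C' X CC' _ h] le.
- exact: mcls0.
- exact: mclsT (leq_trans kN le) h.
- by apply: mclsD; [exact: h|exact: h'].
- by apply: mclsZ; exact: h.
- by apply: mclsW CC' _; exact: h.
Qed.

Lemma mclsM N B W N' B' W' : mcls N B W -> mcls N' B' W' -> mcls (N + N') (B * B') (W *m W').
Proof.
move=> h h'; elim: h => [M|k M X kN h|M C X C1 Y _ h _ k|M C X c _ h|M C C1 X CC _ h].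
- by rewrite mul0r mul0mx; exact: mcls0.
- rewrite mul1r; apply: (@mcls_leN (k + N')); first by rewrite leq_add2r.
  elim: h' => [M'|k' M' X' kN' h'|M' C X' C' Y' _ h1 _ h1'|M' C X' c _ h1|M' C C' X' CC' _ h1].
  + by rewrite mulmx0; exact: mcls0.
  + by apply: (mclsT _ (mwordM h h')); rewrite leq_add2l.
  + by rewrite mulmxDr; exact: mclsD.
  + by rewrite -scalemxAr; exact: mclsZ.
  + exact: mclsW CC' h1.
- by rewrite mulmxDl mulrDl; exact: mclsD.
- by rewrite -scalemxAl -mulrA; exact: mclsZ.
- by apply: mclsW h; rewrite ler_wpM2r ?(mcls_ge0 h').
Qed.

Lemma mcls_tr N B W : mcls N B W -> mcls N B W^T.
Proof.
elim=> [M|k M X kN h|M C X C1 Y _ h _ k|M C X c _ h|M C C1 X CC _ h].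
- by rewrite trmx0; exact: mcls0.
- exact: mclsT kN (mword_tr h).
- by rewrite linearD; exact: mclsD.
- by rewrite linearZ; exact: mclsZ.
- exact: mclsW CC h.
Qed.

Lemma mcls_Dg d : contraction d -> mcls 0 1 (Dg d).
Proof. by move=> hd; rewrite -[Dg d]mulmx1; apply: (mclsT (leqnn _)); exact: mwD hd mw1. Qed.

Lemma mcls_1 : mcls 0 1 1%:M.
Proof. exact: mclsT (leqnn _) mw1. Qed.

Lemma mcls_Z : mcls 1 1 Z.
Proof. by rewrite -[Z]mulmx1; apply: (mclsT (leqnn _)); exact: mwZ mw1. Qed.

Lemma cls_bil u v N B W : unit_ball u -> unit_ball v -> mcls N B W -> cls N B (bil u v W).
Proof.
move=> hu hv; elim=> [M|k M X kN h|M C X C1 Y _ h _ k|M C X c _ h|M C C1 X CC _ h].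
- by rewrite bil0; exact: cls0.
- exact: clsT kN (tp_bil1 hu hv h).
- by rewrite bilD; exact: clsD.
- by rewrite bilZ; exact: clsZ.
- exact: clsW CC h.
Qed.

(** * Wick words and their expectations *)

Definition entry_mean (d : 'rV[R]_n) : R := n%:R^-1 * \sum_i d 0 i.

Lemma mean_le1 d : contraction d -> `|entry_mean d| <= 1.
Proof.
move=> hd; rewrite normrM (ger0_norm invn_ge0).
apply: (@le_trans _ _ (n%:R^-1 * \sum_(i < n) 1)); last first.
  by rewrite sumr_const card_ord mulVf.
rewrite ler_wpM2l ?invn_ge0 //; apply: le_trans (ler_norm_sum _ _ _) _.
exact: ler_sum.
Qed.

Lemma tr_Dg d : n%:R^-1 *: \tr (Dg d) = (entry_mean d)%:A.
Proof.
rewrite /entry_mean -scalerA; congr (_ *: _); rewrite scaler_suml; apply: eq_bigr => i _.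
by rewrite !mxE eqxx mulr1n.
Qed.

Fixpoint wick (l : seq 'rV[R]_n) : 'M[A]_n * 'M[A]_n :=
  if l is d :: l' then
    (Z *m Dg d *m (wick l').1 - (entry_mean d)%:A *: (wick l').2, Dg d *m (wick l').1)
  else (Z, 1%:M).
Notation Q l := (wick l).1.
Notation P l := (wick l).2.

Definition contractions (l : seq 'rV[R]_n) := forall d, d \in l -> contraction d.

Lemma contractions_cons d l :
  contractions (d :: l) -> contraction d /\ contractions l.
Proof.
move=> h; split; first by apply: h; rewrite mem_head.
by move=> d' dl; apply: h; rewrite inE dl orbT.
Qed.

(** Each mask at most doubles the coefficient sum: one share for the product, one for the
    subtraction, whose coefficient <D> has modulus at most 1. *)
Lemma mcls_wick l : contractions l ->
  mcls (size l).+1 (2 ^+ size l) (Q l) /\ mcls (size l) (2 ^+ size l) (P l).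
Proof.
elim: l => [_|d l IH /contractions_cons[hd /IH[hQ hP]]] /=.
  by split; [exact: mcls_Z|exact: mcls_1].
split.
- rewrite exprS mulrDl !mul1r; apply: mclsD.
    rewrite -[2 ^+ size l]mul1r -[X in _ * X]mul1r -[(size l).+2]add1n mulrA.
    apply: mclsM hQ; rewrite -[1%N]addn0; apply: mclsM mcls_Z _; exact: mcls_Dg.
  rewrite -scaleNr -[- (entry_mean d)%:A]scaleNr.
  apply: (@mclsW _ (`|- entry_mean d| * 2 ^+ size l)).
    by rewrite normrN ler_piMl ?exprn_ge0 // mean_le1.
  by apply: mclsZ; apply: mcls_leN hP; lia.
- rewrite exprS mulrDl !mul1r.
  apply: (@mclsW _ (1 * 2 ^+ size l)); first by rewrite mul1r lerDl exprn_ge0.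
  by rewrite -[(size l).+1]add0n; apply: mclsM hQ; exact: mcls_Dg.
Qed.

(** Indexes the derivative of a Wick word: a cut at a mask stands for removing the Z that follows
    this mask. *)
Fixpoint splits (T : Type) (l : seq T) : seq (seq T * T * seq T) :=
  if l is d :: l' then
    ([::], d, l') :: [seq (d :: x.1.1, x.1.2, x.2) | x <- splits l']
  else [::].

Lemma size_splits (T : Type) (l : seq T) : size (splits l) = size l.
Proof. by elim: l => //= d l IH; rewrite size_map IH. Qed.

Lemma splitsP (T : eqType) (l : seq T) x :
  x \in splits l -> l = x.1.1 ++ x.1.2 :: x.2.
Proof.
elim: l x => //= d l IH x; rewrite inE => /predU1P[-> //|/mapP[y /IH h ->] /=].
by rewrite -h.
Qed.

(** At each cut the derivatives of Z D Q(l) and of <D> P(l) combine, and their left factors form the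
    Q word of the prefix prolonged by [d]. Left factors thus inherit the subtraction, and with it
    small traces. *)
Lemma has_der_wick l :
  has_der (Q l) ((1%:M, P l) :: [seq (Q x.1.1 *m Dg x.1.2, P x.2) | x <- splits l]) /\
  has_der (P l) [seq (P x.1.1 *m Dg x.1.2, P x.2) | x <- splits l].
Proof.
elim: l => [|d l [IHQ IHP]] /=.
  split=> a b; first by rewrite big_cons big_nil addr0 dmx_Z.
  by rewrite big_nil dmx_1.
have dPE a b : dmx a b (Dg d *m Q l) = spl a b (Dg d) (P l) +
    \sum_(x <- splits l) spl a b (Dg d *m Q x.1.1 *m Dg x.1.2) (P x.2).
  rewrite dmxM dmx_Dg mul0mx add0r IHQ mulmx_sumr big_cons big_map /= splMl mulmx1.
  by congr (_ + _); apply: eq_bigr => x _; rewrite splMl mulmxA.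
split=> a b; last first.
  by rewrite big_cons !big_map /= mul1mx dPE.
rewrite -mulmxA dmxD -scaleNr -[- (entry_mean d)%:A]scaleNr dmxZ dmxM dmx_Z splMr mul1mx.
rewrite dPE IHP !big_cons !big_map /= -!addrA; congr (_ + _).
rewrite mulmxDr splMl mulmx_sumr -addrA; congr (_ + _).
rewrite scaler_sumr -big_split /=; apply: eq_bigr => x _.
rewrite splMl -splZl -splDl; congr (spl a b _ _).
by rewrite mulmxBl -scalemxAl !scaleNr !mulmxA.
Qed.

Lemma sub_contractions l x : contractions l -> x \in splits l ->
  [/\ contractions x.1.1, contraction x.1.2 & contractions x.2].
Proof.
move=> hl /splitsP lE; split=> [d hd||d hd]; apply: hl; rewrite lE mem_cat.
- by rewrite hd.
- by rewrite mem_head orbT.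
- by rewrite inE hd !orbT.
Qed.

(** The normalized trace is an average of bilinear forms of mean O(1/n); separating it from [G]
    costs a covariance, which is O(1/n) as well. *)
Lemma E_tr_wick c m d d' N B G s : 0 <= c ->
  (forall u w, unit_ball u -> unit_ball w -> `|E (bil u w (Q m))| <= c * n%:R^-1) ->
  contraction d -> contraction d' -> contractions m -> (size m < s)%N -> cls N B G ->
  `|n%:R^-1 * E (\tr (Dg d *m Q m *m Dg d') * G)| <=
  (c * (mom_bound R N * B) + cov_bound R (s + N) * 2 ^+ s * B) * n%:R^-1.
Proof.
move=> c0 hc hd hd' hm ms hG.
pose T := n%:R^-1 *: \tr (Dg d *m Q m *m Dg d').
have hT : cls s (2 ^+ s) T.
  rewrite /T trE; apply: cls_avg => i; apply: cls_bil; [exact: ub_evec..|].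
  rewrite -[s in mcls s _ _]addn0 -[X in mcls _ X _]mulr1; apply: mclsM; last exact: mcls_Dg.
  rewrite -[s in mcls s _ _]add0n -[X in mcls _ X _]mul1r; apply: mclsM; first exact: mcls_Dg.
  apply: (@mclsW _ (2 ^+ size m)); first by rewrite ler_eXn2l ?ltr1n // ltnW.
  by apply: mcls_leN ms _; exact: (mcls_wick hm).1.
have -> : n%:R^-1 * E (\tr (Dg d *m Q m *m Dg d') * G) = E T * E G + cov T G.
  by rewrite /cov addrC subrK -scalerAl EZ.
have ET : `|E T| <= c * n%:R^-1.
  rewrite /T trE EZ linear_sum normrM (ger0_norm invn_ge0).
  have -> : c * n%:R^-1 = n%:R^-1 * (n%:R * (c * n%:R^-1)) by rewrite [RHS]mulrA mulVf // mul1r.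
  rewrite ler_wpM2l ?invn_ge0 //.
  rewrite -[X in _ <= X%:R * _](_ : size (index_enum 'I_n) = n); last first.
    by rewrite -sum1_size big_const_ord iter_addn_0 mul1n.
  apply: norm_sum_le => i _; rewrite bil_Dgr bil_Dgl.
  by apply: hc; apply: ub_dscale => //; exact: ub_evec.
apply: le_trans (ler_normD _ _) _; rewrite mulrDl; apply: lerD.
  by rewrite normrM mulrAC; apply: ler_pM => //; exact: E_cls.
exact: cov_cls hT hG.
Qed.

(** Among the cuts of P(l), only the first has a left factor with a trace that is not small, and
    this term is the one subtracted in Q(l). What survives at leading order is the derivative of
    [Y]. *)
Lemma E_wick c (h v : 'cV[R]_n) (Y : 'M[A]_n) SY N B l :
  0 <= c -> unit_ball h -> unit_ball v -> contractions l ->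
  has_der Y SY -> mcls N B Y ->
  (forall p, p \in SY -> mcls N B p.1 /\ mcls N B p.2) ->
  (forall m u w, unit_ball u -> unit_ball w -> contractions m -> (size m < size l)%N ->
     `|E (bil u w (Q m))| <= c * n%:R^-1) ->
  `|E (bil h v (Y^T *m Q l)) -
    \sum_(p <- SY) n%:R^-1 * E (\tr p.1 * bil h v (p.2^T *m P l))| <=
  wick_error c N B (size SY) (size l) * n%:R^-1.
Proof.
move=> c0 hh hv hl dY hY hSY IH.
set s := size l.
have [_ dP] := has_der_wick l.
have [_ hP] := mcls_wick hl.
have B0 := mcls_ge0 hY.
have mb0 k : 0 <= mom_bound R k by exact: le_trans (mom_bound_ge1 _ _).
have powle a : (a <= s)%N -> (2 ^+ a : R) <= 2 ^+ s by move=> ?; rewrite ler_eXn2l // ltr1n.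
have sizes x : x \in splits l -> (size x.1.1 < s)%N /\ (size x.2 < s)%N.
  by move=> /splitsP lE; rewrite /s lE size_cat /=; lia.
have hx x : x \in splits l -> mcls s (2 ^+ s) (P x.1.1 *m Dg x.1.2) /\ mcls s (2 ^+ s) (P x.2).
  move=> xl; have [h1 h2 h3] := sub_contractions hl xl; have [s1 s2] := sizes _ xl.
  split.
    rewrite -[X in mcls _ X _]mulr1 -[X in mcls X _ _]addn0; apply: mclsM (mcls_Dg h2).
    apply: mclsW (powle _ (ltnW s1)) _; apply: mcls_leN (ltnW s1) _.
    exact: (mcls_wick h1).2.
  apply: mclsW (powle _ (ltnW s2)) _; apply: mcls_leN (ltnW s2) _.
  exact: (mcls_wick h3).2.
pose tw := [seq (P x.1.1 *m Dg x.1.2, P x.2) | x <- splits l].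
(* [L] is the expectation with Q(l) replaced by Z P(l), that is, before the subtraction. *)
have := @loop_equation h v Y (P l) SY _ 1 dY dP.
rewrite mulr1; set L := E _ => LE.
have {}LE : L = \sum_(p <- tw) n%:R^-1 * E (\tr p.1 * bil h v (Y^T *m p.2)) +
    n%:R^-1 * (\sum_(p <- tw) E (bil h v (Y^T *m p.1^T *m p.2))) +
    (\sum_(p <- SY) n%:R^-1 * E (\tr p.1 * bil h v (p.2^T *m P l)) +
     n%:R^-1 * (\sum_(p <- SY) E (bil h v (p.2^T *m p.1 *m P l)))).
  rewrite LE merge1 linear0 addr0.
  under eq_bigr do rewrite !mulr1; under [X in _ * (_ + X)]eq_bigr do rewrite !mulr1.
  by rewrite !big_split /= !mulrDr !mulr_sumr.
have bt2 : `|\sum_(p <- tw) E (bil h v (Y^T *m p.1^T *m p.2))| <=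
    s%:R * (mom_bound R (N + s + s) * (B * 2 ^+ s * 2 ^+ s)).
  rewrite /tw big_map -[s](size_splits l); apply: norm_sum_le => x xl.
  rewrite size_splits; have [h1 h2] := hx _ xl.
  apply: E_cls; apply: cls_bil => //; apply: mclsM h2.
  by apply: mclsM; exact: mcls_tr.
have bt3 : `|\sum_(p <- SY) E (bil h v (p.2^T *m p.1 *m P l))| <=
    (size SY)%:R * (mom_bound R (N + N + s) * (B * B * 2 ^+ s)).
  apply: norm_sum_le => p /hSY [h1 h2].
  apply: E_cls; apply: cls_bil => //; apply: mclsM hP.
  by apply: mclsM => //; exact: mcls_tr.
(* All cuts but the first. For empty [l] there is neither a cut nor a subtraction, hence the
   default. *)
pose tail := if splits l is x :: r then r else [::].
pose rest := \sum_(x <- tail) n%:R^-1 *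
  E (\tr (P x.1.1 *m Dg x.1.2) * bil h v (Y^T *m P x.2)).
(* The first cut has left factor D, so its trace term equals <D> E(Y^T P(l')) and cancels the
   subtraction. *)
have ons : E (bil h v (Y^T *m Q l)) = L - \sum_(p <- tw) n%:R^-1 *
    E (\tr p.1 * bil h v (Y^T *m p.2)) + rest.
  rewrite /L /rest /tail /tw; case: (l) => [|d l'] /=.
    by rewrite !big_nil subr0 addr0 mulmx1.
  rewrite big_cons /= mul1mx -EZ.
  rewrite scalerAl tr_Dg -scalerAl mul1r EZ !big_map /=.
  rewrite -scaleNr -[- (entry_mean d)%:A]scaleNr mulmxDr -scalemxAr bilD bilZ linearD EZ.
  by rewrite mulNr !mulmxA opprD addrA subrK.
have tailP x : x \in tail -> x \in splits l /\ exists d m, x.1.1 = d :: m.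
  rewrite /tail; case: (l) => //= d l' xt; split; first by rewrite inE xt orbT.
  by case/mapP: xt => y _ -> /=; exists d, y.1.1.
have stail : (size tail <= s)%N.
  by rewrite /tail /s -(size_splits l); case: (splits l).
have bt1 : `|rest| <= (size tail)%:R * ((c * (mom_bound R (N + s) * (B * 2 ^+ s)) +
    cov_bound R (s + (N + s)) * 2 ^+ s * (B * 2 ^+ s)) * n%:R^-1).
  apply: norm_sum_le => x /tailP [xl [d [m mE]]].
  have [h1 h2] := hx _ xl; have [c1 c2 c3] := sub_contractions hl xl.
  have [s1 _] := sizes _ xl.
  rewrite mE in c1 s1; have [cd cm] := contractions_cons c1.
  have hG : cls (N + s) (B * 2 ^+ s) (bil h v (Y^T *m P x.2)).
    by apply: cls_bil => //; apply: mclsM h2; exact: mcls_tr.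
  rewrite mE; apply: E_tr_wick => // [u w hu hw|]; first exact: IH (ltnW s1).
  exact: ltnW.
rewrite ons LE.
set s2 := \sum_(p <- tw) E _ in bt2 *; set s3 := \sum_(p <- SY) E _ in bt3 *.
set t1 := \sum_(p <- tw) _; set t3 := \sum_(p <- SY) _.
pose t2 := n%:R^-1 * s2; pose t4 := n%:R^-1 * s3; rewrite -/t2 -/t4.
have -> : t1 + t2 + (t3 + t4) - t1 + rest - t3 = rest + t2 + t4 by ring.
apply: le_trans (ler_normD _ _) _; rewrite /wick_error -/s mulrDl; apply: lerD.
  apply: le_trans (ler_normD _ _) _; rewrite mulrDr mulrDl; apply: lerD.
    apply: le_trans bt1 _; rewrite -[leRHS]mulrA.
    rewrite ler_wpM2r ?ler_nat // mulr_ge0 ?invn_ge0 //.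
    by rewrite !(addr_ge0, mulr_ge0) ?exprn_ge0 ?cov_bound_ge0.
  by rewrite normrM (ger0_norm invn_ge0) mulrC ler_wpM2r ?invn_ge0.
by rewrite normrM (ger0_norm invn_ge0) mulrC ler_wpM2r ?invn_ge0.
Qed.

(** [E_wick] with Y = 1: nothing is differentiated on the left, so no leading term remains. The
    induction on the length provides the smallness of the shorter words. *)
Lemma E_bil_wick s l u v : unit_ball u -> unit_ball v -> contractions l -> (size l <= s)%N ->
  `|E (bil u v (Q l))| <= wick_bound R s * n%:R^-1.
Proof.
elim: s l u v => [|s IH] l u v hu hv hl.
  rewrite leqn0 size_eq0 => /eqP -> /=; rewrite mul0r.
  have := @loop_equation u v 1%:M 1%:M [::] [::] 1 (has_der_cst0 dmx_1) (has_der_cst0 dmx_1).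
  rewrite trmx1 mul1mx !mulmx1 mulr1 merge1 linear0 !big_nil !addr0 => ->.
  by rewrite mulr0 normr0.
rewrite leq_eqVlt ltnS => /orP[/eqP sl|/(IH _ _ _ hu hv hl) h]; last first.
  apply: le_trans h _; rewrite ler_wpM2r ?invn_ge0 //= lerDl.
  by rewrite wick_error_ge0 // wick_bound_ge0.
have hS : forall p : 'M[A]_n * 'M[A]_n, p \in [::] -> mcls 0 1 p.1 /\ mcls 0 1 p.2 by [].
have hI : forall m u' w', unit_ball u' -> unit_ball w' -> contractions m -> (size m < size l)%N ->
    `|E (bil u' w' (Q m))| <= wick_bound R s * n%:R^-1.
  by move=> m u' w' hu' hw' hm; rewrite sl ltnS; exact: IH.
have := E_wick (wick_bound_ge0 R s) hu hv hl (has_der_cst0 dmx_1) mcls_1 hS hI.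
rewrite big_nil subr0 trmx1 mul1mx sl => h; apply: le_trans h _.
by rewrite ler_wpM2r ?invn_ge0 //= lerDr wick_bound_ge0.
Qed.

(** [E_wick] with Y = D Q(l). Removing the leading Z leaves D on the left, with normalized trace
    <D>: the leading term. The other left factors have the form D Q(m) D' and small traces. *)
Lemma E_bil_wick_pair l l' d h h' : unit_ball h -> unit_ball h' -> contraction d ->
  contractions l -> contractions l' ->
  `|E (bil h h' ((Q l)^T *m Dg d *m Q l')) - entry_mean d * E (bil h h' ((P l)^T *m P l'))|
  <= wick_pair_error R (size l) (size l') * n%:R^-1.
Proof.
move=> hh hh' hd hl hl'.
set a := size l; set b := size l'.
pose SY := (Dg d, P l) :: [seq (Dg d *m Q x.1.1 *m Dg x.1.2, P x.2) | x <- splits l].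
have dY : has_der (Dg d *m Q l) SY.
  move=> i j; rewrite dmxM dmx_Dg mul0mx add0r (has_der_wick l).1 mulmx_sumr !big_cons !big_map /=.
  by rewrite splMl mulmx1; congr (_ + _); apply: eq_bigr => x _; rewrite splMl mulmxA.
have [hQ hP] := mcls_wick hl; have [hQ' hP'] := mcls_wick hl'.
have powle k : (k <= a)%N -> (2 ^+ k : R) <= 2 ^+ a by move=> ?; rewrite ler_eXn2l // ltr1n.
have hY : mcls a.+1 (2 ^+ a) (Dg d *m Q l).
  by rewrite -[a.+1]add0n -[2 ^+ a]mul1r; apply: mclsM => //; exact: mcls_Dg.
have pow1 : (1 : R) <= 2 ^+ a by rewrite exprn_ege1 // ler1n.
have splP x : x \in splits l -> [/\ (size x.1.1 < a)%N, (size x.2 < a)%N, contractions x.1.1,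
    contraction x.1.2 & contractions x.2].
  move=> xl; have [c1 c2 c3] := sub_contractions hl xl.
  by split => //; rewrite /a (splitsP xl) size_cat /=; lia.
have hSY p : p \in SY -> mcls a.+1 (2 ^+ a) p.1 /\ mcls a.+1 (2 ^+ a) p.2.
  rewrite inE => /predU1P[-> /=|/mapP[x xl -> /=]].
    split; last by apply: mcls_leN hP.
    by apply: mclsW pow1 _; apply: mcls_leN (mcls_Dg hd).
  have [s1 s2 c1 c2 c3] := splP _ xl; split.
    rewrite -[X in mcls X _ _]addn0 -[X in mcls _ X _]mulr1; apply: mclsM; last exact: mcls_Dg.
    rewrite -[X in mcls X _ _]add0n -[X in mcls _ X _]mul1r; apply: mclsM; first exact: mcls_Dg.
    apply: mclsW (powle _ (ltnW s1)) _; apply: mcls_leN (mcls_wick c1).1.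
    by rewrite ltnS ltnW.
  apply: mclsW (powle _ (ltnW s2)) _; apply: mcls_leN (mcls_wick c3).2.
  by rewrite leqW // ltnW.
have hI : forall m u' w', unit_ball u' -> unit_ball w' -> contractions m -> (size m < b)%N ->
    `|E (bil u' w' (Q m))| <= wick_bound R b * n%:R^-1.
  by move=> m u' w' hu' hw' hm /ltnW; exact: E_bil_wick.
have := E_wick (wick_bound_ge0 R b) hh hh' hl' dY hY hSY hI.
rewrite trmx_mul Dg_tr {1}/SY big_cons /= -EZ scalerAl tr_Dg -scalerAl mul1r EZ.
rewrite size_map size_splits -/a -/b big_map /=.
set X := E _; set Y := entry_mean d * _; set W := \sum_(x <- _) _ => hX.
have hW : `|W| <= a%:R * ((wick_bound R a * (mom_bound R (a + b) * (2 ^+ a * 2 ^+ b)) +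
    cov_bound R (a + (a + b)) * 2 ^+ a * (2 ^+ a * 2 ^+ b)) * n%:R^-1).
  rewrite /a -[X in X%:R * _](size_splits l) -/a; apply: norm_sum_le => x xl.
  have [s1 s2 c1 c2 c3] := splP _ xl.
  apply: E_tr_wick => //; first exact: wick_bound_ge0.
    by move=> u w hu hw; apply: E_bil_wick => //; exact: ltnW.
  apply: cls_bil => //; apply: mclsM hP'; apply: mcls_tr.
  apply: mclsW (powle _ (ltnW s2)) _; apply: mcls_leN (ltnW s2) _.
  exact: (mcls_wick c3).2.
have -> : X - Y = (X - (Y + W)) + W by ring.
apply: le_trans (ler_normD _ _) _; rewrite /wick_pair_error mulrDl; apply: lerD => //.
by apply: le_trans hW _; rewrite mulrA.
Qed.

Lemma second_moment_wick l u v : unit_ball u -> unit_ball v -> contractions l ->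
  E (bil u v (Q l) * bil u v (Q l)) <= wick_var R (size l) * n%:R^-1.
Proof.
move=> hu hv hl; apply: (second_moment_cls _ (E_bil_wick hu hv hl (leqnn _))).
by apply: cls_bil => //; exact: (mcls_wick hl).1.
Qed.

Definition wick_defect l l' d h h' : A :=
  bil h h' ((Q l)^T *m Dg d *m Q l') - entry_mean d *: bil h h' ((P l)^T *m P l').

Lemma second_moment_wick_defect l l' d h h' : unit_ball h -> unit_ball h' -> contraction d ->
  contractions l -> contractions l' ->
  E (wick_defect l l' d h h' * wick_defect l l' d h h') <=
  wick_pair_var R (size l) (size l') * n%:R^-1.
Proof.
move=> hh hh' hd hl hl'; apply: second_moment_cls.
  have [hQ hP] := mcls_wick hl; have [hQ' hP'] := mcls_wick hl'.
  apply: clsD.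
    apply: cls_bil => //; apply: mclsM hQ'.
    rewrite -[(size l).+1]addn0 -[2 ^+ size l]mulr1; apply: mclsM; first exact: mcls_tr.
    exact: mcls_Dg.
  rewrite -scaleNr; apply: (@clsW _ (`|- entry_mean d| * (2 ^+ size l * 2 ^+ size l'))).
    by rewrite ler_piMl ?mulr_ge0 ?exprn_ge0 // normrN mean_le1.
  apply: clsZ; apply: (@cls_leN (size l + size l')); first by lia.
  by apply: cls_bil => //; apply: mclsM hP'; exact: mcls_tr.
by rewrite linearB EZ; exact: E_bil_wick_pair.
Qed.

End gaussian_calculus.

(** * Moments of independent Gaussian variables *)

Section density_transfer.
Local Open Scope ereal_scope.
Context (R : realType) d1 (T1 : measurableType d1) d2 (T2 : measurableType d2).
Variables (m1 : {measure set T1 -> \bar R}) (m2 : {measure set T2 -> \bar R}).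
Variables (X : T1 -> T2) (G : T1 -> R) (c : R).
Hypotheses (mX : measurable_fun setT X) (mG : measurable_fun setT G).
Hypotheses (G0 : forall x, (0 <= G x)%R) (c0 : (0 <= c)%R).
Hypothesis GA : forall A, measurable A ->
  \int[m1]_x ((G x)%:E * (\1_A (X x))%:E) = c%:E * m2 A.

Import HBNNSimple.

Let nnsfun_transfer (h : {nnsfun T2 >-> R}) :
  \int[m1]_x ((G x)%:E * (h (X x))%:E) = c%:E * \int[m2]_x (h x)%:E.
Proof.
have mind A : measurable A -> measurable_fun setT (EFin \o (\1_A \o X : T1 -> R)).
  by move=> mA; apply/measurable_EFinP; apply: measurableT_comp.
rewrite -ge0_integralZl//; last 2 first.
  - exact/measurable_EFinP.
  - by move=> x _; rewrite lee_fin.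
under eq_integral.
  move=> x _; rewrite fimfunE -fsumEFin// ge0_mule_fsumr; last first.
    by move=> r; rewrite EFinM nnfun_muleindic_ge0.
  over.
rewrite ge0_integral_fsum//; last 2 first.
  - move=> r; apply: emeasurable_funM; apply/measurable_EFinP => //.
    by apply: measurable_funM => //; apply: measurableT_comp.
  - by move=> r x _; rewrite mule_ge0 ?lee_fin // -lee_fin EFinM nnfun_muleindic_ge0.
under [RHS]eq_integral.
  move=> x _; rewrite fimfunE -fsumEFin// ge0_mule_fsumr; last first.
    by move=> r; rewrite EFinM nnfun_muleindic_ge0.
  over.
rewrite [RHS]ge0_integral_fsum//; last 2 first.
  - move=> r; apply: emeasurable_funM; apply/measurable_EFinP => //.
    by apply: measurable_funM.
  - by move=> r x _; rewrite mule_ge0 ?lee_fin // -lee_fin EFinM nnfun_muleindic_ge0.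
apply: eq_fsbigr => r _.
have [r0|r0] := leP 0%R r; last first.
  have h0 : h @^-1` [set r] = set0.
    by rewrite preimage_nnfun0.
  by rewrite h0 !integral0_eq // => x _; rewrite indic0 mulr0 mule0.
under eq_integral do rewrite EFinM muleCA.
rewrite ge0_integralZl//; last 2 first.
  - by apply: emeasurable_funM; [exact/measurable_EFinP|exact: mind].
  - by move=> x _; rewrite mule_ge0 ?lee_fin //.
under [RHS]eq_integral do rewrite EFinM muleCA.
rewrite [RHS]ge0_integralZl//; last 2 first.
  - by apply: emeasurable_funM; apply/measurable_EFinP => //.
  - by move=> x _; rewrite mule_ge0 ?lee_fin //.
rewrite GA // ge0_integralZl ?lee_fin //; last exact/measurable_EFinP.
by rewrite integral_indic// setIT.
Qed.

(** From indicators to simple functions by linearity, then by monotone convergence. It serves for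
    the law and density of an entry, for independence, and for both marginals of a coupling. *)
Lemma ge0_integral_transfer (f : T2 -> \bar R) :
  measurable_fun setT f -> (forall x, 0 <= f x) ->
  \int[m1]_x ((G x)%:E * f (X x)) = c%:E * \int[m2]_x f x.
Proof.
move=> mf f0; pose f_ := nnsfun_approx measurableT mf.
have fcvg x : (f_ n x)%:E @[n --> \oo] --> f x.
  exact: (cvg_nnsfun_approx measurableT mf (fun x _ => f0 x)).
have cvgfm : (\int[m2]_x f x) = limn (fun n => \int[m2]_x (f_ n x)%:E).
  rewrite -monotone_convergence//=.
  - by apply: eq_integral => x _; apply/esym/cvg_lim => //; exact: fcvg.
  - by move=> n; exact/measurable_EFinP.
  - by move=> n x _; rewrite lee_fin.
  - by move=> x _ a b ab; rewrite lee_fin//; exact/lefP/nd_nnsfun_approx.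
transitivity (limn (fun n => \int[m1]_x ((G x)%:E * (f_ n (X x))%:E))).
  rewrite -monotone_convergence//=.
  - apply: eq_integral => x _; apply/esym/cvg_lim => //.
    by apply: cvgeZl => //; exact: fcvg.
  - move=> n; apply: emeasurable_funM; apply/measurable_EFinP => //.
    by apply: measurableT_comp.
  - by move=> n x _; rewrite mule_ge0 ?lee_fin //.
  - move=> x _ a b ab; rewrite lee_wpmul2l ?lee_fin //.
    exact/lefP/nd_nnsfun_approx.
rewrite cvgfm -limeMl//.
  by congr (limn _); apply/funext => n /=; rewrite nnsfun_transfer.
apply/ereal_nondecreasing_is_cvgn => a b ab; apply: ge0_le_integral => //.
- by move=> x _; rewrite lee_fin.
- exact/measurable_EFinP.
- exact/measurable_EFinP.
- by move=> x _; rewrite lee_fin; exact/lefP/nd_nnsfun_approx.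
Qed.

End density_transfer.

(** * Integrability and integration by parts for the Gaussian density *)

Section gaussian_moments.
Variables (R : realType) (s : R).
Hypothesis s_gt0 : 0 < s.
Local Notation mu := (@lebesgue_measure R).
Local Notation g := (normal_fun 0 s).

Let s_neq0 : s != 0. Proof. by rewrite gt_eqF. Qed.

(** With y = x^2 / (4 s^2) the unnormalized density is exp(-2y). One factor exp(-y) pays for |x|^k
    <= 1 + (4 s^2)^k y^k through y^k <= k! exp(y); the other lies below the Gaussian of deviation
    2s. *)
Definition gauss_dom k : R := 1 + (4 * s ^+ 2) ^+ k * k`!%:R.

Lemma normal_fun_dom k x : `|x ^+ k * g x| <= gauss_dom k * normal_fun 0 (2 * s) x.
Proof.
rewrite normrM [X in _ * X <= _]ger0_norm ?normal_fun_ge0 // normrX.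
pose y := x ^+ 2 / (4 * s ^+ 2).
have s2 : 0 < 4 * s ^+ 2 by rewrite mulr_gt0 // exprn_gt0.
have y0 : 0 <= y by rewrite divr_ge0 ?sqr_ge0 // ltW.
have gE : g x = expR (- y) * expR (- y).
  by rewrite -expRD /normal_fun /y subr0; congr expR; field.
have g2E : expR (- y) <= normal_fun 0 (2 * s) x.
  rewrite /normal_fun subr0 ler_expR.
  have -> : - x ^+ 2 / ((2 * s) ^+ 2 *+ 2) = - y / 2 by rewrite /y; field.
  lra.
have yk : y ^+ k <= k`!%:R * expR y.
  case: k => [|k]; first by rewrite expr0 mul1r -expR0 ler_expR.
  have := expR_ge1Dxn k y0; have f0 : 0 < k.+1`!%:R :> R by rewrite ltr0n fact_gt0.
  move=> h; rewrite mulrC -ler_pdivrMr //; apply: le_trans h; lra.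
have xk : `|x| ^+ k <= gauss_dom k * expR y.
  have e1 : 1 <= expR y by rewrite -expR0 ler_expR.
  have : `|x| ^+ k <= 1 + (x ^+ 2) ^+ k.
    rewrite -exprM mulnC [x ^+ (k * 2)]exprM -normrX -(real_normK (num_real (x ^+ k))).
    have := sqr_ge0 (`|x ^+ k| - 1); have := normr_ge0 (x ^+ k); nra.
  move=> h; apply: le_trans h _.
  have -> : x ^+ 2 = 4 * s ^+ 2 * y by rewrite /y; field.
  rewrite exprMn /gauss_dom; move: (4 * s ^+ 2) s2 => w w0.
  rewrite mulrDl mul1r; apply: lerD => //.
  by rewrite -[leRHS]mulrA ler_wpM2l // exprn_ge0 // ltW.
rewrite gE mulrA; apply: ler_pM => //; rewrite ?mulr_ge0 ?exprn_ge0 ?expR_ge0 //.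
by rewrite expRN ler_pdivrMr ?expR_gt0.
Qed.

Lemma gauss_dom_ge0 k : 0 <= gauss_dom k.
Proof. by rewrite addr_ge0 // mulr_ge0 // exprn_ge0 // mulr_ge0 // sqr_ge0. Qed.

Let measurable_xg k : measurable_fun setT (fun x : R => x ^+ k * g x).
Proof.
apply: measurable_funM; last exact: measurable_normal_fun.
exact: measurable_funX.
Qed.

Lemma integrable_xg k : mu.-integrable setT (fun x => (x ^+ k * g x)%:E).
Proof.
have s2 : 2 * s != 0 by rewrite mulf_neq0.
have := integrableZl measurableT (gauss_dom k / normal_peak (2 * s))
  (integrable_normal_pdf 0 (2 * s)).
apply: le_integrable => //; first by apply/measurable_EFinP; exact: measurable_xg.
move=> x _; rewrite -EFinM !abse_EFin lee_fin.
apply: le_trans (normal_fun_dom k x) _; rewrite normal_pdfE // -mulrA.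
rewrite [_^-1 * _]mulrA mulVf ?mul1r; first exact: ler_norm.
by rewrite gt_eqF // normal_peak_gt0.
Qed.

Definition gauss_der (k : nat) (x : R) : R := k%:R * (x ^+ k.-1 * g x) - (s ^+ 2)^-1 * (x ^+ k.+1 * g x).

Lemma is_derive_xg (k : nat) (x : R) : is_derive x 1 (fun y : R => y ^+ k * g y) (gauss_der k x).
Proof.
have hX j : is_derive x 1 (fun y : R => y ^+ j) ((j%:R * x ^+ j.-1) *: 1).
  have -> : (fun y : R => y ^+ j) = (@id R) ^+ j by apply/funext => y; rewrite fctE.
  exact: is_deriveX.
have h1 : is_derive x 1 (fun y : R => - (y - 0) ^+ 2 / (s ^+ 2 *+ 2)) (- x / s ^+ 2).
  have -> : (fun y : R => - (y - 0) ^+ 2 / (s ^+ 2 *+ 2)) =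
            (fun y : R => (- (s ^+ 2 *+ 2)^-1) *: (y ^+ 2)).
    by apply/funext => y; rewrite subr0 /GRing.scale /= mulNr mulNr mulrC.
  have -> : - x / s ^+ 2 = (- (s ^+ 2 *+ 2)^-1) *: ((2%:R * x ^+ 1) *: 1).
    by rewrite /GRing.scale /=; field.
  by apply: is_deriveZ; exact: (hX 2%N).
have h2 : is_derive x 1 g (g x * (- x / s ^+ 2)).
  exact: (@is_derive1_comp _ expR (fun y : R => - (y - 0) ^+ 2 / (s ^+ 2 *+ 2))).
have := is_deriveM (hX k) h2.
rewrite [X in is_derive _ _ _ X](_ : _ = gauss_der k x) //.
by rewrite /gauss_der /GRing.scale /= [x ^+ k.+1]exprS; field.
Qed.

Lemma continuous_xg k : continuous (fun x : R => x ^+ k * g x).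
Proof.
move=> x; apply: differentiable_continuous; apply/derivable1_diffP.
by have [] := is_derive_xg k x.
Qed.

Lemma continuous_gauss_der k : continuous (gauss_der k).
Proof.
move=> x; apply: cvgB; apply: cvgM; try exact: cvg_cst; exact: continuous_xg.
Qed.

(** Domination with one more power of x leaves a factor 1/n. *)
Lemma xg_cvg0 k : (fun n : nat => (n%:R ^+ k * g n%:R : R)) @ \oo --> (0 : R).
Proof.
apply/cvgrPdist_le => e e0.
near=> n; rewrite sub0r normrN.
have n0 : 0 < n%:R :> R by near: n; exists 1%N => // m /= m1; rewrite ltr0n.
have := normal_fun_dom k.+1 n%:R; rewrite exprS -mulrA normrM (ger0_norm (ltW n0)).
move=> h; rewrite -(ler_pM2l n0); apply: le_trans h _.
apply: (@le_trans _ _ (gauss_dom k.+1)).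
  rewrite ler_piMr ?gauss_dom_ge0 // -expR0 ler_expR mulNr oppr_le0.
  by rewrite divr_ge0 ?sqr_ge0 // mulrn_wge0 // sqr_ge0.
rewrite -ler_pdivrMr //; near: n; exact: nbhs_infty_ger.
Unshelve. all: by end_near. Qed.

(** The fundamental theorem on [-n, n]: the boundary values tend to 0, and dominated convergence
    gives the integral over the line. *)
Lemma integral_gauss_der k : (\int[mu]_x (gauss_der k x)%:E = 0)%E.
Proof.
have ig : mu.-integrable setT (fun x => (gauss_der k x)%:E).
  rewrite (_ : (fun x => _) = (fun x : R => (k%:R%:E * (x ^+ k.-1 * g x)%:E) -
     ((s ^+ 2)^-1%:E * (x ^+ k.+1 * g x)%:E))%E); last first.
    by apply/funext => x; rewrite -!EFinM -EFinB.
  by apply: integrableB => //; apply: integrableZl => //; exact: integrable_xg.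
pose I n := `[- n%:R, n%:R]%classic : set R.
pose f := fun x => (gauss_der k x)%:E.
have mder : measurable_fun [set: R] (gauss_der k).
  exact: continuous_measurable_fun (@continuous_gauss_der k).
have mf : measurable_fun [set: R] f by exact/measurable_EFinP.
have mfI n : measurable_fun [set: R] (f \_ (I n)).
  have mI : measurable (I n) by exact: measurable_itv.
  by have [h _] := measurable_restrictT f mI; apply: h; exact: measurable_funTS.
have fcvg : {ae mu, forall x, [set: R] x -> (f \_ (I n)) x @[n --> \oo] --> f x}.
  apply: aeW => x _; apply: cvg_near_cst; near=> n.
  rewrite patchE mem_set // /I /= in_itv /= -ler_norml; near: n.
  exact: nbhs_infty_ger.
have fle : {ae mu, forall x n, [set: R] x -> (`|(f \_ (I n)) x| <= `|f x|)%E}.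
  by apply: aeW => x n _; rewrite patchE; case: ifP => // _; rewrite abse0.
have iabs : mu.-integrable [set: R] (fun x => `|f x|%E) by exact: integrable_abse.
have [_ _ h] := @dominated_convergence _ _ _ mu setT measurableT _ f _ mfI mf fcvg iabs fle.
have {}h : (fun n => (n%:R ^+ k * g n%:R)%:E - ((- n%:R) ^+ k * g (- n%:R))%:E)%E @ \oo -->
    (\int[mu]_x f x)%E.
  apply: cvg_trans h; apply: near_eq_cvg; near=> n => /=.
  rewrite -integral_mkcond.
  have n0 : 0 < n%:R :> R by near: n; exists 1%N => // m /= m1; rewrite ltr0n.
  apply: (@continuous_FTC2 _ _ (fun x => x ^+ k * g x)).
  - by lra.
  - by apply: continuous_subspaceT; exact: continuous_gauss_der.
  - split=> [x _||].
    + by have [] := is_derive_xg k x.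
    + by apply: cvg_at_right_filter; exact: continuous_xg.
    + by apply: cvg_at_left_filter; exact: continuous_xg.
  - move=> x _; rewrite derive1E; by have [_ ->] := is_derive_xg k x.
have h0 : (fun n => (n%:R ^+ k * g n%:R)%:E - ((- n%:R) ^+ k * g (- n%:R))%:E)%E @ \oo -->
    ((0 : R)%:E - (0 : R)%:E)%E.
  apply: cvgeB => //; apply: cvg_EFin; try exact: nearW.
    exact: xg_cvg0.
  have gN x : g (- x) = g x by rewrite /normal_fun !subr0 sqrrN.
  rewrite -[X in _ --> X](mulr0 ((-1) ^+ k)).
  rewrite [X in X @ _ --> _](_ : _ = (fun n => (-1) ^+ k * (n%:R ^+ k * g n%:R))).
    by apply: cvgM; [exact: cvg_cst|exact: xg_cvg0].
  by apply/funext => n /=; rewrite gN [(- _) ^+ k]exprNn mulrA.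
by rewrite (cvg_unique _ h h0) // sube0.
Unshelve. all: by end_near. Qed.

End gaussian_moments.

Section gaussian_law.
Variables (R : realType) (s : R).
Hypothesis s_gt0 : 0 < s.
Context d (T : measurableType d) (P : probability T R) (X : T -> R).
Hypothesis mX : measurable_fun setT X.
Hypothesis lawX : forall A, measurable A -> pushforward P X A = normal_prob 0 s A.
Local Notation mu := (@lebesgue_measure R).
Local Notation pdf := (normal_pdf 0 s).

Lemma ge0_integral_gaussian (f : R -> \bar R) :
  measurable_fun setT f -> (forall x, 0 <= f x)%E ->
  (\int[P]_w f (X w) = \int[mu]_x ((pdf x)%:E * f x))%E.
Proof.
move=> mf f0.
transitivity (\int[normal_prob 0 s]_x f x)%E.
  have GA A : measurable A ->
      (\int[P]_w ((cst (1 : R) w)%:E * (\1_A (X w))%:E) = 1%:E * normal_prob 0 s A)%E.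
    move=> mA; rewrite mul1e -(lawX mA).
    under eq_integral do rewrite mul1e.
    rewrite (_ : (fun w => _) = (fun w => (\1_(X @^-1` A) w)%:E)) //.
    rewrite integral_indic // ?setIT //; by rewrite -[X in measurable X]setTI; exact: mX.
  have := ge0_integral_transfer (m2 := normal_prob 0 s) mX (@measurable_cst _ _ _ _ setT (1 : R)) (fun _ => ler01) ler01 GA mf f0.
  by rewrite mul1e => <-; apply: eq_integral => w _; rewrite mul1e.
have GA A : measurable A ->
    (\int[mu]_x ((pdf x)%:E * (\1_A (id x))%:E) = 1%:E * normal_prob 0 s A)%E.
  move=> mA; rewrite mul1e /normal_prob [RHS]integral_mkcond.
  apply: eq_integral => x _; rewrite patchE indicE /=.
  by case: (x \in A); rewrite ?mule1 ?mule0.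
have := ge0_integral_transfer (m1 := mu) (m2 := normal_prob 0 s) (@measurable_id _ _ setT) (measurable_normal_pdf 0 s)
  (normal_pdf_ge0 0 s) ler01 GA mf f0.
by rewrite mul1e => ->.
Qed.

Lemma integral_gaussian (f : R -> R) : measurable_fun setT f ->
  (\int[P]_w (f (X w))%:E = \int[mu]_x (pdf x * f x)%:E)%E.
Proof.
move=> mf; have mEf : measurable_fun setT (EFin \o f) by exact/measurable_EFinP.
rewrite integralE [RHS]integralE; congr (_ - _)%E.
  transitivity (\int[P]_w ((EFin \o f)^\+%E (X w)))%E.
    by apply: eq_integral => w _; rewrite !funeposE.
  rewrite ge0_integral_gaussian //.
    apply: eq_integral => x _; rewrite !funeposE /= -EFin_max -[0%E]/(0%:E) -EFin_max.
    by rewrite -EFinM maxr_pMr ?normal_pdf_ge0 // mulr0.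
  exact: measurable_funepos.
transitivity (\int[P]_w ((EFin \o f)^\-%E (X w)))%E.
  by apply: eq_integral => w _; rewrite !funenegE.
rewrite ge0_integral_gaussian //.
  apply: eq_integral => x _; rewrite !funenegE /= -[0%E]/(0%:E) -!EFin_max.
  by rewrite -EFinM maxr_pMr ?normal_pdf_ge0 // mulr0 mulrN.
exact: measurable_funeneg.
Qed.

Let pdfE x k : pdf x * x ^+ k = normal_peak s * (x ^+ k * normal_fun 0 s x).
Proof. by rewrite normal_pdfE ?gt_eqF //; ring. Qed.

Lemma gaussian_pow_integrable k : P.-integrable setT (fun w => (X w ^+ k)%:E).
Proof.
apply/integrableP; split.
  by apply/measurable_EFinP; exact: measurable_funX.
have h := @ge0_integral_gaussian (fun x => `|(x ^+ k)%:E|%E).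
rewrite h //; last first.
  by apply: measurableT_comp => //; apply/measurable_EFinP; exact: measurable_funX.
under eq_integral.
  move=> x _; rewrite -[(pdf x)%:E]gee0_abs ?lee_fin ?normal_pdf_ge0 // -abseM -EFinM pdfE.
  over.
have /integrableP[_] := integrableZl measurableT (normal_peak s) (integrable_xg s_gt0 k).
by under eq_integral do rewrite -EFinM.
Qed.

(** The derivative of x^k times the density integrates to 0. For k = 0 the truncated predecessor has
    coefficient 0, and the identity says that the mean vanishes. *)
Lemma gaussian_moment_rec k :
  (\int[P]_w (X w ^+ k.+1)%:E = (k%:R * s ^+ 2)%:E * \int[P]_w (X w ^+ k.-1)%:E)%E.
Proof.
have mpow j : measurable_fun setT (fun x : R => x ^+ j) by exact: measurable_funX.
have E j : (\int[P]_w (X w ^+ j)%:E =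
    (normal_peak s)%:E * \int[mu]_x (x ^+ j * normal_fun 0 s x)%:E)%E.
  rewrite (@integral_gaussian (fun x => x ^+ j)) //.
  rewrite -integralZl //; last exact: integrable_xg.
  by apply: eq_integral => x _; rewrite pdfE EFinM.
have := integral_gauss_der s_gt0 k; rewrite /gauss_der.
under eq_integral do rewrite EFinB !EFinM -!EFinM [X in (X - _)%E]EFinM [X in (_ - X)%E]EFinM.
rewrite integralB //; last 2 first.
  by apply: integrableZl => //; exact: integrable_xg.
  by apply: integrableZl => //; exact: integrable_xg.
rewrite !integralZl //; [|exact: integrable_xg..].
rewrite !E.
have fin j : (\int[mu]_x (x ^+ j * normal_fun 0 s x)%:E)%E \is a fin_num.
  by apply: integrable_fin_num => //; exact: integrable_xg.
rewrite -(fineK (fin k.-1)) -(fineK (fin k.+1)) -!EFinM -EFinB => -[h]; congr (_%:E).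
have s2 : s ^+ 2 != 0 by rewrite expf_neq0 // gt_eqF.
set a := fine _ in h *; set b := fine _ in h *.
have bE : b = s ^+ 2 * ((s ^+ 2)^-1 * b) by rewrite mulrA divff ?mul1r.
by rewrite bE -(subr0_eq h); ring.
Qed.

End gaussian_law.

(** * Expectations of products of independent variables *)

Section independent_products.
Context (R : realType) d (Om : measurableType d) (P : probability Om R).
Variables (I : finType) (X : I -> Om -> R).
Hypothesis mX : forall i, measurable_fun setT (X i).
Hypothesis indX : mutually_independent P X.

Definition mean_of (f : Om -> R) : R := fine (\int[P]_w (f w)%:E)%E.

Lemma prod_indic_integral (A : I -> set R) : (forall i, measurable (A i)) ->
  (\int[P]_w (\prod_i (\1_(A i) (X i w) : R))%:E =
   \prod_i \int[P]_w (\1_(A i) (X i w))%:E)%E.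
Proof.
move=> mA; pose S : {set I} := [set: I]%SET.
pose B := \bigcap_(i in [set i | i \in S]) (X i @^-1` A i).
have mXA i : measurable (X i @^-1` A i).
  by rewrite -[X in measurable X]setTI; exact: mX.
have mB : measurable B by apply: fin_bigcap_measurable => //; exact: finite_finset.
have -> : (fun w => (\prod_i (\1_(A i) (X i w) : R))%:E) = (fun w => (\1_B w)%:E).
  apply/funext => w; congr (_%:E); rewrite [RHS]indicE.
  have [wB|wB] := pselect (B w).
    rewrite mem_set //; apply: big1 => i _; rewrite indicE mem_set //.
    by apply: (wB i); rewrite /= inE.
  rewrite memNset //.
  have [i iA] : exists i, ~ A i (X i w).
    by apply: contrapT => h; apply: wB => i _; apply: contrapT => h'; apply: h; exists i.
  by rewrite (bigD1 i) //= indicE memNset // mul0r.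
have PB := indX S mA.
rewrite integral_indic // setIT [LHS]PB.
rewrite big_mkcond /=; apply: eq_bigr => i _; rewrite inE.
by rewrite (_ : (fun w => _) = (fun w => (\1_(X i @^-1` A i) w)%:E)) // integral_indic ?setIT.
Qed.

Let measurable_prod (f : I -> R -> R) (Q : pred I) :
  (forall i, measurable_fun setT (f i)) ->
  measurable_fun setT (fun w => \prod_(i | Q i) f i (X i w)).
Proof.
move=> mf; rewrite (_ : (fun w => _) = (fun w => \prod_(i <- enum Q) f i (X i w))).
  by apply: measurable_prod => i _; apply: measurableT_comp.
by apply/funext => w; rewrite big_enum.
Qed.

(** [T] lists the coordinates where [f] need not be an indicator. The induction hypothesis with an
    indicator at [j] says that weighting by the other factors only rescales the law of [X j]; the
    transfer lemma extends this to [f j]. *)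
Lemma ge0_prod_integral (T : seq I) (f : I -> R -> R) :
  (forall i, measurable_fun setT (f i)) -> (forall i x, 0 <= f i x) ->
  (forall i, i \notin T -> exists2 A, measurable A & f i = \1_A) ->
  (forall i, (\int[P]_w (f i (X i w))%:E)%E \is a fin_num) ->
  (\int[P]_w (\prod_i f i (X i w))%:E = \prod_i \int[P]_w (f i (X i w))%:E)%E.
Proof.
elim: T f => [|j T IH] f mf f0 fT ffin.
  have /choice[A hA] : forall i, exists A, measurable A /\ f i = \1_A.
    by move=> i; have [A mA fA] := fT i isT; exists A.
  have -> : f = fun i => \1_(A i) by apply/funext => i; rewrite (hA i).2.
  by apply: prod_indic_integral => i; exact: (hA i).1.
pose c := \prod_(i | i != j) mean_of (fun w => f i (X i w)).
pose G w := \prod_(i | i != j) f i (X i w).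
have mean0 i : 0 <= mean_of (fun w => f i (X i w)).
  by apply: fine_ge0; apply: integral_ge0 => w _; rewrite lee_fin.
have cE : ((\prod_(i | i != j) \int[P]_w (f i (X i w))%:E) = c%:E)%E.
  rewrite /c -prodEFin; apply: eq_bigr => i _; by rewrite /mean_of fineK.
have GA A : measurable A -> (\int[P]_w ((G w)%:E * (\1_A (X j w))%:E) =
    c%:E * pushforward P (X j) A)%E.
  move=> mA; pose h i := if i == j then \1_A else f i.
  have hj i : i != j -> h i = f i by rewrite /h => /negbTE ->.
  have hjj : h j = \1_A by rewrite /h eqxx.
  have mh i : measurable_fun setT (h i).
    by rewrite /h; case: ifP => // _; exact: measurable_indic.
  have h0 i x : 0 <= h i x by rewrite /h; case: ifP.
  have hT i : i \notin T -> exists2 A, measurable A & h i = \1_A.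
    rewrite /h; case: eqVneq => [_ _|ij iT]; first by exists A.
    by apply: fT; rewrite inE negb_or ij.
  have indE : (\int[P]_w (\1_A (X j w))%:E = P (X j @^-1` A))%E.
    rewrite (_ : (fun w => _) = (fun w => (\1_(X j @^-1` A) w)%:E)) // integral_indic ?setIT //.
    by rewrite -[X in measurable X]setTI; exact: mX.
  have hfin i : (\int[P]_w (h i (X i w))%:E)%E \is a fin_num.
    have [->|ij] := eqVneq i j; last by rewrite hj.
    by rewrite hjj indE fin_num_measure // -[X in measurable X]setTI; exact: mX.
  have hE := IH h mh h0 hT hfin.
  transitivity (\int[P]_w (\prod_i h i (X i w))%:E)%E.
    apply: eq_integral => w _; rewrite -EFinM; congr (_%:E).
    rewrite (bigD1 j) //= hjj mulrC; congr (_ * _).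
    by apply: eq_bigr => i /hj ->.
  rewrite hE (bigD1 j) //= hjj indE muleC -cE; congr (_ * _)%E.
  by apply: eq_bigr => i /hj ->.
rewrite [RHS](bigD1 j) //= cE muleC.
have G0 w : 0 <= G w by apply: prodr_ge0.
have c0 : 0 <= c by apply: prodr_ge0.
have mG : measurable_fun setT G by exact: measurable_prod.
have mEf : measurable_fun setT (EFin \o f j) by exact/measurable_EFinP.
have f0' x : (0 <= (EFin \o f j) x)%E by rewrite lee_fin.
have := ge0_integral_transfer
  (m2 := measure_function_pushforward__canonical__measure_function_Measure P (mX j))
  (mX j) mG G0 c0 GA mEf f0'.
rewrite (ge0_integral_pushforward (mX j)) //= => [<-|]; last by move=> x _; exact: f0'.
by apply: eq_integral => w _; rewrite /= -EFinM (bigD1 j) //= mulrC.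
Qed.

Lemma integrable_fine (f : Om -> R) : P.-integrable setT (EFin \o f) ->
  (\int[P]_w (f w)%:E = (mean_of f)%:E)%E.
Proof. by move=> h; rewrite /mean_of fineK //; exact: integrable_fin_num. Qed.

Lemma mean_ofB (f g : Om -> R) :
  P.-integrable setT (EFin \o f) -> P.-integrable setT (EFin \o g) ->
  mean_of (fun w => f w - g w) = mean_of f - mean_of g.
Proof.
move=> hf hg; apply: EFin_inj; rewrite EFinB -!integrable_fine //.
  by rewrite -integralB.
exact: (integrableB measurableT hf hg).
Qed.

(** [T] lists the coordinates where [f] may change sign. Splitting [f j] into positive and negative
    part gives two products covered by the induction hypothesis. *)
Lemma prod_mean (T : seq I) (f : I -> R -> R) :
  (forall i, measurable_fun setT (f i)) ->
  (forall i, i \notin T -> forall x, 0 <= f i x) ->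
  (forall i, P.-integrable setT (fun w => (f i (X i w))%:E)) ->
  P.-integrable setT (fun w => (\prod_i f i (X i w))%:E) /\
  mean_of (fun w => \prod_i f i (X i w)) = \prod_i mean_of (fun w => f i (X i w)).
Proof.
elim: T f => [|j T IH] f mf f0 fint.
  have hp : (\int[P]_w (\prod_i f i (X i w))%:E =
      (\prod_i mean_of (fun w => f i (X i w)))%:E)%E.
    rewrite (@ge0_prod_integral (enum I)) //.
    - by rewrite -prodEFin; apply: eq_bigr => i _; exact: (@integrable_fine (fun w => f i (X i w)) (fint i)).
    - by move=> i x; exact: f0.
    - by move=> i; rewrite mem_enum.
    - by move=> i; apply: integrable_fin_num.
  split; last by rewrite /mean_of hp.
  apply/integrableP; split; first by apply/measurable_EFinP; exact: measurable_prod.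
  under eq_integral.
    move=> w _; rewrite gee0_abs ?lee_fin; last by apply: prodr_ge0 => i _; exact: f0.
    over.
  by rewrite hp ltry.
pose fp i := if i == j then (f j)^\+ else f i.
pose fn i := if i == j then (f j)^\- else f i.
have mfp i : measurable_fun setT (fp i).
  by rewrite /fp; case: ifP => // _; exact: measurable_funrpos.
have mfn i : measurable_fun setT (fn i).
  by rewrite /fn; case: ifP => // _; exact: measurable_funrneg.
have intp i : P.-integrable setT (fun w => (fp i (X i w))%:E).
  rewrite /fp; case: eqVneq => [->|_]; last exact: fint.
  exact: (integrable_funrpos measurableT (fint j)).
have intn i : P.-integrable setT (fun w => (fn i (X i w))%:E).
  rewrite /fn; case: eqVneq => [->|_]; last exact: fint.
  exact: (integrable_funrneg measurableT (fint j)).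
have fp0 i : i \notin T -> forall x, 0 <= fp i x.
  rewrite /fp; case: eqVneq => // ij iT; apply: f0; by rewrite inE negb_or ij.
have fn0 i : i \notin T -> forall x, 0 <= fn i x.
  rewrite /fn; case: eqVneq => // ij iT; apply: f0; by rewrite inE negb_or ij.
have [ip ep] := IH fp mfp fp0 intp.
have [in_ en] := IH fn mfn fn0 intn.
have fpn x : f j x = fp j x - fn j x.
  by rewrite /fp /fn eqxx -[in LHS](funrposBneg (f j)) fctE.
have restE (h : I -> R -> R) (Hh : forall i, i != j -> h i = f i) w :
    \prod_i h i (X i w) = h j (X j w) * \prod_(i | i != j) f i (X i w).
  by rewrite (bigD1 j) //=; congr (_ * _); apply: eq_bigr => i /Hh ->.
have fpj i : i != j -> fp i = f i by rewrite /fp => /negbTE ->.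
have fnj i : i != j -> fn i = f i by rewrite /fn => /negbTE ->.
have prodE : (fun w => \prod_i f i (X i w)) =
    (fun w => \prod_i fp i (X i w) - \prod_i fn i (X i w)).
  by apply/funext => w; rewrite restE // (restE fp) // (restE fn) // fpn mulrBl.
split.
  rewrite (_ : (fun w => _) = (fun w => (\prod_i fp i (X i w))%:E -
     (\prod_i fn i (X i w))%:E)%E); first exact: integrableB.
  by apply/funext => w; rewrite -EFinB -[LHS]/(EFin _) (congr1 (fun g => g w) prodE).
rewrite prodE mean_ofB // ep en ![\prod_i mean_of _](bigD1 j) //=.
rewrite (eq_bigr (fun i => mean_of (fun w => f i (X i w)))); last by move=> i /fpj ->.
rewrite [X in _ - _ * X](eq_bigr (fun i => mean_of (fun w => f i (X i w)))); last first.
  by move=> i /fnj ->.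
rewrite -mulrBl -mean_ofB; [|exact: (intp j)|exact: (intn j)].
by congr (mean_of _ * _); apply/funext => w; rewrite -fpn.
Qed.

End independent_products.

(** * Wick words of the GOE *)

Fixpoint wickR (R : realType) n (Z : 'M[R]_n) (l : seq 'rV[R]_n) : 'M[R]_n * 'M[R]_n :=
  if l is d :: l' then
    (Z *m diag_mx d *m (wickR Z l').1 - entry_mean d *: (wickR Z l').2,
     diag_mx d *m (wickR Z l').1)
  else (Z, 1%:M).

Section goe_polynomials.
Context (R : realType) (n : nat) d (Om : measurableType d) (P : probability Om R).
Variable Z : Om -> 'M[R]_n.
Hypothesis n_gt0 : (0 < n)%N.
Hypothesis goeZ : is_GOE P Z.

Notation pairs := {p : 'I_n * 'I_n | (p.1 <= p.2)%N}.
Notation k := #|{: pairs}|.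
Notation A := (mpoly k R).
Notation mean := (mean_of P).

Definition entry (p : pairs) (w : Om) : R := Z w (val p).1 (val p).2.

Lemma sorted_pair_subproof (a b : 'I_n) :
  (fun p : 'I_n * 'I_n => (p.1 <= p.2)%N) (if (a <= b)%N then (a, b) else (b, a)).
Proof. by case: leqP => //= /ltnW. Qed.

(** The polynomial variables are the independent entries on and above the diagonal; sorting the
    indices makes [Zpoly] symmetric by construction. *)
Definition sorted_pair a b : pairs := Sub _ (sorted_pair_subproof a b).

Definition ev (w : Om) (p : A) : R := meval (fun i => entry (enum_val i) w) p.
Definition Zpoly : 'M[A]_n := \matrix_(a, b) mpolyX R (mnm1 (enum_rank (sorted_pair a b))).

Lemma Zpoly_sym : Zpoly^T = Zpoly.
Proof.
apply/matrixP => a b; rewrite !mxE; do 3 congr (_ _); apply/val_inj => /=.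
by case: ltngtP => // /val_inj ->.
Qed.

Lemma ev_Zpoly w a b : ev w (Zpoly a b) = Z w a b.
Proof.
have [sym _ _ _ _] := goeZ.
rewrite mxE /ev mevalXU /entry enum_rankK /=; case: leqP => //= _.
by rewrite -[in LHS]sym mxE.
Qed.

Lemma measurable_entry p : measurable_fun setT (entry p).
Proof. by have [_ h _ _ _] := goeZ; exact: h. Qed.

Definition pair_var (p : pairs) : R := (1 + ((val p).1 == (val p).2)%:R) / n%:R.

Lemma entry_law p B : measurable B ->
  pushforward P (entry p) B = normal_prob 0 (Num.sqrt (pair_var p)) B.
Proof.
have [_ _ hoff hdiag _] := goeZ; move=> mB; rewrite /entry /pair_var.
case: p => -[a b] /= ab; case: eqVneq => [abE|abN].
  by rewrite -abE; exact: (hdiag a B mB).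
by rewrite addr0 mul1r; apply: (hoff a b) => //; rewrite ltn_neqAle ab andbT.
Qed.

Lemma pair_var_gt0 p : 0 < pair_var p.
Proof. by rewrite divr_gt0 ?ltr0n // ltr_pwDl. Qed.

Lemma sd_gt0 p : 0 < Num.sqrt (pair_var p).
Proof. by rewrite sqrtr_gt0 pair_var_gt0. Qed.

Lemma integrable_entry_pow p e : P.-integrable setT (fun w => (entry p w ^+ e)%:E).
Proof. exact: (gaussian_pow_integrable (sd_gt0 p) (measurable_entry p) (@entry_law p)). Qed.

Lemma mean_entry_rec p e :
  mean (fun w => entry p w ^+ e.+1) = e%:R * pair_var p * mean (fun w => entry p w ^+ e.-1).
Proof.
have := gaussian_moment_rec (sd_gt0 p) (measurable_entry p) (@entry_law p) e.
rewrite sqr_sqrtr ?ltW ?pair_var_gt0 //.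
rewrite (integrable_fine (integrable_entry_pow p e.+1)).
by rewrite (integrable_fine (integrable_entry_pow p e.-1)) -EFinM => -[].
Qed.

Lemma ev_monomial w m :
  ev w (mpolyX R m) = \prod_p entry p w ^+ m (enum_rank p).
Proof.
rewrite /ev mevalX (reindex (@enum_rank _)) /=; last exact: onW_bij (@enum_rank_bij _).
by apply: eq_bigr => p _; rewrite enum_rankK.
Qed.

Lemma monomial_mean m :
  P.-integrable setT (fun w => (ev w (mpolyX R m))%:E) /\
  mean (fun w => ev w (mpolyX R m)) = \prod_p mean (fun w => entry p w ^+ m (enum_rank p)).
Proof.
have [_ _ _ _ ind] := goeZ.
have := @prod_mean _ _ _ P pairs entry measurable_entry ind (enum {: pairs})
  (fun p x => x ^+ m (enum_rank p)).
case.
- by move=> p; exact: measurable_funX.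
- by move=> p; rewrite mem_enum.
- by move=> p; exact: integrable_entry_pow.
- move=> h1 h2; split; last first.
    by rewrite -h2; congr (mean _); apply/funext => w; rewrite ev_monomial.
  rewrite (_ : (fun w => _) = (fun w => (\prod_p entry p w ^+ m (enum_rank p))%:E)) //.
  by apply/funext => w; rewrite ev_monomial.
Qed.

Lemma integrable_ev (p : A) : P.-integrable setT (fun w => (ev w p)%:E).
Proof.
elim/mpolyind: p => [|c m p _ _ IH].
  rewrite (_ : (fun w => _) = cst 0%E) ?integrable0 //.
  by apply/funext => w; rewrite /ev meval0.
rewrite (_ : (fun w => _) = (fun w => c%:E * (ev w (mpolyX R m))%:E + (ev w p)%:E)%E).
  apply: integrableD => //; apply: integrableZl => //; exact: (monomial_mean m).1.
by apply/funext => w; rewrite /ev mevalD mevalZ EFinD EFinM.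
Qed.

Definition Epoly (p : A) : R := mean (fun w => ev w p).

Lemma EpolyE p : (\int[P]_w (ev w p)%:E = (Epoly p)%:E)%E.
Proof. exact: (@integrable_fine _ _ _ P (fun w => ev w p) (integrable_ev p)). Qed.

Lemma Epoly_is_scalar : scalar Epoly.
Proof.
move=> c p q; apply: EFin_inj; rewrite EFinD EFinM -!EpolyE.
rewrite -integralZl //; last exact: integrable_ev.
rewrite -integralD //; last 2 first.
- by apply: integrableZl => //; exact: integrable_ev.
- exact: integrable_ev.
by apply: eq_integral => w _; rewrite /ev mevalD mevalZ EFinD EFinM.
Qed.

HB.instance Definition _ := GRing.isLinear.Build R A R *%R Epoly Epoly_is_scalar.

(** The factor is n times the variance of the entry: it is 2 on the diagonal, where the direction
    e_a e_b^T + e_b e_a^T counts the entry twice. *)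
Definition dpoly (a b : 'I_n) (p : A) : A :=
  (1 + (a == b)%:R : R) *: mderiv (enum_rank (sorted_pair a b)) p.

Lemma dpoly_is_linear a b : linear (dpoly a b).
Proof.
move=> c p q; rewrite /dpoly linearD linearZ /= scalerDr.
by rewrite !scalerA mulrC.
Qed.

HB.instance Definition _ a b := GRing.isLinear.Build R A A *:%R (dpoly a b) (dpoly_is_linear a b).

Lemma dpolyM a b p q : dpoly a b (p * q) = dpoly a b p * q + p * dpoly a b q.
Proof. by rewrite /dpoly mderivM scalerDr scalerAl scalerAr. Qed.

Lemma sorted_pair_eq a b c e : (sorted_pair a b == sorted_pair c e) =
  ((a == c) && (b == e)) || ((a == e) && (b == c)).
Proof.
rewrite -val_eqE /=; case: leqP => h1; case: leqP => h2; rewrite xpair_eqE.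
all: by rewrite -!(inj_eq val_inj) /=; lia.
Qed.

Lemma dpolyZ a b c e :
  dpoly a b (Zpoly c e) = ((a == c) && (b == e))%:R + ((a == e) && (b == c))%:R.
Proof.
rewrite mxE /dpoly mderivX mnm1E (inj_eq enum_rank_inj) eq_sym.
have := sorted_pair_eq a b c e; case: eqVneq => [sE|_]; last first.
  by move=> /esym/norP[/negbTE -> /negbTE ->]; rewrite scale0r scaler0 addr0.
rewrite -sE (_ : mnm_sub _ _ = mnm0); last by apply/mnmP => j; rewrite mnmBE subnn mnm0E.
rewrite mpolyX0 scale1r => /esym; have [<-|ab] := eqVneq a b.
  by rewrite andbC orbb [(a == e) && _]andbC andbC => ->; rewrite scalerDl !scale1r.
rewrite addr0 scale1r; have [<-|ac] := eqVneq a c => /=.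
  by rewrite [b == a]eq_sym (negbTE ab) andbF orbF => ->; rewrite addr0.
by move=> ->; rewrite add0r.
Qed.

Lemma Epoly1 : Epoly 1 = 1.
Proof.
rewrite /Epoly /mean_of (_ : (fun w => _) = cst 1%E); last first.
  by apply/funext => w; rewrite /ev meval1.
by rewrite integral_cst //= probability_setT mule1.
Qed.

(** By linearity a monomial suffices. Independence factors out the other entries, equal on both
    sides, and the moment recursion of a single Gaussian remains. *)
Lemma Epoly_ibp a b F : Epoly (Zpoly a b * F) = n%:R^-1 * Epoly (dpoly a b F).
Proof.
elim/mpolyind: F => [|c m p _ _ IH].
  by rewrite mulr0 !linear0 mulr0.
rewrite mulrDr !linearD /= IH mulrDr; congr (_ + _).
rewrite -scalerAr !linearZ /= mxE -mpolyXD mderivX linearZ /=.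
set q := sorted_pair a b; set i := enum_rank q.
have key : Epoly (mpolyX R (mnm_add (mnm1 i) m)) =
    (m i)%:R * pair_var q * Epoly (mpolyX R (mnm_sub m (mnm1 i))).
  rewrite /Epoly !(monomial_mean _).2 ![\prod_p _](bigD1 q) //= mulrA.
  rewrite mnmDE mnmBE mnm1E eqxx add1n subn1 mean_entry_rec; congr (_ * _).
  apply: eq_bigr => r pq; rewrite mnmDE mnmBE mnm1E (inj_eq enum_rank_inj).
  by rewrite eq_sym (negbTE pq) add0n subn0.
have varE : pair_var q = (1 + (a == b)%:R) / n%:R.
  by rewrite /pair_var /q /=; case: leqP => //= _; rewrite eq_sym.
by rewrite key varE; ring.
Qed.

HB.instance Definition _ w :=
  GRing.RMorphism.copy (ev w) (meval (fun i => entry (enum_val i) w)).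

Lemma ev_alg w (c : R) : ev w c%:A = c.
Proof. by rewrite /ev mevalZ meval1 mulr1. Qed.

Lemma ev_cmx w m p (u : 'M[R]_(m, p)) : map_mx (ev w) (cmx A u) = u.
Proof. by apply/matrixP => i j; rewrite [LHS]mxE [cmx _ _ _ _]mxE ev_alg. Qed.

Lemma ev_bil w u v (W : 'M[A]_n) :
  ev w (bil u v W) = (u^T *m map_mx (ev w) W *m v) 0 0.
Proof.
transitivity (map_mx (ev w) ((cmx A u)^T *m W *m cmx A v) 0 0); first by rewrite [RHS]mxE.
by rewrite !map_mxM map_trmx !ev_cmx.
Qed.

Lemma ev_Dg w (e : 'rV[R]_n) : map_mx (ev w) (Dg A e) = diag_mx e.
Proof. by rewrite /Dg map_diag_mx ev_cmx. Qed.

Lemma ev_wick w l :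
  map_mx (ev w) (wick Zpoly l).1 = (wickR (Z w) l).1 /\
  map_mx (ev w) (wick Zpoly l).2 = (wickR (Z w) l).2.
Proof.
have evZ : map_mx (ev w) Zpoly = Z w by apply/matrixP => i j; rewrite mxE ev_Zpoly.
elim: l => [|e l [IH1 IH2]] /=; first by rewrite evZ map_mx1.
split; last by rewrite map_mxM ev_Dg IH1.
by rewrite map_mxB !map_mxM map_mxZ -[X in X *: _]/(ev w _) ev_alg evZ ev_Dg IH1 IH2.
Qed.

Definition wick_form (u v : 'cV[R]_n) l w : R := (u^T *m (wickR (Z w) l).1 *m v) 0 0.

Definition wick_pair_form l l' e (h h' : 'cV[R]_n) w : R :=
  (h^T *m ((wickR (Z w) l).1^T *m diag_mx e *m (wickR (Z w) l').1) *m h') 0 0 -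
  entry_mean e * (h^T *m ((wickR (Z w) l).2^T *m (wickR (Z w) l').2) *m h') 0 0.

Lemma chebyshev_ev (p : A) (c eps : R) : 0 < eps -> Epoly (p * p) <= c ->
  exists2 B, measurable B & ((P B <= (c / eps ^+ 2)%:E)%E /\
    forall w, ~ B w -> `|ev w p| <= eps).
Proof.
move=> eps0 hc; have e20 : 0 < eps ^+ 2 by rewrite exprn_gt0.
have mev : measurable_fun setT (fun w => ev w (p * p)).
  by apply/measurable_EFinP; have /integrableP[] := integrable_ev (p * p).
have evpp w : ev w (p * p) = ev w p ^+ 2 by rewrite rmorphM.
have ev0 w : 0 <= ev w (p * p) by rewrite evpp sqr_ge0.
pose B := [set: Om] `&` [set w | (eps ^+ 2)%:E <= `|(ev w (p * p))%:E|]%E.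
have BE : B = [set: Om] `&` (fun w => ev w (p * p)) @^-1` `[eps ^+ 2, +oo[.
  apply/seteqP; split=> w [_ h]; split=> //; move: h => /=;
    by rewrite lee_fin ger0_norm // in_itv /= andbT.
exists B; first by rewrite BE; apply: mev.
split.
  have mE : measurable_fun setT (fun w => (ev w (p * p))%:E) by exact/measurable_EFinP.
  have := le_integral_abse P measurableT mE e20; rewrite -/B => h.
  have hE : (\int[P]_w `|(ev w (p * p))%:E| = (Epoly (p * p))%:E)%E.
    by rewrite -EpolyE; apply: eq_integral => w _; rewrite gee0_abs ?lee_fin.
  rewrite -(@lee_pmul2l _ (eps ^+ 2)%:E) ?lte_fin //; apply: le_trans h _.
  by rewrite hE -EFinM lee_fin mulrCA divff ?mulr1 // gt_eqF.
move=> w wB; rewrite leNgt; apply/negP => lt; apply: wB; split=> //=.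
rewrite lee_fin ger0_norm // evpp -[ev w p ^+ 2]real_normK ?num_real //.
by rewrite ler_sqr ?nnegrE ?(ltW eps0) // ltW.
Qed.

Lemma wick_form_small l u v eps : unit_ball u -> unit_ball v -> contractions l -> 0 < eps ->
  exists2 B, measurable B & ((P B <= (wick_var R (size l) * n%:R^-1 / eps ^+ 2)%:E)%E /\
    forall w, ~ B w -> `|wick_form u v l w| <= eps).
Proof.
move=> hu hv hl eps0.
have h := second_moment_wick n_gt0 Zpoly_sym dpolyM dpolyZ Epoly1 Epoly_ibp hu hv hl.
have [B mB [PB hB]] := chebyshev_ev eps0 h; exists B => //; split=> // w /hB.
by rewrite ev_bil (ev_wick w l).1.
Qed.

Lemma wick_pair_form_small l l' e h h' eps :
  unit_ball h -> unit_ball h' -> contraction e -> contractions l -> contractions l' -> 0 < eps ->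
  exists2 B, measurable B &
    ((P B <= (wick_pair_var R (size l) (size l') * n%:R^-1 / eps ^+ 2)%:E)%E /\
    forall w, ~ B w -> `|wick_pair_form l l' e h h' w| <= eps).
Proof.
move=> hh hh' he hl hl' eps0.
have hE := second_moment_wick_defect n_gt0 Zpoly_sym dpolyM dpolyZ Epoly1 Epoly_ibp
  hh hh' he hl hl'.
have [B mB [PB hB]] := chebyshev_ev eps0 hE; exists B => //; split=> // w /hB.
rewrite /wick_defect rmorphB /= -mul_mpolyC rmorphM /= {2}/ev mevalC !ev_bil.
rewrite !map_mxM -!map_trmx ev_Dg.
by rewrite !(ev_wick w _).1 !(ev_wick w _).2.
Qed.

End goe_polynomials.

(** * Limits of the empirical averages *)

Lemma measurable_tuple_bool k (A : set (k.-tuple bool)) : measurable A.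
Proof.
have h (b : k.-tuple bool) : measurable [set b].
  have -> : [set b] = \bigcap_(i in [set: 'I_k]) ((fun x : k.-tuple bool => tnth x i) @^-1` [set tnth b i]).
    apply/seteqP; split=> [x -> i _ //|x hx].
    by apply: eq_from_tnth => i; exact: hx.
  apply: fin_bigcap_measurable => // i _; rewrite -[X in measurable X]setTI.
  exact: measurable_tnth.
have -> : A = \bigcup_(b in A) [set b].
  by apply/seteqP; split=> [x Ax|x [b Ab ->] //]; exists x.
exact: fin_bigcup_measurable.
Qed.

Lemma measurable_init_bits t : measurable_fun setT (init_bits t).
Proof.
apply/measurable_fun_tnthP => i; apply: (@measurable_fun_bool _ _ _ _ true).
rewrite setTI; apply: sub_sigma_algebra; exists i, true.
by apply/seteqP; split=> w /=; rewrite tnth_mktuple.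
Qed.

(** * Integrals against a coupling *)

Section coupling.
Context (R : realType) (t n : nat).
Variables (z : 'I_n -> (R * R) * (t.+1).-tuple bool).
Variables (mu : probability (R * R)%type R) (nu : probability bitstrings R).
Notation S := ((R * R) * (t.+1).-tuple bool)%type.
Variable g : probability (S * S)%type R.
Hypothesis gz : couplings (empirical z) (mu \x pushforward nu (init_bits t))%E g.
Variable chi : (t.+1).-tuple bool -> bool.

Definition nu_chi : R := fine (nu [set w | chi (init_bits t w)]).

Lemma integral_coupling1 (f : S -> \bar R) : measurable_fun setT f -> (forall x, 0 <= f x)%E ->
  (\int[g]_x f x.1 = (n%:R^-1)%:E * \sum_(i < n) f (z i))%E.
Proof.
move=> mf f0.
(* [msum] runs over the natural numbers, so [z] is extended by an arbitrary point. *)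
pose z' k := oapp z point (insub k : option 'I_n).
have ni0 : 0 <= (n%:R^-1 : R) by rewrite invr_ge0.
pose m := mscale (NngNum ni0) (msum (fun k => \d_(z' k)) n).
have z'E (i : 'I_n) : z' i = z i by rewrite /z' valK.
have GA A : measurable A ->
    (\int[g]_x ((cst (1 : R) x)%:E * (\1_A (x.1))%:E) = 1%:E * m A)%E.
  move=> mA; rewrite mul1e; under eq_integral do rewrite mul1e.
  rewrite (_ : (fun x => _) = (fun x => (\1_(A `*` [set: S]) x)%:E)); last first.
    apply/funext => x; congr (_%:E); rewrite !indicE.
    by congr ((_ : bool)%:R); apply/idP/idP; rewrite !inE => //= -[].
  rewrite integral_indic //; last exact: measurableX.
  rewrite setIT; etransitivity; first exact: (gz.1 A mA).
  rewrite /empirical /m /mscale /msum /=.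
  by congr (_ * _)%E; apply: eq_bigr => i _; rewrite z'E.
have := ge0_integral_transfer (m1 := g) (m2 := m) (@measurable_fst _ _ _ _)
  (@measurable_cst _ _ _ _ setT (1 : R)) (fun _ => ler01) ler01 GA mf f0.
rewrite mul1e => h.
transitivity (\int[g]_x ((cst 1 x)%:E * f x.1))%E.
  by apply: eq_integral => x _; rewrite mul1e.
rewrite h /m ge0_integral_mscale //; congr (_ * _)%E.
rewrite ge0_integral_measure_sum //; apply: eq_bigr => i _.
by rewrite integral_dirac // diracT mul1e z'E.
Qed.

(** The second marginal is a product, so a weight depending on the bits rescales the law of the real
    pair by a constant. *)
Lemma integral_coupling2 (f : R * R -> \bar R) :
  measurable_fun setT f -> (forall x, 0 <= f x)%E ->
  (\int[g]_x ((chi x.2.2)%:R%:E * f x.2.1) = nu_chi%:E * \int[mu]_x f x)%E.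
Proof.
move=> mf f0.
pose B := [set b | chi b].
have mB : measurable B by exact: measurable_tuple_bool.
pose G (x : S * S) : R := \1_B x.2.2.
have GE x : G x = (chi x.2.2)%:R.
  by rewrite /G indicE; congr (nat_of_bool _)%:R; apply/idP/idP; rewrite inE.
have finB : nu [set w | chi (init_bits t w)] \is a fin_num.
  apply: fin_num_measure.
  have : measurable ([set: bitstrings] `&` init_bits t @^-1` B) by apply: measurable_init_bits.
  by rewrite setTI.
have mX : measurable_fun setT (fun x : S * S => x.2.1).
  by apply: measurableT_comp => //; exact: measurable_fst.
have mG : measurable_fun setT G.
  apply: measurableT_comp => //; apply: measurableT_comp => //; exact: measurable_snd.
have GA A : measurable A ->
    (\int[g]_x ((G x)%:E * (\1_A (x.2.1))%:E) = nu_chi%:E * mu A)%E.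
  move=> mA.
  rewrite (_ : (fun x => _) = (fun x => (\1_([set: S] `*` (A `*` B)) x)%:E)); last first.
    apply/funext => -[x [a b]] /=; rewrite /G /= -EFinM !indicE -natrM mulnb; congr (_%:R%:E).
    by rewrite !in_setX in_setT /= andbC.
  rewrite integral_indic //; last by apply: measurableX => //; exact: measurableX.
  rewrite setIT; etransitivity; first exact: (gz.2 (A `*` B) (measurableX mA mB)).
  rewrite /product_measure1 /=.
  transitivity (\int[mu]_x (nu_chi%:E * (\1_A x)%:E))%E.
    apply: eq_integral => x _.
    rewrite /= indicE /pushforward; have [xA|xA] := boolP (x \in A).
      by rewrite in_xsectionX // mule1 /nu_chi fineK.
    by rewrite notin_xsectionX // mule0 preimage_set0 measure0.
  rewrite ge0_integralZl //.
  - by rewrite integral_indic // setIT.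
  - exact/measurable_EFinP.
  - by rewrite lee_fin fine_ge0.
have nu0 : 0 <= nu_chi by exact: fine_ge0.
have G0 x : 0 <= G x by [].
have := ge0_integral_transfer (m1 := g) (m2 := mu) mX mG G0 nu0 GA mf f0.
by move=> <-; apply: eq_integral => x _; rewrite GE.
Qed.

End coupling.

Lemma nu_chi_true (R : realType) (nu : probability bitstrings R) t :
  nu_chi nu (fun _ : (t.+1).-tuple bool => true) = 1.
Proof.
rewrite /nu_chi (_ : [set w | _] = setT) ?probability_setT //.
by apply/seteqP; split.
Qed.

Section coupling_estimate.
Context (R : realType) (t : nat).
Variables (mu : probability (R * R)%type R) (nu : probability bitstrings R).
Variable chi : (t.+1).-tuple bool -> bool.
Variables (al be ga : R).
Hypotheses (al1 : `|al| <= 1) (be1 : `|be| <= 1).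
Notation S := ((R * R) * (t.+1).-tuple bool)%type.

Definition aff (x : R * R) : R := al * x.1 + be * x.2 + ga.
(** One family yields all limits: a constant affine function gives the averages of masks, a
    coordinate gives norms, and the sum of both coordinates gives the inner product by
    polarization. *)
Definition test_fun (s : S) : R := (chi s.2)%:R * aff s.1 ^+ 2.
Definition aff_tail (K : R) (x : R * R) : R := aff x ^+ 2 * (K < `|aff x|)%R%:R.
(* Bound for the oscillation of test_fun: affine squares are not Lipschitz, hence the free
   parameter kap from Young's inequality, and a flip of chi costs sqdist >= 1, which pays for
   values up to K. *)
Definition test_rem (kap K : R) (a b : S) : R :=
  (2 * (1 + kap^-1) + 4 + 2 * K ^+ 2) * sqdist a b +
  kap * aff b.1 ^+ 2 + 2 * aff_tail K b.1.

Lemma sqdist_ge0 (a b : S) : 0 <= sqdist a b.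
Proof. by rewrite !addr_ge0 ?sqr_ge0 // sumr_ge0 // => j _; rewrite sqr_ge0. Qed.

Lemma aff_sqdist (a b : S) : (aff a.1 - aff b.1) ^+ 2 <= 2 * sqdist a b.
Proof.
have s0 : 0 <= \sum_(j < t.+1) ((tnth a.2 j)%:R - (tnth b.2 j)%:R) ^+ 2 :> R.
  by rewrite sumr_ge0 // => j _; rewrite sqr_ge0.
rewrite /sqdist; move: (\sum_j _) s0 => r r0.
rewrite /aff; move: a.1 b.1 => [x1 x2] [y1 y2] /=.
have ha : al ^+ 2 <= 1 by rewrite -real_normK ?num_real // expr_le1.
have hb : be ^+ 2 <= 1 by rewrite -real_normK ?num_real // expr_le1.
set u := x1 - y1; set v := x2 - y2.
have -> : al * x1 + be * x2 + ga - (al * y1 + be * y2 + ga) = al * u + be * v.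
  by rewrite /u /v; ring.
have h1 : 0 <= (1 - al ^+ 2) * u ^+ 2 by rewrite mulr_ge0 ?sqr_ge0 // subr_ge0.
have h2 : 0 <= (1 - be ^+ 2) * v ^+ 2 by rewrite mulr_ge0 ?sqr_ge0 // subr_ge0.
have h3 := sqr_ge0 (al * u - be * v).
have -> : (al * u + be * v) ^+ 2 =
    2 * (al ^+ 2 * u ^+ 2) + 2 * (be ^+ 2 * v ^+ 2) - (al * u - be * v) ^+ 2 by ring.
rewrite mulrBl mul1r in h1; rewrite mulrBl mul1r in h2; lra.
Qed.

Lemma sqdist_ge1 (a b : S) : a.2 != b.2 -> 1 <= sqdist a b.
Proof.
move=> ab; have [j jab] : exists j, tnth a.2 j != tnth b.2 j.
  apply/existsP; rewrite -negb_forall; apply: contra ab => /forallP h.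
  by apply/eqP/eq_from_tnth => j; apply/eqP; exact: h.
rewrite /sqdist (bigD1 j) //=.
have -> : ((tnth a.2 j)%:R - (tnth b.2 j)%:R) ^+ 2 = 1 :> R.
  by case: (tnth a.2 j) (tnth b.2 j) jab => -[] //= _; rewrite ?sub0r ?subr0 ?sqrrN expr1n.
have := sqr_ge0 (a.1.1 - b.1.1); have := sqr_ge0 (a.1.2 - b.1.2).
have : 0 <= \sum_(i < t.+1 | i != j) ((tnth a.2 i)%:R - (tnth b.2 i)%:R) ^+ 2 :> R.
  by rewrite sumr_ge0 // => i _; rewrite sqr_ge0.
lra.
Qed.

(** Write x, y for the affine values and D for [sqdist]. If [chi] agrees, Young's inequality bounds
    2y(x - y), and (x - y)^2 <= 2D. Otherwise D >= 1, so y^2 <= K^2 D + tail and x^2 <= 2(x - y)^2 +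
    2y^2 <= 4D + 2K^2 D + 2 tail. *)
Lemma test_fun_le kap K (a b : S) : 0 < kap -> 0 <= K ->
  `|test_fun a - test_fun b| <= test_rem kap K a b.
Proof.
move=> kap0 K0.
have D0 := sqdist_ge0 a b; have hD := aff_sqdist a b.
rewrite /test_fun /test_rem /aff_tail.
set x := aff a.1 in hD *; set y := aff b.1 in hD *; set D := sqdist a b in D0 hD *.
have k0 : 0 < kap^-1 by rewrite invr_gt0.
have kk : kap * kap^-1 = 1 by rewrite divff // gt_eqF.
set k := kap^-1 in k0 kk *.
have y2 := sqr_ge0 y; have K2 := sqr_ge0 K.
have tail0 : 0 <= y ^+ 2 * (K < `|y|)%R%:R by rewrite mulr_ge0.
have e1 : 0 <= k * (kap * y - (x - y)) ^+ 2 by rewrite mulr_ge0 ?sqr_ge0 // ltW.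
have e2 : 0 <= k * (kap * y + (x - y)) ^+ 2 by rewrite mulr_ge0 ?sqr_ge0 // ltW.
have e1' : k * (kap * y - (x - y)) ^+ 2 = kap * y ^+ 2 - 2 * y * (x - y) + k * (x - y) ^+ 2.
  transitivity ((kap * k) * (kap * y ^+ 2 - 2 * y * (x - y)) + k * (x - y) ^+ 2); first by ring.
  by rewrite kk mul1r.
have e2' : k * (kap * y + (x - y)) ^+ 2 = kap * y ^+ 2 + 2 * y * (x - y) + k * (x - y) ^+ 2.
  transitivity ((kap * k) * (kap * y ^+ 2 + 2 * y * (x - y)) + k * (x - y) ^+ 2); first by ring.
  by rewrite kk mul1r.
have hkD : k * (x - y) ^+ 2 <= k * (2 * D) by rewrite ler_wpM2l // ltW.
have KD : 0 <= K ^+ 2 * D by rewrite mulr_ge0.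
have kD : 0 <= k * D by rewrite mulr_ge0 // ltW.
have ky : 0 <= kap * y ^+ 2 by rewrite mulr_ge0 // ltW.
have xE : x ^+ 2 = y ^+ 2 + 2 * y * (x - y) + (x - y) ^+ 2 by ring.
have xy2 := sqr_ge0 (x - y).
have xle : x ^+ 2 <= 2 * (x - y) ^+ 2 + 2 * y ^+ 2.
  by have := sqr_ge0 (x - y - y); rewrite xE; nra.
set Y := y ^+ 2 in y2 tail0 e1' e2' ky xE xle *; set V := (x - y) ^+ 2 in hD hkD xy2 xE xle e1' e2' *.
set W := 2 * y * (x - y) in e1' e2' xE *; set T := Y * _ in tail0 *.
have same : `|x ^+ 2 - Y| <= (2 * (1 + k) + 4 + 2 * K ^+ 2) * D + kap * Y + 2 * T.
  rewrite ler_norml xE e1' e2' in e1 e2 *; apply/andP; split; nra.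
have [ab|ab] := eqVneq (chi a.2) (chi b.2).
  by rewrite ab; case: (chi b.2); rewrite ?mul1r ?mul0r ?subrr ?normr0 //; apply: le_trans same.
have D1 : 1 <= D by apply: sqdist_ge1; apply: contraNneq ab => ->.
have YT : Y <= K ^+ 2 * D + T.
  rewrite /T; have [Ky|yK] := ltP K `|y|; first by rewrite mulr1; lra.
  rewrite mulr0 addr0; have : Y <= K ^+ 2.
    by rewrite /Y -real_normK ?num_real // ler_sqr ?nnegrE.
  nra.
have x20 := sqr_ge0 x.
case: (chi a.2) (chi b.2) ab => -[] // _; rewrite !(mul1r, mul0r) ?subr0 ?sub0r ?normrN ger0_norm //; nra.
Qed.

Lemma measurable_aff : measurable_fun setT aff.
Proof.
apply: measurable_funD => //; apply: measurable_funD; apply: measurable_funM => //.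
Qed.

Lemma measurable_aff2 : measurable_fun setT (fun x => aff x ^+ 2).
Proof. by apply: measurable_funX; exact: measurable_aff. Qed.

Lemma measurable_aff_tail K : measurable_fun setT (aff_tail K).
Proof.
apply: measurable_funM; first exact: measurable_aff2.
rewrite (_ : (fun x => _) = (fun b : bool => b%:R : R) \o (fun x => (K < `|aff x|)%R)) //.
apply: measurableT_comp => //; apply: measurable_fun_ltr => //.
by apply: measurableT_comp => //; exact: measurable_aff.
Qed.

Lemma measurable_tuple_fun k (f : k.-tuple bool -> R) : measurable_fun setT f.
Proof. by move=> _ Y mY; exact: measurable_tuple_bool. Qed.

Lemma measurable_sqdist : measurable_fun setT (fun x : S * S => sqdist x.1 x.2).
Proof.
have m1 : measurable_fun setT (fun x : S * S => x.1.1).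
  by apply: measurableT_comp => //; exact: measurable_fst.
have m2 : measurable_fun setT (fun x : S * S => x.2.1).
  by apply: measurableT_comp => //; exact: measurable_fst.
apply: measurable_funD.
  apply: measurable_funD; apply: measurable_funX; apply: measurable_funB;
  by apply: measurableT_comp.
apply: measurable_sum => j; apply: measurable_funX; apply: measurable_funB.
  apply: (measurableT_comp (f := fun b : (t.+1).-tuple bool => (tnth b j)%:R : R)).
    exact: measurable_tuple_fun.
  by apply: measurableT_comp => //; exact: measurable_snd.
apply: (measurableT_comp (f := fun b : (t.+1).-tuple bool => (tnth b j)%:R : R)).
  exact: measurable_tuple_fun.
by apply: measurableT_comp => //; exact: measurable_snd.
Qed.

Lemma measurable_test_fun : measurable_fun setT test_fun.
Proof.
apply: measurable_funM.
  apply: (measurableT_comp (f := fun b : (t.+1).-tuple bool => (chi b)%:R : R)) => //.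
  exact: measurable_tuple_fun.
exact: (measurableT_comp (f := fun x => aff x ^+ 2) measurable_aff2 measurable_fst).
Qed.

(** Integrate the bound of [test_fun_le] against [g]: the two marginals turn the test functions into
    the empirical average and its limit, and the remainder, apart from [sqdist], into integrals over
    [mu]. *)
Lemma coupling_estimate n (z : 'I_n -> S) (g : probability (S * S)%type R) kap K eps M T :
  couplings (empirical z) (mu \x pushforward nu (init_bits t))%E g ->
  0 < kap -> 0 <= K ->
  (\int[g]_x (sqdist x.1 x.2)%:E <= eps%:E)%E ->
  (\int[mu]_x (aff x ^+ 2)%:E = M%:E)%E ->
  (\int[mu]_x (aff_tail K x)%:E = T%:E)%E ->
  `|n%:R^-1 * \sum_(i < n) test_fun (z i) - nu_chi nu chi * M| <=
  (2 * (1 + kap^-1) + 4 + 2 * K ^+ 2) * eps + kap * M + 2 * T.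
Proof.
move=> gz kap0 K0 heps hM hT.
set c := 2 * (1 + kap^-1) + 4 + 2 * K ^+ 2.
have c0 : 0 <= c by rewrite !addr_ge0 ?mulr_ge0 ?addr_ge0 ?sqr_ge0 // invr_ge0 ltW.
have tf0 s : 0 <= test_fun s by rewrite mulr_ge0 ?sqr_ge0.
have i1 : (\int[g]_x (test_fun x.1)%:E = (n%:R^-1 * \sum_(i < n) test_fun (z i))%:E)%E.
  rewrite (integral_coupling1 gz (f := EFin \o test_fun)).
  - by rewrite EFinM sumEFin.
  - by apply/measurable_EFinP; exact: measurable_test_fun.
  - by move=> x; rewrite lee_fin.
have i2 : (\int[g]_x (test_fun x.2)%:E = (nu_chi nu chi * M)%:E)%E.
  rewrite EFinM -hM -(integral_coupling2 gz chi).
  - by apply: eq_integral => x _; rewrite -EFinM.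
  - by apply/measurable_EFinP; exact: measurable_aff2.
  - by move=> x; rewrite lee_fin sqr_ge0.
have i3 (f : R * R -> R) : measurable_fun setT f -> (forall x, 0 <= f x) ->
    (\int[g]_x (f x.2.1)%:E = \int[mu]_x (f x)%:E)%E.
  move=> mf f0; rewrite -[RHS]mul1e -(nu_chi_true nu t).
  rewrite -(integral_coupling2 gz (fun=> true)).
  - by apply: eq_integral => x _; rewrite mul1e.
  - exact/measurable_EFinP.
  - by move=> x; rewrite lee_fin.
have mm (f : R * R -> R) : measurable_fun setT f ->
    measurable_fun setT (fun x : S * S => (f x.2.1)%:E).
  move=> mf; apply/measurable_EFinP; apply: measurableT_comp => //.
  by apply: measurableT_comp => //; exact: measurable_fst.
have at0 x : 0 <= aff_tail K x by rewrite mulr_ge0 ?sqr_ge0.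
have ms : measurable_fun setT (fun x : S * S => (sqdist x.1 x.2)%:E).
  by apply/measurable_EFinP; exact: measurable_sqdist.
have mq : measurable_fun setT (fun x : S * S => aff x.2.1 ^+ 2).
  by apply/measurable_EFinP; apply: (mm (fun x => aff x ^+ 2)); exact: measurable_aff2.
have mt : measurable_fun setT (fun x : S * S => aff_tail K x.2.1).
  by apply/measurable_EFinP; apply: (mm (aff_tail K)); exact: measurable_aff_tail.
have gD (f h : S * S -> R) : (forall x, 0 <= f x) -> measurable_fun setT f ->
    (forall x, 0 <= h x) -> measurable_fun setT h ->
    (\int[g]_x (f x + h x)%:E = \int[g]_x (f x)%:E + \int[g]_x (h x)%:E)%E.
  move=> f0 mf h0 mh; rewrite -ge0_integralD // ?EFinD //.
  - by move=> x _; rewrite lee_fin.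
  - exact/measurable_EFinP.
  - by move=> x _; rewrite lee_fin.
  - exact/measurable_EFinP.
have gZ k (f : S * S -> R) : 0 <= k -> (forall x, 0 <= f x) -> measurable_fun setT f ->
    (\int[g]_x (k * f x)%:E = k%:E * \int[g]_x (f x)%:E)%E.
  move=> k0 f0 mf; rewrite -ge0_integralZl ?lee_fin //; first exact/measurable_EFinP.
  by move=> x _; rewrite lee_fin.
have i4 : (\int[g]_x (test_rem kap K x.1 x.2)%:E <= (c * eps + kap * M + 2 * T)%:E)%E.
  rewrite /test_rem -/c.
  rewrite (gD (fun x => c * sqdist x.1 x.2 + kap * aff x.2.1 ^+ 2) (fun x => 2 * aff_tail K x.2.1)).
  - rewrite (gD (fun x => c * sqdist x.1 x.2) (fun x => kap * aff x.2.1 ^+ 2)).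
    + rewrite (gZ c (fun x => sqdist x.1 x.2)) ?(gZ kap (fun x => aff x.2.1 ^+ 2)) ?(gZ 2 (fun x => aff_tail K x.2.1)) //.
      * rewrite (i3 (fun x => aff x ^+ 2)) //; [|exact: measurable_aff2|by move=> x; rewrite sqr_ge0].
        rewrite (i3 (aff_tail K)) //; last exact: measurable_aff_tail.
        rewrite hM hT !EFinD -!EFinM; apply: leeD2r; apply: leeD2r.
        by rewrite [X in (_ <= X)%E]EFinM; apply: lee_wpmul2l; rewrite ?lee_fin.
      * exact: ltW.
      * by move=> x; rewrite sqr_ge0.
      * by move=> x; exact: sqdist_ge0.
      * exact: measurable_sqdist.
    + by move=> x; rewrite mulr_ge0 ?sqdist_ge0.
    + by apply: measurable_funM => //; exact: measurable_sqdist.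
    + by move=> x; rewrite mulr_ge0 ?sqr_ge0 // ltW.
    + exact: measurable_funM.
  - move=> x; apply: addr_ge0; apply: mulr_ge0; rewrite ?sqdist_ge0 ?sqr_ge0 //.
    exact: ltW.
  - apply: measurable_funD; apply: measurable_funM => //; exact: measurable_sqdist.
  - by move=> x; rewrite mulr_ge0.
  - exact: measurable_funM.
have mt1 : measurable_fun setT (fun x : S * S => test_fun x.1).
  exact: (measurableT_comp measurable_test_fun).
have mt2 : measurable_fun setT (fun x : S * S => test_fun x.2).
  exact: (measurableT_comp measurable_test_fun).
have mr : measurable_fun setT (fun x : S * S => test_rem kap K x.1 x.2).
  apply: measurable_funD; last exact: measurable_funM.
  by apply: measurable_funD; apply: measurable_funM => //; exact: measurable_sqdist.
have r0 (x : S * S) : 0 <= test_rem kap K x.1 x.2.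
  exact: le_trans (test_fun_le x.1 x.2 kap0 K0).
(* Each inequality compares integrals of nonnegative functions, so no difference of integrals has to
   be formed. *)
have side (f h : S * S -> R) (a b : R) :
    (forall x, 0 <= f x) -> (forall x, 0 <= h x) ->
    measurable_fun setT f -> measurable_fun setT h ->
    (\int[g]_x (f x)%:E = a%:E)%E -> (\int[g]_x (h x)%:E = b%:E)%E ->
    (forall x, f x <= h x + test_rem kap K x.1 x.2) ->
    a - b <= c * eps + kap * M + 2 * T.
  move=> f0 h0 mf mh hf hh le; rewrite lerBlDl -lee_fin EFinD -hf -hh.
  apply: le_trans (leeD2l _ i4); rewrite -(gD h (fun x => test_rem kap K x.1 x.2)) //.
  apply: ge0_le_integral => //.
  - by move=> x _; rewrite lee_fin.
  - exact/measurable_EFinP.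
  - by apply/measurable_EFinP; exact: measurable_funD.
  - by move=> x _; rewrite lee_fin.
rewrite ler_norml lerNl opprB; apply/andP; split.
  apply: (side _ _ _ _ _ _ mt2 mt1 i2 i1) => // x.
  by have := test_fun_le x.1 x.2 kap0 K0; rewrite ler_norml => /andP[h _]; lra.
apply: (side _ _ _ _ _ _ mt1 mt2 i1 i2) => // x.
by have := test_fun_le x.1 x.2 kap0 K0; rewrite ler_norml => /andP[_ h]; lra.
Qed.

(** Dominated convergence: the tails vanish pointwise as K grows and lie below the integrable
    square. *)
Lemma aff_tail_small M eta : (\int[mu]_x (aff x ^+ 2)%:E = M%:E)%E -> 0 < eta ->
  exists K T, [/\ 0 <= K, (\int[mu]_x (aff_tail K x)%:E = T%:E)%E & T <= eta].
Proof.
move=> hM eta0.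
have a20 (x : R * R) : (0 <= (aff x ^+ 2)%:E)%E by rewrite lee_fin sqr_ge0.
have m2 : measurable_fun setT (fun x => (aff x ^+ 2)%:E).
  by apply/measurable_EFinP; exact: measurable_aff2.
have i2 : mu.-integrable setT (fun x => (aff x ^+ 2)%:E).
  apply/integrableP; split => //; under eq_integral do rewrite gee0_abs //.
  by rewrite hM ltry.
have mt K : measurable_fun setT (fun x => (aff_tail K x)%:E).
  by apply/measurable_EFinP; exact: measurable_aff_tail.
have t0 K x : 0 <= aff_tail K x by rewrite mulr_ge0 ?sqr_ge0.
have tle K x : aff_tail K x <= aff x ^+ 2.
  by rewrite /aff_tail; case: (K < _); rewrite ?mulr1 ?mulr0 ?sqr_ge0.
have fcvg : {ae mu, forall x, [set: R * R] x -> (aff_tail n%:R x)%:E @[n --> \oo] --> cst 0%E x}.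
  apply: aeW => x _; apply: cvg_near_cst; near=> n.
  rewrite /aff_tail ltNge (_ : `|aff x| <= n%:R) ?mulr0 //; near: n.
  exact: nbhs_infty_ger.
have fle : {ae mu, forall x n, [set: R * R] x -> (`|(aff_tail n%:R x)%:E| <= (aff x ^+ 2)%:E)%E}.
  by apply: aeW => x n _; rewrite gee0_abs lee_fin.
have [_ _] := dominated_convergence measurableT (fun n => mt n%:R)
  (measurable_cst _) fcvg i2 fle.
rewrite integral0 => /= h.
have fin K : (\int[mu]_x (aff_tail K x)%:E)%E \is a fin_num.
  apply: integrable_fin_num => //; apply: (le_integrable measurableT _ _ i2) => //.
  by move=> x _; rewrite !gee0_abs ?lee_fin // sqr_ge0.
have /fine_cvgP[_ /cvgrPdist_le /(_ eta eta0) [N _ /(_ N)]] := h.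
rewrite /= sub0r normrN => /(_ (leqnn _)) hN.
exists N%:R, (fine (\int[mu]_x (aff_tail N%:R x)%:E)%E); split=> //.
  by rewrite fineK.
exact: le_trans (ler_norm _) hN.
Unshelve. all: by end_near. Qed.

Lemma W2_test_cvg (z : forall n, 'I_n -> S) M :
  (\int[mu]_x (aff x ^+ 2)%:E = M%:E)%E ->
  (fun n => W2sq (empirical (z n)) (mu \x pushforward nu (init_bits t))%E) @ \oo --> 0%E ->
  (fun n => n%:R^-1 * \sum_(i < n) test_fun (z n i)) @ \oo --> nu_chi nu chi * M.
Proof.
move=> hM hW; apply/cvgrPdist_le => eta eta0.
have M0 : 0 <= M by rewrite -lee_fin -hM integral_ge0 // => x _; rewrite lee_fin sqr_ge0.
(* Three errors of size eta/3: kap M, then 2T with T <= eta/6, then c times eps. Adding 1 to [M]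
   keeps the denominator positive. *)
pose kap := eta / 3 / (M + 1).
have M1 : 0 < M + 1 by lra.
have kap0 : 0 < kap by rewrite !divr_gt0.
have [K [T [K0 hT Tle]]] := aff_tail_small hM (divr_gt0 eta0 (ltr0n _ 6)).
pose c := 2 * (1 + kap^-1) + 4 + 2 * K ^+ 2.
have c0 : 0 < c.
  have := sqr_ge0 K; have : 0 < kap^-1 by rewrite invr_gt0.
  by rewrite /c; lra.
pose eps := eta / 3 / c.
have eps0 : 0 < eps by rewrite !divr_gt0.
have /fine_cvgP[hfin /cvgrPdist_lt /(_ eps eps0) hlt] := hW.
near=> n.
have Wfin : W2sq (empirical (z n)) (mu \x pushforward nu (init_bits t))%E \is a fin_num.
  by near: n.
have Wlt : (W2sq (empirical (z n)) (mu \x pushforward nu (init_bits t)) < eps%:E)%E.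
  rewrite -(fineK Wfin) lte_fin; apply: le_lt_trans (ler_norm _) _.
  by rewrite -[X in `|X|]opprK normrN -[X in `|X|]add0r; near: n.
have [_ [g gz <-] glt] := ereal_inf_lt Wlt.
rewrite distrC; apply: le_trans (coupling_estimate gz kap0 K0 (ltW glt) hM hT) _.
rewrite -/c /eps mulrCA divff ?gt_eqF // mulr1.
have : kap * M <= eta / 3.
  have h1 : M / (M + 1) <= 1 by rewrite ler_pdivrMr //; lra.
  have -> : kap * M = eta / 3 * (M / (M + 1)) by rewrite /kap; ring.
  by rewrite ler_piMr // divr_ge0 // ltW.
lra.
Unshelve. all: by end_near. Qed.

End coupling_estimate.

(** * Convergence in probability *)

Section convergence_in_probability.
Context (R : realType) (dOm : nat -> measure_display) (Om : forall n, measurableType (dOm n)).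
Variable P : forall n, probability (Om n) R.

(* Convergence in probability, phrased with measurable exceptional sets so that
   it is meaningful for functions not yet known to be measurable. *)
Definition cvp (X : forall n, Om n -> R) (x : R) : Prop :=
  forall eps eta : R, 0 < eps -> 0 < eta -> exists N, forall n, (N <= n)%N ->
    exists2 B, measurable B & ((P n B <= eta%:E)%E /\
      forall w, ~ B w -> `|X n w - x| <= eps).

Lemma cvp_seq (u : nat -> R) x : u @ \oo --> x -> cvp (fun n _ => u n) x.
Proof.
move=> /cvgrPdist_le hu eps eta eps0 eta0.
have [N _ hN] := hu _ eps0; exists N => n Nn; exists set0 => //.
by rewrite measure0 lee_fin ltW //; split=> // w _; rewrite distrC; exact: hN.
Qed.

Lemma cvp_cst x : cvp (fun _ _ => x) x.
Proof. by apply: cvp_seq; exact: cvg_cst. Qed.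

Lemma cvp_near_eq (X Y : forall n, Om n -> R) x N :
  (forall n w, (N <= n)%N -> X n w = Y n w) -> cvp Y x -> cvp X x.
Proof.
move=> XY hY eps eta eps0 eta0; have [M hM] := hY _ _ eps0 eta0.
exists (maxn N M) => n; rewrite geq_max => /andP[Nn /hM[B mB [PB hB]]].
by exists B => //; split=> // w /hB; rewrite XY.
Qed.

Lemma cvp_comp2 (f : R -> R -> R) X Y x y :
  (forall eps, 0 < eps -> exists2 del, 0 < del &
     forall a b, `|a - x| <= del -> `|b - y| <= del -> `|f a b - f x y| <= eps) ->
  cvp X x -> cvp Y y -> cvp (fun n w => f (X n w) (Y n w)) (f x y).
Proof.
move=> hf hX hY eps eta eps0 eta0; have [del del0 hdel] := hf _ eps0.
have eta2 : 0 < eta / 2 by rewrite divr_gt0.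
have [N hN] := hX _ _ del0 eta2; have [M hM] := hY _ _ del0 eta2.
exists (maxn N M) => n; rewrite geq_max => /andP[/hN[B mB [PB hB]] /hM[C mC [PC hC]]].
exists (B `|` C); first exact: measurableU.
split; last by move=> w /not_orP[/hB h1 /hC h2]; exact: hdel.
apply: le_trans (measureU2 _ mB mC) _.
rewrite [eta]splitr EFinD; exact: leeD.
Qed.

Lemma cvpD X Y x y : cvp X x -> cvp Y y -> cvp (fun n w => X n w + Y n w) (x + y).
Proof.
apply: cvp_comp2 => eps eps0; exists (eps / 2); first by rewrite divr_gt0.
move=> a b ha hb; rewrite opprD addrACA; apply: le_trans (ler_normD _ _) _.
by rewrite [eps]splitr; exact: lerD.
Qed.

Lemma cvpM X Y x y : cvp X x -> cvp Y y -> cvp (fun n w => X n w * Y n w) (x * y).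
Proof.
apply: cvp_comp2 => eps eps0.
pose K := `|x| + `|y| + 1; have x0 := normr_ge0 x; have y0 := normr_ge0 y.
have K0 : 0 < K by rewrite /K; lra.
exists (Num.min 1 (eps / K)).
  by rewrite lt_min ltr01 divr_gt0.
move=> a b; rewrite !le_min => /andP[a1 ae] /andP[b1 be].
have -> : a * b - x * y = (a - x) * (b - y) + (a - x) * y + x * (b - y) by ring.
have h1 : `|(a - x) * (b - y)| <= eps / K.
  by rewrite normrM -[leRHS]mulr1 ler_pM.
have h2 : `|(a - x) * y| <= eps / K * `|y| by rewrite normrM ler_wpM2r.
have h3 : `|x * (b - y)| <= `|x| * (eps / K) by rewrite normrM ler_wpM2l.
apply: le_trans (ler_normD _ _) _; apply: le_trans (lerD (ler_normD _ _) (lexx _)) _.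
apply: le_trans (lerD (lerD h1 h2) h3) _.
rewrite [leLHS](_ : _ = eps / K * K); last by rewrite /K; ring.
by rewrite divfK // gt_eqF.
Qed.

Lemma cvp_sum m (X : 'I_m -> forall n, Om n -> R) (x : 'I_m -> R) :
  (forall i, cvp (X i) (x i)) ->
  cvp (fun n w => \sum_i X i n w) (\sum_i x i).
Proof.
elim: m X x => [|m IH] X x h.
  rewrite big_ord0; apply: (@cvp_near_eq _ _ _ 0) (cvp_cst 0) => n w _.
  by rewrite big_ord0.
rewrite big_ord_recr /=; have := cvpD (IH _ _ (fun i => h (widen_ord (leqnSn m) i))) (h ord_max).
by apply: (@cvp_near_eq _ _ _ 0) => n w _; rewrite big_ord_recr.
Qed.

Lemma cvp_inv_sqrt X x : 0 < x -> cvp X x ->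
  cvp (fun n w => (Num.sqrt (X n w))^-1) (Num.sqrt x)^-1.
Proof.
move=> x0 hX.
have hc : (fun a : R => (Num.sqrt a)^-1) @ x --> (Num.sqrt x)^-1.
  apply: cvgV; first by rewrite gt_eqF // sqrtr_gt0.
  exact: sqrt_continuous.
have := @cvp_comp2 (fun a _ => (Num.sqrt a)^-1) X X x x; apply => // eps eps0.
have /cvgrPdist_le /(_ _ eps0) /nbhs_ballP [del /= del0 hdel] := hc.
exists (del / 2); first by rewrite divr_gt0.
move=> a _ ha _; rewrite distrC; apply: hdel; rewrite /ball /= distrC.
by apply: le_lt_trans ha _; rewrite ltr_pdivrMr // ltr_pMr // ltr1n.
Qed.

End convergence_in_probability.

Section wick_representation.
Context (R : realType) (dOm : nat -> measure_display) (Om : forall n, measurableType (dOm n)).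
Variable P : forall n, probability (Om n) R.
Variable Z : forall n, Om n -> 'M[R]_n.
Arguments Z : clear implicits.
Hypothesis goeZ : forall n, is_GOE (P n) (Z n).
Notation rvec := (forall n, Om n -> 'cV[R]_n).
Notation cvp := (cvp P).

Definition bounded_vec (h : forall n, 'cV[R]_n) :=
  exists C N, 0 < C /\ forall n, (N <= n)%N -> vdot (h n) (h n) <= C * n%:R.

(* The pairs (f, g) = sum c (P(l)h, Q(l)h) with random scalars c converging in probability. *)
Inductive vrep : rvec -> rvec -> Prop :=
| vrep_atom (l : forall n, seq 'rV[R]_n) (h : forall n, 'cV[R]_n) s :
    (forall n, size (l n) = s) -> (forall n, contractions (l n)) -> bounded_vec h ->
    vrep (fun n w => (wickR (Z n w) (l n)).2 *m h n)
         (fun n w => (wickR (Z n w) (l n)).1 *m h n)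
| vrep0 : vrep (fun _ _ => 0) (fun _ _ => 0)
| vrepD f g f' g' : vrep f g -> vrep f' g' ->
    vrep (fun n w => f n w + f' n w) (fun n w => g n w + g' n w)
| vrepZ c x f g : cvp c x -> vrep f g ->
    vrep (fun n w => c n w *: f n w) (fun n w => c n w *: g n w)
| vrep_eq N f g f' g' :
    (forall n w, (N <= n)%N -> f' n w = f n w /\ g' n w = g n w) ->
    vrep f g -> vrep f' g'.

(** On atoms this prepends [D] to the list. It is the effect of one iteration on a noise vector:
    mask it, multiply by Z, and subtract its share of the memory term. *)
Lemma vrep_mask (D : forall n, 'rV[R]_n) f g : (forall n, contraction (D n)) -> vrep f g ->
  vrep (fun n w => diag_mx (D n) *m g n w)
       (fun n w => Z n w *m (diag_mx (D n) *m g n w) - entry_mean (D n) *: f n w).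
Proof.
move=> hD; elim=> {f g} [l h s sl hl hh||f g f' g' _ IH _ IH'|c x f g hc _ IH|N f g f' g' e _ IH].
- have hl' n : contractions (D n :: l n).
    by move=> d; rewrite inE => /predU1P[->|/hl].
  have := @vrep_atom (fun n => D n :: l n) h s.+1 (fun n => congr1 S (sl n)) hl' hh.
  apply: (@vrep_eq 0) => n w _ /=; split; first by rewrite mulmxA.
  by rewrite mulmxBl -scalemxAl !mulmxA.
- by apply: (@vrep_eq 0) vrep0 => n w _; rewrite !mulmx0 scaler0 subr0.
- apply: (@vrep_eq 0) (vrepD IH IH') => n w _; split; first by rewrite mulmxDr.
  by rewrite !mulmxDr scalerDr opprD addrACA.
- apply: (@vrep_eq 0) (vrepZ hc IH) => n w _; split; first by rewrite scalemxAr.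
  by rewrite scalerBr !scalemxAr !scalerA mulrC.
- apply: (@vrep_eq N) IH => n w Nn; have [-> ->] := e n w Nn; by [].
Qed.

Lemma vdotE n (a b : 'cV[R]_n) : vdot a b = (a^T *m b) 0 0.
Proof. by rewrite mxE; apply: eq_bigr => i _; rewrite mxE. Qed.

Lemma vdotC n (a b : 'cV[R]_n) : vdot a b = vdot b a.
Proof. by apply: eq_bigr => i _; rewrite mulrC. Qed.

Lemma vdotDr n (a b c : 'cV[R]_n) : vdot a (b + c) = vdot a b + vdot a c.
Proof. by rewrite !vdotE mulmxDr mxE. Qed.

Lemma vdotZr n k (a b : 'cV[R]_n) : vdot a (k *: b) = k * vdot a b.
Proof. by rewrite !vdotE -scalemxAr mxE. Qed.

Lemma vdot0r n (a : 'cV[R]_n) : vdot a 0 = 0.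
Proof. by rewrite vdotE mulmx0 mxE. Qed.

Lemma vdotDl n (a b c : 'cV[R]_n) : vdot (a + b) c = vdot a c + vdot b c.
Proof. by rewrite !(vdotC _ c) vdotDr. Qed.

Lemma vdotZl n k (a b : 'cV[R]_n) : vdot (k *: a) b = k * vdot a b.
Proof. by rewrite !(vdotC _ b) vdotZr. Qed.

(** Extracting the natural size sqrt(n) allows the unit-ball estimates to be used; below the
    threshold [u] is 0, so it lies in the ball for every n. *)
Lemma bounded_vec_unit (h : forall n, 'cV[R]_n) : bounded_vec h ->
  exists (u : forall n, 'cV[R]_n) C N, [/\ 0 < C, forall n, unit_ball (u n) &
    forall n, (N <= n)%N -> h n = (C * Num.sqrt n%:R) *: u n].
Proof.
move=> [C [N [C0 hN]]]; pose k n := Num.sqrt C * Num.sqrt n%:R.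
have sC0 : 0 < Num.sqrt C by rewrite sqrtr_gt0.
pose u n : 'cV[R]_n := if (maxn N 1 <= n)%N then (k n)^-1 *: h n else 0.
exists u, (Num.sqrt C), (maxn N 1); split=> // [n|n Nn].
  rewrite /u; case: ifPn => [|_]; last first.
    by rewrite /unit_ball big1 // => i _; rewrite mxE expr0n.
  rewrite geq_max => /andP[Nn n1].
  have n0 : 0 < n%:R :> R by rewrite ltr0n.
  have k0 : 0 < k n by rewrite mulr_gt0 // sqrtr_gt0.
  have : vdot ((k n)^-1 *: h n) ((k n)^-1 *: h n) <= 1.
    rewrite vdotZl vdotZr mulrA -expr2 exprVn mulrC ler_pdivrMr ?exprn_gt0 // mul1r.
    have -> : k n ^+ 2 = C * n%:R by rewrite exprMn !sqr_sqrtr // ltW.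
    exact: hN.
  by rewrite /unit_ball /vdot; under eq_bigr do rewrite -expr2.
rewrite /u Nn scalerA -/(k n) divff ?scale1r // gt_eqF // mulr_gt0 // sqrtr_gt0 ltr0n.
by move: Nn; rewrite geq_max => /andP[].
Qed.

Lemma div_nat_small (c eta : R) : 0 < eta ->
  exists M, forall n, (M <= n)%N -> c * n%:R^-1 <= eta.
Proof.
move=> eta0; exists (Num.bound (`|c| / eta)).+1 => n Mn.
have n0 : 0 < n%:R :> R by rewrite ltr0n (leq_trans _ Mn).
rewrite ler_pdivrMr //; apply: le_trans (ler_norm _) _.
rewrite mulrC -ler_pdivrMr //; apply: ltW.
apply: lt_le_trans (archi_boundP _) _; first by rewrite divr_ge0 // ltW.
by rewrite ler_nat ltnW.
Qed.

Lemma div_nat_small2 (c e eta : R) : 0 < e -> 0 < eta ->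
  exists M, forall n, (M <= n)%N -> c * n%:R^-1 / e ^+ 2 <= eta.
Proof.
move=> e0 eta0; have e2 : 0 < e ^+ 2 by rewrite exprn_gt0.
have [M hM] := div_nat_small c (mulr_gt0 eta0 e2).
by exists M => n /hM h; rewrite ler_pdivrMr.
Qed.

Lemma sqrt_scale n (C C' W : R) : (0 < n)%N ->
  n%:R^-1 * (C * Num.sqrt n%:R * (C' * Num.sqrt n%:R * W)) = C * C' * W.
Proof.
move=> n1; have n0 : n%:R != 0 :> R by rewrite pnatr_eq0 -lt0n.
rewrite [LHS](_ : _ = (n%:R^-1 * Num.sqrt n%:R ^+ 2) * (C * C' * W)); last by ring.
by rewrite sqr_sqrtr // mulVf // mul1r.
Qed.

(** By linearity in [g] an atom suffices; there both factors sqrt(n) cancel against 1/n, and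
    [wick_form_small] applies. *)
Lemma vrep_dot v f g : bounded_vec v -> vrep f g ->
  cvp (fun n w => n%:R^-1 * vdot (v n) (g n w)) 0.
Proof.
move=> hv; elim=> {f g} [l h s sl hl hh||f g f' g' _ IH _ IH'|c x f g hc _ IH|N f g f' g' e _ IH].
- have [u [C [N [C0 hu vE]]]] := bounded_vec_unit hv.
  have [u' [C' [N' [C0' hu' hE]]]] := bounded_vec_unit hh.
  move=> eps eta eps0 eta0.
  pose e := eps / (C * C'); have e0 : 0 < e by rewrite divr_gt0 // mulr_gt0.
  have [M hM] : exists M, forall n, (M <= n)%N -> wick_var R s * n%:R^-1 / e ^+ 2 <= eta.
    exact: div_nat_small2.
  exists (maxn M (maxn N (maxn N' 1))) => n; rewrite !geq_max => /and4P[Mn Nn Nn' n1].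
  have [B mB [PB hB]] := wick_form_small n1 (goeZ n) (hu n) (hu' n) (hl n) e0.
  exists B => //; split.
    by apply: le_trans PB _; rewrite lee_fin sl; exact: hM.
  move=> w /hB; rewrite subr0 /wick_form => hw.
  rewrite vE // hE // -scalemxAr vdotZl vdotZr vdotE mulmxA.
  set W := (_ *m _) 0 0 in hw *.
  rewrite sqrt_scale //.
  rewrite normrM ger0_norm; last by rewrite ltW // mulr_gt0.
  by rewrite mulrC -ler_pdivlMr // mulr_gt0.
- by apply: (@cvp_near_eq _ _ _ _ _ _ _ 0) (cvp_cst _ 0) => n w _; rewrite vdot0r mulr0.
- have := cvpD IH IH'; rewrite addr0.
  by apply: (@cvp_near_eq _ _ _ _ _ _ _ 0) => n w _; rewrite vdotDr mulrDr.
- have := cvpM hc IH; rewrite mulr0.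
  by apply: (@cvp_near_eq _ _ _ _ _ _ _ 0) => n w _; rewrite vdotZr mulrCA.
- by apply: (@cvp_near_eq _ _ _ _ _ _ _ N) IH => n w Nn; have [_ ->] := e n w Nn.
Qed.

Definition pair_defect (D : forall n, 'rV[R]_n) (f g f' g' : rvec) n (w : Om n) : R :=
  n%:R^-1 * vdot (g n w) (diag_mx (D n) *m g' n w) -
  entry_mean (D n) * (n%:R^-1 * vdot (f n w) (f' n w)).

Lemma vrep_pair_atom D l h s f' g' : (forall n, contraction (D n)) ->
  (forall n, size (l n) = s) -> (forall n, contractions (l n)) -> bounded_vec h ->
  vrep f' g' ->
  cvp (pair_defect D (fun n w => (wickR (Z n w) (l n)).2 *m h n)
         (fun n w => (wickR (Z n w) (l n)).1 *m h n) f' g') 0.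
Proof.
move=> hD sl hl hh; rewrite /pair_defect.
elim=> {f' g'} [l' h' s' sl' hl' hh'||f g f' g' _ IH _ IH'|c x f g hc _ IH|N f g f' g' e _ IH].
- have [u [C [N [C0 hu hE]]]] := bounded_vec_unit hh.
  have [u' [C' [N' [C0' hu' hE']]]] := bounded_vec_unit hh'.
  move=> eps eta eps0 eta0.
  pose e := eps / (C * C'); have e0 : 0 < e by rewrite divr_gt0 // mulr_gt0.
  have [M hM] := div_nat_small2 (wick_pair_var R s s') e0 eta0.
  exists (maxn M (maxn N (maxn N' 1))) => n; rewrite !geq_max => /and4P[Mn Nn Nn' n1].
  have [B mB [PB hB]] := wick_pair_form_small n1 (goeZ n) (hu n) (hu' n) (hD n) (hl n) (hl' n) e0.
  exists B => //; split.
    by apply: le_trans PB _; rewrite lee_fin sl sl'; exact: hM.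
  move=> w /hB; rewrite subr0 /wick_pair_form => hw.
  rewrite hE // hE' // -!scalemxAr !vdotZl !vdotZr !sqrt_scale // mulrCA -mulrBr.
  rewrite normrM ger0_norm; last by rewrite ltW // mulr_gt0.
  rewrite mulrC -ler_pdivlMr ?mulr_gt0 //; move: hw.
  by rewrite !vdotE !trmx_mul !mulmxA.
- apply: (@cvp_near_eq _ _ _ _ _ _ _ 0) (cvp_cst _ 0) => n w _.
  by rewrite mulmx0 !vdot0r !mulr0 subr0.
- have := cvpD IH IH'; rewrite addr0.
  by apply: (@cvp_near_eq _ _ _ _ _ _ _ 0) => n w _; rewrite mulmxDr !vdotDr; ring.
- have := cvpM hc IH; rewrite mulr0.
  by apply: (@cvp_near_eq _ _ _ _ _ _ _ 0) => n w _; rewrite -scalemxAr !vdotZr; ring.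
- by apply: (@cvp_near_eq _ _ _ _ _ _ _ N) IH => n w Nn; have [-> ->] := e n w Nn.
Qed.

(** The defect is bilinear in the two pairs; [vrep_pair_atom] has reduced the second one, and the
    same induction reduces the first. *)
Lemma vrep_pair D f g f' g' : (forall n, contraction (D n)) ->
  vrep f g -> vrep f' g' -> cvp (pair_defect D f g f' g') 0.
Proof.
move=> hD hf hf'.
elim: hf => {f g} [l h s sl hl hh||f g f1 g1 _ IH _ IH'|c x f g hc _ IH|N f g f1 g1 e _ IH].
- exact: vrep_pair_atom sl hl hh hf'.
- apply: (@cvp_near_eq _ _ _ _ _ _ _ 0) (cvp_cst _ 0) => n w _.
  by rewrite /pair_defect !(vdotC 0) !vdot0r !mulr0 subr0.
- have := cvpD IH IH'; rewrite addr0.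
  by apply: (@cvp_near_eq _ _ _ _ _ _ _ 0) => n w _; rewrite /pair_defect !vdotDl; ring.
- have := cvpM hc IH; rewrite mulr0.
  by apply: (@cvp_near_eq _ _ _ _ _ _ _ 0) => n w _; rewrite /pair_defect !vdotZl; ring.
- apply: (@cvp_near_eq _ _ _ _ _ _ _ N) IH => n w Nn.
  by rewrite /pair_defect; have [-> ->] := e n w Nn.
Qed.

End wick_representation.

(** * State evolution *)

Section amp_recursion.
Context (R : realType) (n : nat) (M : 'M[R]_n) (th0 : 'cV[R]_n).
Variable delta : nat -> 'I_n -> bool.
Hypothesis delta0 : forall i, delta 0 i = true.

Notation th := (theta_hat M th0 delta).
(** The index is shifted: [xprev t] is the vector x_{t-1}. *)
Definition xprev t := (amp_iter M th0 delta t).2.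
Definition amp_y t : 'cV[R]_n :=
  M *m th t - (Num.sqrt n%:R * vnorm (xprev t))^-1 *: \sum_(s < t) wts delta t s *: th s.

Lemma amp_iterS t : amp_iter M th0 delta t.+1 =
  let th' s := nth 0 (amp_iter M th0 delta t).1 s in
  let xt := hadamard (bits_vec (delta t))
     (M *m th' t - (Num.sqrt n%:R * vnorm (xprev t))^-1 *: \sum_(s < t) wts delta t s *: th' s) +
     hadamard (ones n - bits_vec (delta t)) (xprev t) in
  (rcons (amp_iter M th0 delta t).1 ((Num.sqrt n%:R / vnorm xt) *: xt), xt).
Proof. by rewrite /xprev /=; case: (amp_iter M th0 delta t). Qed.

Lemma amp_size t : size (amp_iter M th0 delta t).1 = t.+1.
Proof. by elim: t => // t IH; rewrite amp_iterS /= size_rcons IH. Qed.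

Lemma amp_nth s t : (s <= t)%N -> nth 0 (amp_iter M th0 delta t).1 s = th s.
Proof.
elim: t => [|t IH]; first by rewrite leqn0 => /eqP ->.
rewrite leq_eqVlt ltnS => /predU1P[-> //|st].
by rewrite amp_iterS /= nth_rcons amp_size ltnS st IH.
Qed.

Lemma xprevS t : xprev t.+1 = hadamard (bits_vec (delta t)) (amp_y t) +
  hadamard (ones n - bits_vec (delta t)) (xprev t).
Proof.
rewrite {1}/xprev amp_iterS /=; congr (hadamard _ (_ - _ *: _) + _).
by apply: eq_bigr => s _; rewrite amp_nth // ltnW.
Qed.

Lemma theta_hatS t : th t.+1 = (Num.sqrt n%:R / vnorm (xprev t.+1)) *: xprev t.+1.
Proof.
by rewrite /theta_hat /xprev amp_iterS /= nth_rcons amp_size ltnn eqxx.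
Qed.

Lemma tauS t i : tau delta t.+1 i = if delta t i then t else tau delta t i.
Proof.
rewrite /tau big_mkcond big_ord_recr /= -big_mkcond /=.
case: ifP => _; last by rewrite maxn0.
apply/maxn_idPr; apply/bigmax_leqP => s _; exact: ltnW.
Qed.

Lemma tau_ltn t i : (tau delta t.+1 i < t.+1)%N.
Proof. by rewrite ltnS /tau; apply/bigmax_leqP => s _; rewrite -ltnS. Qed.

Lemma xprevS_entry t i : xprev t.+1 i 0 =
  (delta t i)%:R * amp_y t i 0 + (1 - (delta t i)%:R) * xprev t i 0.
Proof.
rewrite xprevS [LHS]mxE /hadamard; move: (amp_y t) (xprev t) => y x.
by rewrite !mxE.
Qed.

Lemma xprev_entry t i : xprev t.+1 i 0 = amp_y (tau delta t.+1 i) i 0.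
Proof.
elim: t => [|t IH]; rewrite xprevS_entry tauS.
  by rewrite delta0 mul1r subrr mul0r addr0.
case: (delta t.+1 i); first by rewrite mul1r subrr mul0r addr0.
by rewrite mul0r subr0 mul1r add0r IH.
Qed.

Definition mask t s : 'rV[R]_n := \row_i (tau delta t i == s)%:R.

Lemma contraction_mask t s : contraction (mask t s).
Proof. by move=> i; rewrite mxE; case: eqP; rewrite ?normr1 ?normr0. Qed.

Lemma maskE t s i : mask t s 0 i = (tau delta t i == s)%:R.
Proof. by rewrite mxE. Qed.

Lemma diag_entry (e : 'rV[R]_n) (y : 'cV[R]_n) i : (diag_mx e *m y) i 0 = e 0 i * y i 0.
Proof. by rewrite mul_diag_mx mxE. Qed.

Lemma xprev_mask t : xprev t.+1 = \sum_(s < t.+1) diag_mx (mask t.+1 s) *m amp_y s.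
Proof.
apply/matrixP => i j; rewrite (ord1 j) xprev_entry summxE.
rewrite (bigD1 (Ordinal (tau_ltn t i))) //= diag_entry maskE eqxx mul1r.
rewrite big1 ?addr0 // => s sN; rewrite diag_entry maskE.
rewrite (_ : _ == _ = false) ?mul0r //; apply: contraNF sN => /eqP e.
by apply/eqP/val_inj.
Qed.

Lemma wts_mask t s : wts delta t s = \sum_i mask t s 0 i :> R.
Proof.
rewrite /wts -sum1_card natr_sum big_mkcond; apply: eq_bigr => i _.
rewrite maskE; case: ifPn => [/set_mem /= -> //|/negP h].
by case: eqP => // /eqP e; case: h; exact/mem_set.
Qed.

End amp_recursion.

(** Continuity holds off 0, and the point 0 is measurable. With total division the normalized
    iterates are measurable without excluding zero norms. *)
Lemma measurable_inv (R : realType) : measurable_fun setT (fun x : R => x^-1).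
Proof.
rewrite -(setvU [set 0]); apply/measurable_funU; [by apply: measurableC| by []|split].
  apply: open_continuous_measurable_fun; first by rewrite openC; exact: closed_eq.
  by move=> x; rewrite inE /= => /eqP x0; exact: inv_continuous.
exact: measurable_fun_set1.
Qed.

(** * Measurability of the iterates *)

Section measurable_amp.
Context (R : realType) d (Om : measurableType d) (n : nat) (M : Om -> 'M[R]_n) (th0 : 'cV[R]_n).
Variable delta : nat -> 'I_n -> bool.
Hypothesis mM : forall i j, measurable_fun setT (fun w => M w i j).

Lemma measurable_vdot (a b : Om -> 'cV[R]_n) :
  (forall i, measurable_fun setT (fun w => a w i 0)) ->
  (forall i, measurable_fun setT (fun w => b w i 0)) ->
  measurable_fun setT (fun w => vdot (a w) (b w)).
Proof. by move=> ma mb; apply: measurable_sum => i; exact: measurable_funM. Qed.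

Lemma measurable_vnorm (a : Om -> 'cV[R]_n) :
  (forall i, measurable_fun setT (fun w => a w i 0)) ->
  measurable_fun setT (fun w => vnorm (a w)).
Proof.
move=> ma; apply: (measurableT_comp (f := @Num.sqrt R)); last exact: measurable_vdot.
exact: continuous_measurable_fun (@sqrt_continuous R).
Qed.

Lemma measurable_amp t :
  (forall s, (s <= t)%N -> forall i, measurable_fun setT (fun w => theta_hat (M w) th0 delta s i 0)) /\
  forall i, measurable_fun setT (fun w => xprev (M w) th0 delta t i 0).
Proof.
elim: t => [|t [IHth IHx]].
  split=> [s|i]; first by rewrite leqn0 => /eqP -> i; exact: measurable_cst.
  by rewrite /xprev /=; exact: measurable_cst.
have my i : measurable_fun setT (fun w => amp_y (M w) th0 delta t i 0).
  rewrite (_ : (fun w => _) = (fun w => \sum_j M w i j * theta_hat (M w) th0 delta t j 0 -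
    (Num.sqrt n%:R * vnorm (xprev (M w) th0 delta t))^-1 *
    \sum_(s < t) wts delta t s * theta_hat (M w) th0 delta s i 0)); last first.
    apply/funext => w; rewrite /amp_y mxE [X in _ + X = _]mxE [X in - X]mxE summxE [X in X - _]mxE.
    congr (_ - _ * _).
    by apply: eq_bigr => s _; rewrite mxE.
  apply: measurable_funB.
    by apply: measurable_sum => j; apply: measurable_funM => //; exact: IHth.
  apply: measurable_funM.
    apply: (measurableT_comp (@measurable_inv R)); apply: measurable_funM => //.
    exact: measurable_vnorm.
  apply: measurable_sum => s; apply: measurable_funM => //.
  by apply: IHth; exact: ltnW.
have mx i : measurable_fun setT (fun w => xprev (M w) th0 delta t.+1 i 0).
  rewrite (_ : (fun w => _) = (fun w => (delta t i)%:R * amp_y (M w) th0 delta t i 0 +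
    (1 - (delta t i)%:R) * xprev (M w) th0 delta t i 0)); last first.
    by apply/funext => w; rewrite xprevS_entry.
  by apply: measurable_funD; apply: measurable_funM.
split=> // s; rewrite leq_eqVlt ltnS => /predU1P[-> i|]; last exact: IHth.
rewrite (_ : (fun w => _) = (fun w => Num.sqrt n%:R / vnorm (xprev (M w) th0 delta t.+1) *
   xprev (M w) th0 delta t.+1 i 0)); last by apply/funext => w; rewrite theta_hatS mxE.
apply: measurable_funM => //; apply: measurable_funM => //.
by apply: (measurableT_comp (@measurable_inv R)); exact: measurable_vnorm.
Qed.

End measurable_amp.

(* Under delta_0 = 1, the event tau(t, i) = s read off the first t + 1 bits. *)
Definition last_at (t s : nat) (b : (t.+1).-tuple bool) : bool :=
  tnth b (inord s) && [forall r : 'I_t.+1, (s < r < t)%N ==> ~~ tnth b r].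

Lemma tau_attained n (delta : nat -> 'I_n -> bool) t i :
  delta 0%N i -> delta (tau delta t.+1 i) i.
Proof.
by move=> h0; elim: t => [|t IH]; rewrite tauS ?h0 //; case: ifP.
Qed.

Lemma tau_last_at n (delta : nat -> 'I_n -> bool) t s i : delta 0%N i -> (s < t)%N ->
  (tau delta t i == s) = last_at s [tuple delta r i | r < t.+1].
Proof.
move=> h0 st; apply/eqP/andP => [<-|[]].
  case: t st => // t st; have tl := tau_ltn delta t i.
  split; first by rewrite tnth_mktuple inordK ?tau_attained // ltnW.
  apply/forallP => r; apply/implyP => /andP[sr rt]; rewrite tnth_mktuple.
  apply/negP => dr; move: sr; rewrite ltnNge.
  by rewrite (@leq_bigmax_cond _ (fun s : 'I_t.+1 => delta s i) (fun s => s : nat) (Ordinal rt)).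
rewrite tnth_mktuple inordK; last by rewrite ltnS ltnW.
move=> ds /forallP h; apply/eqP; rewrite eqn_leq; apply/andP; split.
  apply/bigmax_leqP => r dr; rewrite leqNgt; apply/negP => sr.
  have := h (widen_ord (leqnSn t) r); rewrite tnth_mktuple /= sr ltn_ord /=.
  by rewrite dr.
exact: (@leq_bigmax_cond _ (fun s : 'I_t => delta s i) (fun s => s : nat) (Ordinal st)).
Qed.

Lemma p_last_nu_chi (R : realType) (nu : probability bitstrings R) t s : (s < t)%N ->
  p_last nu t s = nu_chi nu (@last_at t s).
Proof.
move=> st; rewrite /p_last /nu_chi; congr (fine (nu _)); apply/seteqP; split=> w /=.
  move=> [ws wr]; rewrite /last_at tnth_mktuple inordK ?ws /=; last by rewrite ltnS ltnW.
  apply/forallP => r; apply/implyP => /andP[sr rt].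
  by rewrite tnth_mktuple wr.
rewrite /last_at tnth_mktuple inordK; last by rewrite ltnS ltnW.
move=> /andP[ws /forallP h]; split=> // r sr rt.
have rt1 : (r < t.+1)%N by rewrite ltnS ltnW.
have := h (Ordinal rt1); rewrite tnth_mktuple /= sr rt /= => /negbTE.
by [].
Qed.

(** * Limits of mask averages, norms and inner products of the data *)

Section empirical_limits.
Context (R : realType) (theta th0 : forall n : nat, 'cV[R]_n).
Variable delta : forall n : nat, nat -> 'I_n -> bool.
Arguments delta : clear implicits.
Variables (mu : probability (R * R)%type R) (nu : probability bitstrings R).
Hypothesis delta0 : forall n i, delta n 0 i = true.
Hypothesis mu1 : (\int[mu]_x (x.1 ^+ 2)%:E = 1)%E.
Hypothesis mu2 : (\int[mu]_x (x.2 ^+ 2)%:E = 1)%E.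
Hypothesis W2 : forall t : nat, (fun n : nat =>
  W2sq (empirical (fun i : 'I_n =>
    ((theta n i 0, th0 n i 0), [tuple delta n (nat_of_ord s) i | s < t.+1])))
    (mu \x pushforward nu (init_bits t))%E) @ \oo --> 0%E.

Definition corr : R := fine (\int[mu]_x (x.1 * x.2)%:E)%E.

Notation msk n t s := (mask R (delta n) t s).

Lemma mean_mask_cvg t s : (s < t)%N ->
  (fun n => entry_mean (msk n t s)) @ \oo --> p_last nu t s.
Proof.
move=> st; rewrite p_last_nu_chi // -[X in _ --> X]mulr1.
have hM : (\int[mu]_x (aff 0 0 1 x ^+ 2)%:E = (1 : R)%:E)%E.
  under eq_integral do rewrite /aff !mul0r !add0r expr1n.
  by rewrite integral_cst //= probability_setT mule1.
have n0 : `|0 : R| <= 1 by rewrite normr0.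
have := @W2_test_cvg _ _ _ nu (@last_at t s) 0 0 1 n0 n0 _ 1 hM (W2 t).
apply: cvg_trans; apply: near_eq_cvg; apply: nearW => n /=.
rewrite /entry_mean; congr (_ * _); apply: eq_bigr => i _.
by rewrite /test_fun /aff !mul0r !add0r expr1n mulr1 maskE tau_last_at.
Qed.

Lemma theta_mask_cvg t s : (s < t)%N ->
  (fun n => n%:R^-1 * vdot (theta n) (diag_mx (msk n t s) *m theta n)) @ \oo -->
  p_last nu t s.
Proof.
move=> st; rewrite p_last_nu_chi // -[X in _ --> X]mulr1.
have hM : (\int[mu]_x (aff 1 0 0 x ^+ 2)%:E = (1 : R)%:E)%E.
  by under eq_integral do rewrite /aff mul0r !addr0 mul1r.
have n0 : `|0 : R| <= 1 by rewrite normr0.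
have n1 : `|1 : R| <= 1 by rewrite normr1.
have := @W2_test_cvg _ _ _ nu (@last_at t s) 1 0 0 n1 n0 _ 1 hM (W2 t).
apply: cvg_trans; apply: near_eq_cvg; apply: nearW => n /=.
congr (_ * _); apply: eq_bigr => i _.
rewrite diag_entry maskE /test_fun /aff mul0r !addr0 mul1r tau_last_at //=.
by ring.
Qed.

Lemma theta_norm_cvg :
  (fun n => n%:R^-1 * vdot (theta n) (theta n)) @ \oo --> (1 : R).
Proof.
have hM : (\int[mu]_x (aff 1 0 0 x ^+ 2)%:E = (1 : R)%:E)%E.
  by under eq_integral do rewrite /aff mul0r !addr0 mul1r.
have n0 : `|0 : R| <= 1 by rewrite normr0.
have n1 : `|1 : R| <= 1 by rewrite normr1.
have := @W2_test_cvg _ _ _ nu (fun=> true) 1 0 0 n1 n0 _ 1 hM (W2 0).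
rewrite nu_chi_true mulr1.
apply: cvg_trans; apply: near_eq_cvg; apply: nearW => n /=.
congr (_ * _); apply: eq_bigr => i _.
by rewrite /test_fun /aff /=; ring.
Qed.

Lemma th0_norm_cvg :
  (fun n => n%:R^-1 * vdot (th0 n) (th0 n)) @ \oo --> (1 : R).
Proof.
have hM : (\int[mu]_x (aff 0 1 0 x ^+ 2)%:E = (1 : R)%:E)%E.
  by under eq_integral do rewrite /aff mul0r addr0 add0r mul1r.
have n0 : `|0 : R| <= 1 by rewrite normr0.
have n1 : `|1 : R| <= 1 by rewrite normr1.
have := @W2_test_cvg _ _ _ nu (fun=> true) 0 1 0 n0 n1 _ 1 hM (W2 0).
rewrite nu_chi_true mulr1.
apply: cvg_trans; apply: near_eq_cvg; apply: nearW => n /=.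
congr (_ * _); apply: eq_bigr => i _.
by rewrite /test_fun /aff /=; ring.
Qed.

(** Polarization: the square of the sum of both coordinates is a test function, and the two squared
    norms are subtracted. *)
Lemma theta_th0_cvg :
  (fun n => n%:R^-1 * vdot (theta n) (th0 n)) @ \oo --> corr.
Proof.
have m1 : measurable_fun setT (fun x : R * R => x.1) by exact: measurable_fst.
have m2 : measurable_fun setT (fun x : R * R => x.2) by exact: measurable_snd.
have i1 : mu.-integrable setT (fun x : R * R => (x.1 ^+ 2)%:E).
  apply/integrableP; split; first by apply/measurable_EFinP; exact: measurable_funX.
  under eq_integral do rewrite gee0_abs ?lee_fin ?sqr_ge0 //.
  by rewrite mu1 ltry.
have i2 : mu.-integrable setT (fun x : R * R => (x.2 ^+ 2)%:E).
  apply/integrableP; split; first by apply/measurable_EFinP; exact: measurable_funX.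
  under eq_integral do rewrite gee0_abs ?lee_fin ?sqr_ge0 //.
  by rewrite mu2 ltry.
have i12 : mu.-integrable setT (fun x : R * R => (x.1 * x.2)%:E).
  have := integrableD measurableT i1 i2; apply: le_integrable => //.
    by apply/measurable_EFinP; exact: measurable_funM.
  move=> x _; rewrite -EFinD !abse_EFin lee_fin normrM.
  rewrite (ger0_norm (addr_ge0 (sqr_ge0 _) (sqr_ge0 _))).
  rewrite -(real_normK (num_real x.1)) -(real_normK (num_real x.2)).
  have := sqr_ge0 (`|x.1| - `|x.2|); have := normr_ge0 x.1; have := normr_ge0 x.2; nra.
have corrE : (\int[mu]_x (x.1 * x.2)%:E = corr%:E)%E.
  by rewrite /corr fineK //; exact: integrable_fin_num.
have hM : (\int[mu]_x (aff 1 1 0 x ^+ 2)%:E = (2 + 2 * corr)%:E)%E.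
  transitivity (\int[mu]_x ((x.1 ^+ 2)%:E + (x.2 ^+ 2)%:E + 2%:E * (x.1 * x.2)%:E))%E.
    apply: eq_integral => x _; rewrite -EFinM -!EFinD /aff; congr (_%:E); ring.
  rewrite integralD //; last 2 first.
  - exact: integrableD.
  - exact: integrableZl.
  by rewrite integralD // integralZl // mu1 mu2 corrE -EFinM -!EFinD.
have n1 : `|1 : R| <= 1 by rewrite normr1.
have h := @W2_test_cvg _ _ _ nu (fun=> true) 1 1 0 n1 n1 _ _ hM (W2 0).
rewrite nu_chi_true mul1r in h.
pose z n (i : 'I_n) := ((theta n i 0, th0 n i 0), [tuple delta n (nat_of_ord s) i | s < 1]).
have h2 : (fun n => (n%:R^-1 * \sum_(i < n) test_fun (fun=> true) 1 1 0 (z n i) -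
    n%:R^-1 * vdot (theta n) (theta n) - n%:R^-1 * vdot (th0 n) (th0 n)) * 2^-1) @ \oo -->
    (2 + 2 * corr - 1 - 1) * 2^-1.
  apply: cvgM; last exact: cvg_cst.
  by apply: cvgB th0_norm_cvg; apply: cvgB theta_norm_cvg.
have -> : corr = (2 + 2 * corr - 1 - 1) * 2^-1 by field.
apply: cvg_trans h2; apply: near_eq_cvg; apply: nearW => n /=.
rewrite -!mulrBr -!sumrB -[LHS]mulrA mulr_suml; congr (_ * _).
by apply: eq_bigr => i _; rewrite /test_fun /aff /=; field.
Qed.

(** For n >= 1 the masks at time t partition the coordinates, so their averages sum to 1, and this
    passes to the limit. *)
Lemma sum_p_last t : (0 < t)%N -> \sum_(s < t) p_last nu t s = 1.
Proof.
move=> t0.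
have h : (fun n => \sum_(s < t) entry_mean (msk n t s)) @ \oo --> \sum_(s < t) p_last nu t s.
  suff gen m : (m <= t)%N ->
      (fun n => \sum_(s < m) entry_mean (msk n t s)) @ \oo --> \sum_(s < m) p_last nu t s by exact: gen.
  elim: m => [_|m IH mt].
    rewrite big_ord0 (_ : (fun n => _) = fun=> 0); first exact: cvg_cst.
    by apply/funext => n; rewrite big_ord0.
  rewrite big_ord_recr /= (_ : (fun n => _) =
    fun n => \sum_(s < m) entry_mean (msk n t s) + entry_mean (msk n t m)).
    by apply: cvgD; [exact: IH (ltnW mt)|exact: mean_mask_cvg].
  by apply/funext => n; rewrite big_ord_recr.
apply: (cvg_unique _ h) => //; apply: cvg_near_cst; near=> n.
have n0 : n%:R != 0 :> R by rewrite pnatr_eq0 -lt0n; near: n; exists 1%N.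
rewrite /entry_mean -mulr_sumr exchange_big /=.
rewrite (eq_bigr (fun=> 1)); first by rewrite sumr_const card_ord mulVf.
move=> i _; case: t t0 {h} => // t _.
rewrite (bigD1 (Ordinal (tau_ltn (delta n) t i))) //= maskE eqxx big1 ?addr0 // => s sN.
rewrite maskE (_ : _ == _ = false) //; apply: contraNF sN => /eqP e.
by apply/eqP/val_inj.
Unshelve. all: by end_near. Qed.

End empirical_limits.

Section rho_recursion.
Context (R : realType) (lambda rho0 : R) (p : nat -> nat -> R).
Notation rho := (rho lambda rho0 p).

Lemma size_rho_seq t : size (rho_seq lambda rho0 p t) = t.+1.
Proof. by elim: t => //= t IH; rewrite size_rcons IH. Qed.

Lemma nth_rho_seq s t : (s <= t)%N -> nth 0 (rho_seq lambda rho0 p t) s = rho s.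
Proof.
elim: t => [|t IH]; first by rewrite leqn0 => /eqP ->.
rewrite leq_eqVlt ltnS => /predU1P[-> //|st].
by rewrite /= nth_rcons size_rho_seq ltnS st IH.
Qed.

Lemma rhoS t : rho t.+1 = lambda * (\sum_(s < t.+1) rho s * p t.+1 s) /
  Num.sqrt (\sum_(s < t.+1) (lambda ^+ 2 * rho s ^+ 2 + 1) * p t.+1 s).
Proof.
rewrite {1}/Defs.rho /= nth_rcons size_rho_seq ltnn eqxx.
congr (_ * _ / Num.sqrt _); apply: eq_bigr => s _; rewrite nth_rho_seq //; by rewrite -ltnS.
Qed.

End rho_recursion.

(** * Signal and noise parts for the spiked matrix *)

Section spiked_amp.
Context (R : realType) (n : nat) (theta th0 : 'cV[R]_n) (delta : nat -> 'I_n -> bool).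
Context (lambda : R) (Z : 'M[R]_n).
Hypothesis n_gt0 : (0 < n)%N.
Hypothesis delta0 : forall i, delta 0 i = true.
Let M := (lambda / n%:R) *: (theta *m theta^T) + Z.
Notation th := (theta_hat M th0 delta).
Notation msk := (mask R delta).

Definition overlap t : R := n%:R^-1 * vdot theta (th t).
(** For t >= 1 the same scalar normalizes [th t] and multiplies the mask averages in the memory term
    of time t; hence both fit into one pair of words with a common coefficient. *)
Definition scaling t : R := Num.sqrt n%:R / vnorm (xprev M th0 delta t).
Definition noise t : 'cV[R]_n :=
  Z *m th t - scaling t *: \sum_(s < t) entry_mean (msk t s) *: th s.

Let n0 : n%:R != 0 :> R. Proof. by rewrite pnatr_eq0 -lt0n. Qed.

(** The spike acts through the overlap, and w_ts divided by sqrt(n) times the norm of x_{t-1} is the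
    scaling times a mask average. *)
Lemma amp_yE t : amp_y M th0 delta t = (lambda * overlap t) *: theta + noise t.
Proof.
rewrite /amp_y /M mulmxDl -addrA; congr (_ + (_ - _)).
  rewrite -scalemxAl -mulmxA; apply/matrixP => i j; rewrite (ord1 j) mxE [RHS]mxE.
  rewrite [X in _ * X]mxE big_ord1 -vdotE /overlap; by ring.
rewrite !scaler_sumr; apply: eq_bigr => s _; rewrite !scalerA; congr (_ *: _).
rewrite wts_mask /scaling /entry_mean invfM.
have s0 : Num.sqrt n%:R != 0 :> R by rewrite gt_eqF // sqrtr_gt0 ltr0n.
have -> : (Num.sqrt n%:R)^-1 = Num.sqrt n%:R / n%:R :> R.
  have nE : n%:R = Num.sqrt n%:R * Num.sqrt n%:R :> R by rewrite -expr2 sqr_sqrtr.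
  by rewrite [X in _ / X]nE invfM mulrA divff // mul1r.
by ring.
Qed.

Lemma vdot_diag (a b : 'cV[R]_n) (e : 'rV[R]_n) :
  vdot a (diag_mx e *m b) = vdot (diag_mx e *m a) b.
Proof. by rewrite !vdotE trmx_mul tr_diag_mx mulmxA. Qed.

Lemma vdot_sumr (m : nat) (a : 'cV[R]_n) (F : 'I_m -> 'cV[R]_n) :
  vdot a (\sum_i F i) = \sum_i vdot a (F i).
Proof. by rewrite vdotE mulmx_sumr summxE; apply: eq_bigr => i _; rewrite vdotE. Qed.

(** Masks for different s have disjoint supports, so no cross terms occur. *)
Lemma vdot_xprev t :
  vdot (xprev M th0 delta t.+1) (xprev M th0 delta t.+1) =
  \sum_(s < t.+1) vdot (amp_y M th0 delta s) (diag_mx (msk t.+1 s) *m amp_y M th0 delta s).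
Proof.
rewrite {2}xprev_mask // vdot_sumr; apply: eq_bigr => s _; apply: eq_bigr => i _.
rewrite diag_entry maskE xprev_entry //; case: eqP => [->//|_].
by rewrite !mul0r !mulr0.
Qed.

Lemma scalingE t :
  scaling t = (Num.sqrt (n%:R^-1 * vdot (xprev M th0 delta t) (xprev M th0 delta t)))^-1.
Proof. by rewrite /scaling /vnorm sqrtrM ?invr_ge0 // sqrtrV // invfM invrK. Qed.

Lemma vdot_amp_y s (e : 'rV[R]_n) :
  n%:R^-1 * vdot (amp_y M th0 delta s) (diag_mx e *m amp_y M th0 delta s) =
  (lambda * overlap s) * (lambda * overlap s) * (n%:R^-1 * vdot theta (diag_mx e *m theta)) +
  2 * (lambda * overlap s) * (n%:R^-1 * vdot (diag_mx e *m theta) (noise s)) +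
  n%:R^-1 * vdot (noise s) (diag_mx e *m noise s).
Proof.
rewrite amp_yE; move: (noise s) => g.
rewrite mulmxDr -scalemxAr !(vdotDl, vdotDr, vdotZl, vdotZr).
by rewrite (vdotC g (diag_mx e *m theta)) (vdot_diag theta g); ring.
Qed.

Lemma overlapS t : overlap t.+1 = scaling t.+1 * \sum_(s < t.+1)
  (lambda * overlap s * (n%:R^-1 * vdot theta (diag_mx (msk t.+1 s) *m theta)) +
   n%:R^-1 * vdot (diag_mx (msk t.+1 s) *m theta) (noise s)).
Proof.
rewrite {1}/overlap theta_hatS -/(scaling t.+1) vdotZr mulrCA; congr (_ * _).
rewrite xprev_mask // vdot_sumr mulr_sumr; apply: eq_bigr => s _.
rewrite amp_yE; move: (noise s) => g.
by rewrite mulmxDr -scalemxAr vdotDr vdotZr (vdot_diag theta g); ring.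
Qed.

Lemma norm_theta_hatS t : n%:R^-1 * vdot (th t.+1) (th t.+1) =
  scaling t.+1 * scaling t.+1 *
  (n%:R^-1 * vdot (xprev M th0 delta t.+1) (xprev M th0 delta t.+1)).
Proof. by rewrite theta_hatS -/(scaling t.+1) vdotZl vdotZr; ring. Qed.

Lemma theta_hatS_mask t : th t.+1 = scaling t.+1 *: \sum_(s < t.+1)
  ((lambda * overlap s) *: (diag_mx (msk t.+1 s) *m theta) + diag_mx (msk t.+1 s) *m noise s).
Proof.
rewrite theta_hatS -/(scaling t.+1) xprev_mask //; congr (_ *: _).
by apply: eq_bigr => s _; rewrite amp_yE mulmxDr scalemxAr.
Qed.

(** Summand by summand, the second components belonging to [theta_hatS_mask]: an atom with the empty
    list for the signal, and the output of [vrep_mask] for the noise. *)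
Lemma noiseS_mask t : noise t.+1 = scaling t.+1 *: \sum_(s < t.+1)
  ((lambda * overlap s) *: (Z *m (diag_mx (msk t.+1 s) *m theta)) +
   (Z *m (diag_mx (msk t.+1 s) *m noise s) - entry_mean (msk t.+1 s) *: th s)).
Proof.
rewrite {1}/noise theta_hatS_mask -scalemxAr -scalerBr mulmx_sumr -sumrB; congr (_ *: _).
apply: eq_bigr => s _; move: (noise s) => g.
by rewrite mulmxDr -scalemxAr addrA.
Qed.

End spiked_amp.

(** * Induction over time *)

Section state_evolution_induction.
Context (R : realType) (theta th0 : forall n : nat, 'cV[R]_n).
Variable delta : forall n : nat, nat -> 'I_n -> bool.
Arguments delta : clear implicits.
Variable lambda : R.
Variables (mu : probability (R * R)%type R) (nu : probability bitstrings R).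
Context (dOm : nat -> measure_display) (Om : forall n, measurableType (dOm n)).
Variables (P : forall n, probability (Om n) R) (Z : forall n, Om n -> 'M[R]_n).
Arguments Z : clear implicits.
Hypothesis delta0 : forall n i, delta n 0 i = true.
Hypothesis goeZ : forall n, is_GOE (P n) (Z n).
Hypothesis mu1 : (\int[mu]_x (x.1 ^+ 2)%:E = 1)%E.
Hypothesis mu2 : (\int[mu]_x (x.2 ^+ 2)%:E = 1)%E.
Hypothesis W2 : forall t : nat, (fun n : nat =>
  W2sq (empirical (fun i : 'I_n =>
    ((theta n i 0, th0 n i 0), [tuple delta n (nat_of_ord s) i | s < t.+1])))
    (mu \x pushforward nu (init_bits t))%E) @ \oo --> 0%E.

Let M n (w : Om n) : 'M[R]_n := (lambda / n%:R) *: (theta n *m (theta n)^T) + Z n w.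
Let th t n (w : Om n) : 'cV[R]_n := theta_hat (M w) (th0 n) (delta n) t.
Let ov t n (w : Om n) : R := overlap (theta n) (th0 n) (delta n) lambda (Z n w) t.
Let sc t n (w : Om n) : R := scaling (theta n) (th0 n) (delta n) lambda (Z n w) t.
Let ns t n (w : Om n) : 'cV[R]_n := noise (theta n) (th0 n) (delta n) lambda (Z n w) t.
Arguments th : clear implicits.
Arguments ov : clear implicits.
Arguments sc : clear implicits.
Arguments ns : clear implicits.
Notation msk n t s := (mask R (delta n) t s).
Notation rho := (rho lambda (corr mu) (p_last nu)).
Notation cvp := (cvp P).
Notation vrep := (vrep P Z).

Lemma cvg_bounded_vec (h : forall n, 'cV[R]_n) (c : R) :
  (fun n => n%:R^-1 * vdot (h n) (h n)) @ \oo --> c -> bounded_vec h.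
Proof.
move=> /cvgrPdist_le /(_ 1 ltr01) [N _ hN].
exists (`|c| + 1), (maxn N 1); split; first by have := normr_ge0 c; lra.
move=> n; rewrite geq_max => /andP[Nn n1].
have n0 : 0 < n%:R :> R by rewrite ltr0n.
rewrite -ler_pdivrMr // mulrC; have /= := hN n Nn; rewrite ler_distl => /andP[h1 _].
have := ler_norm c; lra.
Qed.

(** Mask entries are 0 or 1, so the squared norm of the masked signal is the quantity in
    [theta_mask_cvg]. *)
Lemma bounded_mask_theta t s : (s < t)%N ->
  bounded_vec (fun n => diag_mx (msk n t s) *m theta n).
Proof.
move=> st; have := theta_mask_cvg delta0 mu1 W2 st => h.
apply: (@cvg_bounded_vec _ (p_last nu t s)); apply: cvg_trans h.
apply: near_eq_cvg; apply: nearW => n; congr (_ * _); apply: eq_bigr => i _.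
by rewrite !diag_entry maskE; case: eqP => _; rewrite ?mul1r ?mul0r ?mulr0.
Qed.

Lemma vrep_sum m (f g : 'I_m -> forall n, Om n -> 'cV[R]_n) :
  (forall i, vrep (f i) (g i)) ->
  vrep (fun n w => \sum_i f i n w) (fun n w => \sum_i g i n w).
Proof.
elim: m f g => [|m IH] f g h.
  by apply: (@vrep_eq _ _ _ _ _ 0) (vrep0 _ _) => n w _; rewrite !big_ord0.
have := vrepD (IH _ _ (fun i => h (widen_ord (leqnSn m) i))) (h ord_max).
by apply: (@vrep_eq _ _ _ _ _ 0) => n w _; rewrite !big_ord_recr.
Qed.

Lemma p_last_ge0 t s : 0 <= p_last nu t s.
Proof. exact: fine_ge0. Qed.

(** The norm belongs to the invariant because the masked noise energy is compared with <D> times the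
    squared norm of [th t]. *)
Definition state_evolution t := [/\ vrep (th t) (ns t), cvp (ov t) (rho t) &
  cvp (fun n w => n%:R^-1 * vdot (th t n w) (th t n w)) 1].

Lemma vrep_det (h : forall n, 'cV[R]_n) : bounded_vec h ->
  vrep (fun n _ => h n) (fun n w => Z n w *m h n).
Proof.
move=> hb; have hc n : contractions ([::] : seq 'rV[R]_n) by [].
have := @vrep_atom _ _ _ P Z (fun=> [::]) h 0 (fun=> erefl) hc hb.
by apply: (@vrep_eq _ _ _ _ _ 0) => n w _; rewrite /= mul1mx.
Qed.

Lemma state_evolution0 : state_evolution 0.
Proof.
split.
- have := vrep_det (cvg_bounded_vec (th0_norm_cvg mu2 W2)).
  apply: (@vrep_eq _ _ _ _ _ 0) => n w _; split=> //.
  by rewrite /ns /noise big_ord0 scaler0 subr0.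
- exact: (cvp_seq P (theta_th0_cvg mu1 mu2 W2)).
- exact: (cvp_seq P (th0_norm_cvg mu2 W2)).
Qed.

Section step.
Variable t : nat.
Hypothesis IH : forall s, (s <= t)%N -> state_evolution s.
Notation D n s := (msk n t.+1 s).
Notation p s := (p_last nu t.+1 s).

Lemma noise_theta_cvp (s : 'I_t.+1) :
  cvp (fun n w => n%:R^-1 * vdot (diag_mx (D n s) *m theta n) (ns s n w)) 0.
Proof.
have [hr _ _] := IH (ltn_ord s : (s <= t)%N).
exact: vrep_dot (bounded_mask_theta (ltn_ord s)) hr.
Qed.

Lemma theta_theta_cvp (s : 'I_t.+1) :
  cvp (fun n w => n%:R^-1 * vdot (theta n) (diag_mx (D n s) *m theta n)) (p s).
Proof. exact: (cvp_seq P (theta_mask_cvg delta0 mu1 W2 (ltn_ord s))). Qed.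

Lemma noise_noise_cvp (s : 'I_t.+1) :
  cvp (fun n w => n%:R^-1 * vdot (ns s n w) (diag_mx (D n s) *m ns s n w)) (p s).
Proof.
have [hr _ hn] := IH (ltn_ord s : (s <= t)%N).
have hm : cvp (fun n _ => entry_mean (D n s)) (p s).
  exact: (cvp_seq P (mean_mask_cvg delta0 W2 (ltn_ord s))).
have := cvpD (vrep_pair goeZ (fun n => @contraction_mask R n (delta n) t.+1 s) hr hr) (cvpM hm hn).
rewrite mulr1 add0r; apply: (@cvp_near_eq _ _ _ _ _ _ _ 0) => n w _.
by rewrite /pair_defect subrK.
Qed.

Definition power := \sum_(s < t.+1) (lambda ^+ 2 * rho s ^+ 2 + 1) * p s.

(** The p_t(s) sum to 1, so the power is at least 1, which keeps the normalization of x_t away from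
    zero. *)
Lemma power_gt0 : 0 < power.
Proof.
rewrite /power; under eq_bigr do rewrite mulrDl mul1r.
rewrite big_split /= (sum_p_last delta0 W2) // ltr_pwDr //.
apply: sumr_ge0 => s _; apply: mulr_ge0 (p_last_ge0 _ _).
by rewrite mulr_ge0 ?sqr_ge0.
Qed.

Lemma xprev_norm_cvp : cvp (fun n w => n%:R^-1 *
  vdot (xprev (M w) (th0 n) (delta n) t.+1) (xprev (M w) (th0 n) (delta n) t.+1)) power.
Proof.
have term (s : 'I_t.+1) : cvp (fun n w => n%:R^-1 *
    vdot (amp_y (M w) (th0 n) (delta n) s) (diag_mx (D n s) *m amp_y (M w) (th0 n) (delta n) s))
    ((lambda ^+ 2 * rho s ^+ 2 + 1) * p s).
  have [_ ho _] := IH (ltn_ord s : (s <= t)%N).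
  have hk := cvpM (cvp_cst P lambda) ho.
  have h1 := cvpM (cvpM hk hk) (theta_theta_cvp s).
  have h2 := cvpM (cvpM (cvp_cst P 2) hk) (noise_theta_cvp s).
  have := cvpD (cvpD h1 h2) (noise_noise_cvp s).
  rewrite (_ : _ + _ + _ = (lambda ^+ 2 * rho s ^+ 2 + 1) * p s); last by ring.
  by apply: (@cvp_near_eq _ _ _ _ _ _ _ 1) => n w n1; rewrite vdot_amp_y.
have := cvp_sum term; apply: (@cvp_near_eq _ _ _ _ _ _ _ 1) => n w n1.
by rewrite vdot_xprev // mulr_sumr.
Qed.

Lemma scaling_cvp : cvp (sc t.+1) (Num.sqrt power)^-1.
Proof.
have := cvp_inv_sqrt power_gt0 xprev_norm_cvp.
by apply: (@cvp_near_eq _ _ _ _ _ _ _ 1) => n w n1; rewrite /sc scalingE.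
Qed.

Lemma overlap_cvp : cvp (ov t.+1) (rho t.+1).
Proof.
have term (s : 'I_t.+1) : cvp (fun n w =>
    lambda * ov s n w * (n%:R^-1 * vdot (theta n) (diag_mx (D n s) *m theta n)) +
    n%:R^-1 * vdot (diag_mx (D n s) *m theta n) (ns s n w)) (lambda * (rho s * p s)).
  have [_ ho _] := IH (ltn_ord s : (s <= t)%N).
  have := cvpD (cvpM (cvpM (cvp_cst P lambda) ho) (theta_theta_cvp s)) (noise_theta_cvp s).
  by rewrite addr0 mulrA.
have := cvpM scaling_cvp (cvp_sum term).
rewrite rhoS -mulr_sumr mulrC.
by apply: (@cvp_near_eq _ _ _ _ _ _ _ 1) => n w n1; rewrite /ov overlapS.
Qed.

Lemma theta_hat_norm_cvp : cvp (fun n w => n%:R^-1 * vdot (th t.+1 n w) (th t.+1 n w)) 1.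
Proof.
have := cvpM (cvpM scaling_cvp scaling_cvp) xprev_norm_cvp.
rewrite (_ : _ * _ * power = 1).
  by apply: (@cvp_near_eq _ _ _ _ _ _ _ 1) => n w n1; rewrite /th norm_theta_hatS.
rewrite -expr2 exprVn sqr_sqrtr; last exact: ltW power_gt0.
by rewrite mulVf // gt_eqF // power_gt0.
Qed.

Lemma theta_hat_vrep : vrep (th t.+1) (ns t.+1).
Proof.
have term (s : 'I_t.+1) : vrep
    (fun n w => (lambda * ov s n w) *: (diag_mx (D n s) *m theta n) + diag_mx (D n s) *m ns s n w)
    (fun n w => (lambda * ov s n w) *: (Z n w *m (diag_mx (D n s) *m theta n)) +
      (Z n w *m (diag_mx (D n s) *m ns s n w) - entry_mean (D n s) *: th s n w)).
  have [hr ho _] := IH (ltn_ord s : (s <= t)%N).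
  apply: vrepD.
    exact: (vrepZ (cvpM (cvp_cst P lambda) ho) (vrep_det (bounded_mask_theta (ltn_ord s)))).
  exact: (vrep_mask (fun n => @contraction_mask R n (delta n) t.+1 s) hr).
have := vrepZ scaling_cvp (vrep_sum term).
apply: (@vrep_eq _ _ _ _ _ 1) => n w n1; split.
  by rewrite /th theta_hatS_mask.
by rewrite /ns noiseS_mask.
Qed.

End step.

Lemma state_evolutionP t : state_evolution t.
Proof.
elim/ltn_ind: t => -[_|t IH]; first exact: state_evolution0.
have IH' s : (s <= t)%N -> state_evolution s by move=> st; exact: IH.
split; [exact: theta_hat_vrep|exact: overlap_cvp|exact: theta_hat_norm_cvp].
Qed.

End state_evolution_induction.

Theorem theorem4 (R : realType)
    (* deterministic data, for each dimension n *)
    (theta th0 : forall n : nat, 'cV[R]_n)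
    (delta : forall n : nat, nat -> 'I_n -> bool)
    (lambda : R)
    (* the limiting measures *)
    (mu : probability (R * R)%type R)
    (nu : probability bitstrings R)
    (* the noise matrices Z ~ GOE(n), on a probability space for each n *)
    (dOm : nat -> measure_display) (Om : forall n, measurableType (dOm n))
    (P : forall n, probability (Om n) R)
    (Z : forall n, Om n -> 'M[R]_n) :
  0 <= lambda ->
  (forall n, vnorm (th0 n) = Num.sqrt n%:R) ->
  (forall n i, delta n 0 i = true) ->
  (forall n, is_GOE (P n) (Z n)) ->
  (\int[mu]_x (x.1 ^+ 2)%:E = 1)%E ->
  (\int[mu]_x (x.2 ^+ 2)%:E = 1)%E ->
  (forall t : nat,
     (fun n : nat =>
        W2sq
          (empirical (fun i : 'I_n =>
             ((theta n i 0, th0 n i 0), [tuple delta n (nat_of_ord s) i | s < t.+1])))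
          (mu \x pushforward nu (init_bits t))%E)
       @ \oo --> 0%E) ->
  let rho0 := fine (\int[mu]_x (x.1 * x.2)%:E)%E in
  let M n w := (lambda / n%:R) *: (theta n *m (theta n)^T) + Z n w in
  forall t : nat, (0 < t)%N ->
    forall eps : R, 0 < eps ->
      (fun n : nat =>
         P n [set w | eps < `| n%:R^-1 * vdot (theta n)
                                  (theta_hat (M n w) (th0 n) (delta n) t)
                              - rho lambda rho0 (p_last nu) t |])
      @ \oo --> 0%E.
Proof.
move=> _ _ delta0 goeZ mu1 mu2 W2 rho0 M t _ eps eps0.
have [_ ho _] := state_evolutionP lambda delta0 goeZ mu1 mu2 W2 t.
have mX n : measurable_fun setT (fun w => n%:R^-1 * vdot (theta n)
    (theta_hat (M n w) (th0 n) (delta n) t) - rho lambda rho0 (p_last nu) t).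
  apply: measurable_funB => //; apply: measurable_funM => //; apply: measurable_vdot => // i.
  have mM a b : measurable_fun setT (fun w => M n w a b).
    have [_ mZ _ _ _] := goeZ n.
    rewrite (_ : (fun w => _) = (fun w =>
      ((lambda / n%:R) *: (theta n *m (theta n)^T)) a b + Z n w a b)); last first.
      by apply/funext => w; rewrite /M mxE.
    exact: measurable_funD.
  exact: ((measurable_amp (th0 n) (delta n) mM t).1 t (leqnn t) i).
set F := fun n => P n _.
(* Convergence was obtained through exceptional sets; monotonicity of the measure requires the event
   itself to be measurable. *)
have mF n : measurable [set w | eps < `| n%:R^-1 * vdot (theta n)
    (theta_hat (M n w) (th0 n) (delta n) t) - rho lambda rho0 (p_last nu) t |].
  rewrite (_ : [set w | _] = setT `&` (fun w => `| n%:R^-1 * vdot (theta n)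
    (theta_hat (M n w) (th0 n) (delta n) t) - rho lambda rho0 (p_last nu) t |) @^-1` `]eps, +oo[).
    by apply: (measurableT_comp (@normr_measurable R setT) (mX n)).
  by apply/seteqP; split=> w /=; rewrite in_itv /= andbT; [|case].
have Ffin n : F n \is a fin_num by exact: fin_num_measure.
apply/fine_cvgP; split; first exact: nearW.
apply/cvgrPdist_le => eta eta0.
have [N hN] := ho _ _ eps0 eta0; exists N => // n /= /hN [B mB [PB hB]].
rewrite sub0r normrN ger0_norm ?fine_ge0 // -lee_fin fineK //.
(* Outside [B] the deviation is at most eps, so the event is contained in [B]. *)
apply: le_trans PB; apply: le_measure; rewrite ?inE // => w /= hw.
apply: contrapT => /hB; rewrite leNgt => /negP; exact.
Qed.
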